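(* There is an absolute constant $C>0$ such that for every $\beta\in(0,1)$, every sufficiently large $T$ and every $\sigma\in[1/2+1/\log_2T,\,1)$, we have $$Z_\beta(\sigma,T)\ge C\sqrt{\Gamma_\sigma(T^{1-\beta})}.$$
   Context: Here $\zeta$ is the Riemann zeta function and $\log_2T=\log\log T$. For $\beta\in(0,1)$, $$Z_\beta(\sigma,T):=\max_{T^\beta\le|t|\le T}|\zeta(\sigma+it)|.$$ For a finite set $\mathcal M$ of positive integers, $$S_\sigma(\mathcal M):=\sum_{m,n\in\mathcal M}\frac{\gcd(m,n)^\sigma}{\mathrm{lcm}(m,n)^\sigma},$$ and for a positive integer $N$, $$\Gamma_\sigma(N):=\sup_{|\mathcal M|=N}\frac{S_\sigma(\mathcal M)}{N},$$ the supremum being over all sets $\mathcal M$ of $N$ positive integers. For non-integer $x\ge1$, $\Gamma_\sigma(x)$ is understood as $\Gamma_\sigma(\lfloor x\rfloor)$. ''Sufficiently large $T$'' may depend on $\beta$. *)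

(* Defs.v *)
From Stdlib Require Import Reals Zfloor Lra Lia List.
From Coquelicot Require Import Coquelicot.
Import ListNotations.
Open Scope R_scope.

Definition Cexp (z : C) : C :=
  (exp (Re z) * cos (Im z), exp (Re z) * sin (Im z)).

(* [cpow x w] is x^w, meant for x > 0. *)
Definition cpow (x : R) (w : C) : C := Cexp (w * RtoC (ln x))%C.

Definition C_lim_seq (u : nat -> C) : C :=
  (real (Lim_seq (fun n => Re (u n))), real (Lim_seq (fun n => Im (u n)))).

Definition zeta_trunc (s : C) (N : nat) : C :=
  (sum_n_m (fun n => cpow (INR n) (- s)) 1 N
   - cpow (INR N) (1 - s) / (1 - s))%C.

(* The Riemann zeta function on the half-plane Re s > 0, s <> 1 (the values
   elsewhere are meaningless):
     zeta(s) = lim_N (sum_(1 <= n <= N) n^(-s) - N^(1-s) / (1-s)).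
   The limit exists there ([zeta_trunc_lim]), is holomorphic in s
   ([zeta_is_derive]) and equals sum_(n >= 1) n^(-s) when Re s > 1
   ([zeta_Dirichlet_series]), so it is the analytic continuation of the
   Dirichlet series. *)
Definition zeta (s : C) : C := C_lim_seq (zeta_trunc s).

(* For 0 < sigma, sigma <> 1 and T^beta <= T the supremum is a maximum:
   [Zbeta_is_max]. *)
Definition Zbeta (beta sigma T : R) : R :=
  real (Lub_Rbar (fun x => exists t : R,
    Rpower T beta <= Rabs t <= T /\ x = Cmod (zeta (sigma, t)))).

Definition Rsum (M : list nat) (f : nat -> R) : R :=
  fold_right Rplus 0 (map f M).

Definition gcd_sum (sigma : R) (M : list nat) : R :=
  Rsum M (fun m => Rsum M (fun n =>
    Rpower (INR (Nat.gcd m n)) sigma / Rpower (INR (Nat.lcm m n)) sigma)).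

(* A set of N positive integers is a duplicate-free list of length N. *)
Definition Gamma_set (sigma : R) (N : nat) (x : R) : Prop :=
  exists M : list nat,
    NoDup M /\ length M = N /\ (forall m, In m M -> (0 < m)%nat) /\
    x = gcd_sum sigma M / INR N.

(* The supremum is finite for sigma >= 0: [Gamma_is_lub]. *)
Definition Gamma (sigma : R) (N : nat) : R :=
  real (Lub_Rbar (Gamma_set sigma N)).

(* [Gamma] at a real argument x >= 1. *)
Definition GammaR (sigma x : R) : R := Gamma sigma (Z.to_nat (Zfloor x)).

Lemma Cexp_plus (z w : C) : Cexp (z + w)%C = (Cexp z * Cexp w)%C.
Proof.
unfold Cexp, Cmult, Cplus, Re, Im; simpl.
rewrite exp_plus, cos_plus, sin_plus; f_equal; ring.
Qed.

Lemma Cexp_0 : Cexp 0 = 1%C.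
Proof.
unfold Cexp, Re, Im; simpl; rewrite exp_0, cos_0, sin_0.
unfold RtoC; f_equal; ring.
Qed.

Lemma Cmod_Cexp (z : C) : Cmod (Cexp z) = exp (Re z).
Proof.
unfold Cmod, Cexp; simpl.
replace (_ + _) with (exp (Re z) ^ 2).
- apply sqrt_pow2; left; apply exp_pos.
- generalize (sin2_cos2 (Im z)); unfold Rsqr; nra.
Qed.

Lemma Cmod_cpow (x : R) (w : C) : Cmod (cpow x w) = Rpower x (Re w).
Proof.
unfold cpow; rewrite Cmod_Cexp; unfold Rpower; f_equal.
destruct w; unfold Re; simpl; ring.
Qed.

Lemma Cmod_le_Re_Im (z : C) : Cmod z <= Rabs (Re z) + Rabs (Im z).
Proof.
assert (H : z = (RtoC (Re z) + Ci * RtoC (Im z))%C).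
{ destruct z; unfold Cplus, Cmult, RtoC, Ci, Re, Im; simpl; f_equal; ring. }
rewrite H at 1.
eapply Rle_trans; [apply Cmod_triangle|].
rewrite Cmod_mult, !Cmod_R, Cmod_Ci; lra.
Qed.

Lemma im_le_Cmod' (z : C) : Rabs (Im z) <= Cmod z.
Proof. eapply Rle_trans; [apply Rmax_r|apply (Rmax_Cmod z)]. Qed.

Definition Cder (f : R -> C) (x : R) (l : C) : Prop :=
  is_derive (fun t => Re (f t)) x (Re l) /\
  is_derive (fun t => Im (f t)) x (Im l).

Lemma Cder_eq f x l l' : Cder f x l -> l = l' -> Cder f x l'.
Proof. now intros H <-. Qed.

Lemma Cder_const (c : C) x : Cder (fun _ => c) x 0.
Proof. split; apply @is_derive_const. Qed.

Lemma Cder_RtoC (f : R -> R) x l :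
  is_derive f x l -> Cder (fun t => RtoC (f t)) x (RtoC l).
Proof. intros H; split; [exact H|exact (is_derive_const 0 x)]. Qed.

Lemma Cder_plus f g x lf lg :
  Cder f x lf -> Cder g x lg -> Cder (fun t => f t + g t)%C x (lf + lg)%C.
Proof. intros [H1 H2] [H3 H4]; split; apply @is_derive_plus; assumption. Qed.

Lemma is_derive_Rmult (a b : R -> R) x la lb :
  is_derive a x la -> is_derive b x lb ->
  is_derive (fun t => a t * b t) x (la * b x + a x * lb).
Proof.
intros Ha Hb.
apply (is_derive_mult a b x la lb Ha Hb); intros; apply Rmult_comm.
Qed.

Lemma Cder_mult f g x lf lg :
  Cder f x lf -> Cder g x lg ->
  Cder (fun t => f t * g t)%C x (lf * g x + f x * lg)%C.
Proof.
intros [H1 H2] [H3 H4]; split.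
- replace (Re (lf * g x + f x * lg)%C) with
    ((Re lf * Re (g x) + Re (f x) * Re lg)
     - (Im lf * Im (g x) + Im (f x) * Im lg))
    by (unfold Re, Im, Cplus, Cmult; simpl; ring).
  exact (is_derive_minus _ _ _ _ _ (is_derive_Rmult _ _ _ _ _ H1 H3)
           (is_derive_Rmult _ _ _ _ _ H2 H4)).
- replace (Im (lf * g x + f x * lg)%C) with
    ((Re lf * Im (g x) + Re (f x) * Im lg)
     + (Im lf * Re (g x) + Im (f x) * Re lg))
    by (unfold Re, Im, Cplus, Cmult; simpl; ring).
  exact (is_derive_plus _ _ _ _ _ (is_derive_Rmult _ _ _ _ _ H1 H4)
           (is_derive_Rmult _ _ _ _ _ H2 H3)).
Qed.

Lemma Cder_Cexp f x l :
  Cder f x l -> Cder (fun t => Cexp (f t)) x (l * Cexp (f x))%C.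
Proof.
intros [H1 H2].
assert (He := is_derive_comp exp _ _ _ _ (is_derive_exp _) H1).
assert (Hc := is_derive_comp cos _ _ _ _ (is_derive_cos _) H2).
assert (Hs := is_derive_comp sin _ _ _ _ (is_derive_sin _) H2).
split; unfold Cexp.
- eapply is_derive_ext; [|eapply Logic.eq_ind;
    [exact (is_derive_Rmult _ _ _ _ _ He Hc)|]]; [reflexivity|].
  unfold Re, Im, Cmult, scal; simpl; unfold mult; simpl; ring.
- eapply is_derive_ext; [|eapply Logic.eq_ind;
    [exact (is_derive_Rmult _ _ _ _ _ He Hs)|]]; [reflexivity|].
  unfold Re, Im, Cmult, scal; simpl; unfold mult; simpl; ring.
Qed.

Lemma Rmvt_le (f g f' g' : R -> R) :
  (forall t, 0 <= t <= 1 -> is_derive f t (f' t)) ->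
  (forall t, 0 <= t <= 1 -> is_derive g t (g' t)) ->
  (forall t, 0 <= t <= 1 -> f' t <= g' t) ->
  f 1 - f 0 <= g 1 - g 0.
Proof.
intros Hf Hg H.
destruct (MVT_gen (fun t => g t - f t) 0 1 (fun t => g' t - f' t))
  as [c [Hc E]].
- intros t Ht; rewrite Rmin_left, Rmax_right in Ht by lra.
  apply @is_derive_minus; [apply Hg|apply Hf]; lra.
- intros t Ht; rewrite Rmin_left, Rmax_right in Ht by lra.
  apply derivable_continuous_pt; exists (g' t - f' t).
  apply is_derive_Reals, @is_derive_minus; [apply Hg|apply Hf]; lra.
- rewrite Rmin_left, Rmax_right in Hc by lra.
  specialize (H c Hc); lra.
Qed.

Lemma Cmvt (f f' : R -> C) (g g' : R -> R) :
  (forall t, 0 <= t <= 1 -> Cder f t (f' t)) ->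
  (forall t, 0 <= t <= 1 -> is_derive g t (g' t)) ->
  (forall t, 0 <= t <= 1 -> Cmod (f' t) <= g' t) ->
  Cmod (f 1 - f 0)%C <= 2 * (g 1 - g 0).
Proof.
intros Hf Hg H.
assert (R1 : Rabs (Re (f 1) - Re (f 0)) <= g 1 - g 0).
{ apply Rabs_le; split.
  - cut (- Re (f 1) - - Re (f 0) <= g 1 - g 0); [lra|].
    apply (Rmvt_le (fun t => - Re (f t)) g (fun t => - Re (f' t)) g'); auto.
    + intros t Ht; apply @is_derive_opp, (Hf t Ht).
    + intros t Ht; specialize (H t Ht).
      generalize (re_le_Cmod (f' t)); unfold Rabs; destruct Rcase_abs; lra.
  - apply (Rmvt_le (fun t => Re (f t)) g (fun t => Re (f' t)) g'); auto.
    + intros t Ht; apply (Hf t Ht).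
    + intros t Ht; specialize (H t Ht).
      generalize (re_le_Cmod (f' t)); unfold Rabs; destruct Rcase_abs; lra. }
assert (R2 : Rabs (Im (f 1) - Im (f 0)) <= g 1 - g 0).
{ apply Rabs_le; split.
  - cut (- Im (f 1) - - Im (f 0) <= g 1 - g 0); [lra|].
    apply (Rmvt_le (fun t => - Im (f t)) g (fun t => - Im (f' t)) g'); auto.
    + intros t Ht; apply @is_derive_opp, (Hf t Ht).
    + intros t Ht; specialize (H t Ht).
      generalize (im_le_Cmod' (f' t)); unfold Rabs; destruct Rcase_abs; lra.
  - apply (Rmvt_le (fun t => Im (f t)) g (fun t => Im (f' t)) g'); auto.
    + intros t Ht; apply (Hf t Ht).
    + intros t Ht; specialize (H t Ht).
      generalize (im_le_Cmod' (f' t)); unfold Rabs; destruct Rcase_abs; lra. }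
eapply Rle_trans; [apply Cmod_le_Re_Im|].
change (Re (f 1 - f 0)%C) with (Re (f 1) - Re (f 0)).
change (Im (f 1 - f 0)%C) with (Im (f 1) - Im (f 0)).
lra.
Qed.

Lemma Cder_scal_id (z : C) t : Cder (fun t => RtoC t * z)%C t z.
Proof.
eapply Cder_eq.
- apply Cder_mult; [exact (Cder_RtoC (fun t => t) t 1 (is_derive_id t))|].
  apply Cder_const.
- cbv beta; ring.
Qed.

Lemma Cexp_bound1 (z : C) :
  Cmod (Cexp z - 1)%C <= 2 * Cmod z * exp (Cmod z).
Proof.
replace (Cexp z - 1)%C with (Cexp (RtoC 1 * z) - Cexp (RtoC 0 * z))%C.
2: { replace (RtoC 0 * z)%C with (RtoC 0) by ring; rewrite Cexp_0.
     now replace (RtoC 1 * z)%C with z by ring. }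
eapply Rle_trans;
  [apply (Cmvt (fun t => Cexp (RtoC t * z)) (fun t => z * Cexp (RtoC t * z))%C
     (fun t => t * (Cmod z * exp (Cmod z))) (fun t => Cmod z * exp (Cmod z)))|].
- intros t _; apply Cder_Cexp, Cder_scal_id.
- intros t _; auto_derive; [trivial|ring].
- intros t Ht; rewrite Cmod_mult, Cmod_Cexp.
  apply Rmult_le_compat_l; [apply Cmod_ge_0|].
  assert (K : Re (RtoC t * z)%C <= Cmod z).
  { eapply Rle_trans; [apply Rle_abs|].
    eapply Rle_trans; [apply re_le_Cmod|].
    rewrite Cmod_mult, Cmod_R, Rabs_pos_eq by lra.
    generalize (Cmod_ge_0 z); nra. }
  destruct K as [K|K]; [left; now apply exp_increasing|rewrite K; lra].
- simpl; lra.
Qed.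

Lemma Cexp_bound2 (z : C) :
  Cmod (Cexp z - 1 - z)%C <= 4 * Cmod z ^ 2 * exp (Cmod z).
Proof.
replace (Cexp z - 1 - z)%C
  with ((Cexp (RtoC 1 * z) + - (RtoC 1 * z))
        - (Cexp (RtoC 0 * z) + - (RtoC 0 * z)))%C.
2: { replace (RtoC 0 * z)%C with (RtoC 0) by ring; rewrite Cexp_0.
     replace (RtoC 1 * z)%C with z by ring; ring. }
eapply Rle_trans;
  [apply (Cmvt (fun t => Cexp (RtoC t * z) + - (RtoC t * z))%C
     (fun t => z * (Cexp (RtoC t * z) - 1))%C
     (fun t => t * (2 * Cmod z ^ 2 * exp (Cmod z)))
     (fun t => 2 * Cmod z ^ 2 * exp (Cmod z)))|].
- intros t _; eapply Cder_eq.
  + apply Cder_plus; [apply Cder_Cexp, Cder_scal_id|].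
    assert (K := Cder_mult (fun _ => RtoC (-1)) _ t _ _ (Cder_const _ t)
       (Cder_scal_id z t)).
    destruct K as [K1 K2]; split.
    * eapply is_derive_ext; [|exact K1].
      intros u; unfold Re; simpl; ring.
    * eapply is_derive_ext; [|exact K2].
      intros u; unfold Im; simpl; ring.
  + cbv beta; change (-1) with (Ropp 1); rewrite RtoC_opp; ring.
- intros t _; auto_derive; [trivial|ring].
- intros t Ht; rewrite Cmod_mult.
  eapply Rle_trans;
    [apply Rmult_le_compat_l; [apply Cmod_ge_0|apply Cexp_bound1]|].
  assert (K : Cmod (RtoC t * z) <= Cmod z).
  { rewrite Cmod_mult, Cmod_R, Rabs_pos_eq by lra.
    generalize (Cmod_ge_0 z); nra. }
  assert (K' : exp (Cmod (RtoC t * z)) <= exp (Cmod z)).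
  { destruct K as [K|K]; [left; now apply exp_increasing|rewrite K; lra]. }
  replace (2 * Cmod z ^ 2 * exp (Cmod z))
    with (Cmod z * (2 * Cmod z * exp (Cmod z))) by ring.
  apply Rmult_le_compat_l; [apply Cmod_ge_0|].
  generalize (Cmod_ge_0 (RtoC t * z)%C); intros K0.
  apply Rmult_le_compat; [lra|left; apply exp_pos|lra|exact K'].
- simpl; lra.
Qed.

Lemma Cexp_RtoC (r : R) : Cexp (RtoC r) = RtoC (exp r).
Proof.
unfold Cexp, RtoC, Re, Im; simpl; rewrite cos_0, sin_0; f_equal; ring.
Qed.

Lemma cpow_succ (y : R) (w : C) :
  0 < y -> cpow y (1 - w)%C = (RtoC y * cpow y (- w))%C.
Proof.
intros Hy; unfold cpow.
replace ((1 - w) * RtoC (ln y))%C with (RtoC (ln y) + - w * RtoC (ln y))%C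
  by ring.
now rewrite Cexp_plus, Cexp_RtoC, exp_ln.
Qed.

Lemma cpow_plus (y : R) (v w : C) :
  cpow y (v + w)%C = (cpow y v * cpow y w)%C.
Proof. unfold cpow; rewrite <- Cexp_plus; f_equal; ring. Qed.

Lemma is_derive_ln_shift a x :
  0 < a + x -> is_derive (fun t => ln (a + t)) x (/ (a + x)).
Proof. intros H; auto_derive; [exact H|field; lra]. Qed.

Lemma Cder_cpow (a x : R) (w : C) :
  0 < a + x ->
  Cder (fun t => cpow (a + t) w) x
    (w * RtoC (/ (a + x)) * cpow (a + x) w)%C.
Proof.
intros H; unfold cpow; eapply Cder_eq.
- apply Cder_Cexp, Cder_mult; [apply Cder_const|].
  apply (Cder_RtoC (fun t => ln (a + t))), is_derive_ln_shift, H.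
- cbv beta; ring.
Qed.

Lemma Cder_opp f x l : Cder f x l -> Cder (fun t => - f t)%C x (- l)%C.
Proof. intros [H1 H2]; split; apply @is_derive_opp; assumption. Qed.

(* zeta_trunc s (n+1) - zeta_trunc s n = zstep s n 1 - zstep s n 0, and
   likewise for the derivative in s. *)
Definition zstep (s : C) (a x : R) : C :=
  (RtoC x * cpow (a + x) (- s) - cpow (a + x) (1 - s) / (1 - s))%C.

Definition dzstep (s : C) (a x : R) : C :=
  (- (RtoC x * RtoC (ln (a + x)) * cpow (a + x) (- s))
   + RtoC (ln (a + x)) * cpow (a + x) (1 - s) / (1 - s)
   - cpow (a + x) (1 - s) / ((1 - s) * (1 - s)))%C.

Definition dzeta_trunc (s : C) (N : nat) : C :=
  (sum_n_m (fun n => - (RtoC (ln (INR n)) * cpow (INR n) (- s)))%C 1 N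
   + RtoC (ln (INR N)) * cpow (INR N) (1 - s) / (1 - s)
   - cpow (INR N) (1 - s) / ((1 - s) * (1 - s)))%C.

Lemma one_minus_neq_0 (s : C) : s <> 1%C -> (1 - s)%C <> 0%C.
Proof.
intros H K; apply H.
replace s with (1 - (1 - s))%C by ring; rewrite K; ring.
Qed.

Lemma Cder_id x : Cder (fun t => RtoC t) x 1.
Proof. exact (Cder_RtoC (fun t => t) x 1 (is_derive_id x)). Qed.

Lemma RtoC_neq_0 (y : R) : 0 < y -> RtoC y <> 0%C.
Proof. intros H K; apply RtoC_inj in K; lra. Qed.

Lemma Cder_zstep (s : C) a x : 0 < a + x -> s <> 1%C ->
  Cder (zstep s a) x
   (- s * RtoC x * RtoC (/ (a + x)) * cpow (a + x) (- s))%C.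
Proof.
intros H Hs; apply one_minus_neq_0 in Hs.
eapply Cder_eq.
- unfold zstep, Cminus, Cdiv at 1.
  apply Cder_plus.
  + apply Cder_mult; [apply Cder_id|apply Cder_cpow, H].
  + apply Cder_opp, Cder_mult; [apply Cder_cpow, H|apply Cder_const].
- cbv beta; fold (1 - s)%C; rewrite (cpow_succ (a + x) s) by exact H.
  rewrite RtoC_inv by lra. field.
  split; [apply RtoC_neq_0, H|exact Hs].
Qed.

Lemma Cder_dzstep (s : C) a x : 0 < a + x -> s <> 1%C ->
  Cder (dzstep s a) x
   (RtoC x * RtoC (/ (a + x)) * cpow (a + x) (- s)
    * (s * RtoC (ln (a + x)) - 1))%C.
Proof.
intros H Hs; apply one_minus_neq_0 in Hs.
eapply Cder_eq.
- unfold dzstep, Cminus, Cdiv.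
  apply Cder_plus; [apply Cder_plus|].
  + apply Cder_opp, Cder_mult; [apply Cder_mult; [apply Cder_id|]|].
    * apply (Cder_RtoC (fun t => ln (a + t))), is_derive_ln_shift, H.
    * apply Cder_cpow, H.
  + apply Cder_mult; [apply Cder_mult|apply Cder_const].
    * apply (Cder_RtoC (fun t => ln (a + t))), is_derive_ln_shift, H.
    * apply Cder_cpow, H.
  + apply Cder_opp, Cder_mult; [apply Cder_cpow, H|apply Cder_const].
- cbv beta; fold (1 - s)%C; rewrite (cpow_succ (a + x) s) by exact H.
  rewrite RtoC_inv by lra. field.
  split; [apply RtoC_neq_0, H|exact Hs].
Qed.

Lemma zeta_trunc_S (s : C) n : (1 <= n)%nat ->
  (zeta_trunc s (S n) - zeta_trunc s n
   = zstep s (INR n) 1 - zstep s (INR n) 0)%C.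
Proof.
intros H; unfold zeta_trunc, zstep.
rewrite sum_n_Sm by lia; rewrite S_INR, Rplus_0_r.
change plus with Cplus; ring.
Qed.

Lemma dzeta_trunc_S (s : C) n : (1 <= n)%nat ->
  (dzeta_trunc s (S n) - dzeta_trunc s n
   = dzstep s (INR n) 1 - dzstep s (INR n) 0)%C.
Proof.
intros H; unfold dzeta_trunc, dzstep.
rewrite sum_n_Sm by lia; rewrite S_INR, Rplus_0_r.
change plus with Cplus; ring.
Qed.

Lemma step_bound (f f' : R -> C) (a K d : R) :
  1 <= a -> 0 < d ->
  (forall x, 0 <= x <= 1 -> Cder f x (f' x)) ->
  (forall x, 0 <= x <= 1 -> Cmod (f' x) <= K * Rpower (a + x) (- d - 1)) ->
  Cmod (f 1 - f 0)%C
  <= 2 * K / d * (Rpower a (- d) - Rpower (a + 1) (- d)).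
Proof.
intros Ha Hd Hf Hb.
eapply Rle_trans; [apply (Cmvt f f' (fun x => - (K / d) * Rpower (a + x) (- d))
  (fun x => K * Rpower (a + x) (- d - 1)) Hf)|].
- intros x Hx; unfold Rpower; auto_derive; [lra|].
  replace ((- d - 1) * ln (a + x)) with (- d * ln (a + x) + - ln (a + x))
    by ring.
  rewrite exp_plus, exp_Ropp, exp_ln by lra; field; lra.
- exact Hb.
- rewrite Rplus_0_r; right; field; lra.
Qed.

Lemma telescope (u : nat -> C) (c d : R) :
  (forall n, (1 <= n)%nat -> Cmod (u (S n) - u n)%C
     <= c * (Rpower (INR n) (- d) - Rpower (INR n + 1) (- d))) ->
  forall n k, (1 <= n)%nat -> Cmod (u (n + k)%nat - u n)%C
     <= c * (Rpower (INR n) (- d) - Rpower (INR (n + k)) (- d)).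
Proof.
intros H n k Hn; induction k as [|k IH].
- rewrite Nat.add_0_r; replace (u n - u n)%C with (RtoC 0) by ring.
  rewrite Cmod_0; lra.
- rewrite Nat.add_succ_r, S_INR.
  replace (u (S (n + k)) - u n)%C
    with ((u (S (n + k)) - u (n + k)%nat) + (u (n + k)%nat - u n))%C by ring.
  eapply Rle_trans; [apply Cmod_triangle|].
  assert (Hk := H (n + k)%nat ltac:(lia)); lra.
Qed.

Lemma Rpower_INR_lim (d : R) : 0 < d ->
  is_lim_seq (fun n => Rpower (INR n) (- d)) 0.
Proof.
intros Hd; unfold Rpower.
apply (is_lim_comp_seq exp (fun n => - d * ln (INR n)) m_infty 0).
- apply is_lim_exp_m.
- exists 0%nat; intros n _; discriminate.
- replace m_infty with (Rbar_mult (- d) p_infty).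
  + apply (is_lim_seq_scal_l (fun n => ln (INR n)) (- d) p_infty).
    apply (is_lim_comp_seq ln INR p_infty p_infty).
    * apply is_lim_ln_p.
    * exists 0%nat; intros n _; discriminate.
    * apply is_lim_seq_INR.
  + simpl.
    destruct (Rle_dec 0 (- d)) as [K|K]; [exfalso; lra|reflexivity].
Qed.

Lemma Rpower_INR_small (c d eps : R) : 0 <= c -> 0 < d -> 0 < eps ->
  exists N, (1 <= N)%nat /\
    forall n, (N <= n)%nat -> c * Rpower (INR n) (- d) < eps.
Proof.
intros Hc Hd He.
assert (L := Rpower_INR_lim d Hd).
apply (is_lim_seq_scal_l _ c) in L.
simpl in L; rewrite Rmult_0_r in L.
apply is_lim_seq_spec in L; destruct (L (mkposreal eps He)) as [N HN].
exists (S N); split; [lia|]; intros n Hn.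
specialize (HN n ltac:(lia)); simpl in HN.
rewrite Rminus_0_r in HN; revert HN; unfold Rabs; destruct Rcase_abs; lra.
Qed.

Lemma C_lim_seq_tele (u : nat -> C) (c d : R) :
  0 <= c -> 0 < d ->
  (forall n, (1 <= n)%nat -> Cmod (u (S n) - u n)%C
     <= c * (Rpower (INR n) (- d) - Rpower (INR n + 1) (- d))) ->
  is_lim_seq (fun n => Re (u n)) (Re (C_lim_seq u)) /\
  is_lim_seq (fun n => Im (u n)) (Im (C_lim_seq u)).
Proof.
intros Hc Hd H.
assert (T : forall eps : posreal, exists N, forall n m, (N <= n)%nat ->
  (N <= m)%nat -> Cmod (u n - u m)%C < eps).
{ intros eps.
  destruct (Rpower_INR_small c d (eps / 2) Hc Hd) as [N [HN1 HN]];
    [generalize (cond_pos eps); lra|].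
  assert (A : forall n, (N <= n)%nat -> Cmod (u n - u N)%C < eps / 2).
  { intros n Hn; eapply Rle_lt_trans; [|apply (HN N); lia].
    replace n with (N + (n - N))%nat at 1 by lia.
    eapply Rle_trans; [apply (telescope u c d H); lia|].
    apply Rmult_le_compat_l; [exact Hc|].
    unfold Rpower at 2; generalize (exp_pos (- d * ln (INR (N + (n - N))))).
    lra. }
  exists N; intros n m Hn Hm.
  replace (u n - u m)%C with ((u n - u N) + - (u m - u N))%C by ring.
  eapply Rle_lt_trans; [apply Cmod_triangle|]; rewrite Cmod_opp.
  generalize (A n Hn) (A m Hm); lra. }
split; unfold C_lim_seq; simpl.
- assert (X : ex_finite_lim_seq (fun n => Re (u n))).
  { apply ex_lim_seq_cauchy_corr; intros eps.
    destruct (T eps) as [N HN]; exists N; intros n m Hn Hm.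
    eapply Rle_lt_trans; [|apply (HN n m Hn Hm)].
    apply (re_le_Cmod (u n - u m)%C). }
  destruct X as [l Hl]; rewrite (is_lim_seq_unique _ _ Hl); exact Hl.
- assert (X : ex_finite_lim_seq (fun n => Im (u n))).
  { apply ex_lim_seq_cauchy_corr; intros eps.
    destruct (T eps) as [N HN]; exists N; intros n m Hn Hm.
    eapply Rle_lt_trans; [|apply (HN n m Hn Hm)].
    apply (im_le_Cmod' (u n - u m)%C). }
  destruct X as [l Hl]; rewrite (is_lim_seq_unique _ _ Hl); exact Hl.
Qed.

Lemma C_lim_bound (u : nat -> C) (l : C) (B : R) :
  is_lim_seq (fun n => Re (u n)) (Re l) ->
  is_lim_seq (fun n => Im (u n)) (Im l) ->
  (exists N, forall n, (N <= n)%nat -> Cmod (u n) <= B) ->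
  Cmod l <= 2 * B.
Proof.
intros H1 H2 [N HN].
eapply Rle_trans; [apply Cmod_le_Re_Im|].
assert (Rabs (Re l) <= B).
{ apply is_lim_seq_abs in H1.
  refine (is_lim_seq_le_loc _ _ (Rabs (Re l)) B _ H1 (is_lim_seq_const B)).
  exists N; intros n Hn; eapply Rle_trans; [apply re_le_Cmod|auto]. }
assert (Rabs (Im l) <= B).
{ apply is_lim_seq_abs in H2.
  refine (is_lim_seq_le_loc _ _ (Rabs (Im l)) B _ H2 (is_lim_seq_const B)).
  exists N; intros n Hn; eapply Rle_trans; [apply im_le_Cmod'|auto]. }
lra.
Qed.

Lemma ln_ge_0 y : 1 <= y -> 0 <= ln y.
Proof. intros H; rewrite <- ln_1; apply ln_le; lra. Qed.

Lemma ln_le_Rpower (y e : R) : 1 <= y -> 0 < e -> ln y <= / e * Rpower y e.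
Proof.
intros Hy He; apply Rmult_le_reg_l with e; [exact He|].
rewrite <- Rmult_assoc, Rinv_r, Rmult_1_l by lra.
unfold Rpower; generalize (exp_ineq1_le (e * ln y)); lra.
Qed.

Lemma Rpower_le_exp (y a b : R) : 1 <= y -> a <= b -> Rpower y a <= Rpower y b.
Proof. intros Hy Hab; now apply Rle_Rpower. Qed.

Lemma Cmod_term (s : C) (a x : R) : 1 <= a -> 0 <= x <= 1 ->
  Cmod (RtoC x * RtoC (/ (a + x)) * cpow (a + x) (- s))%C
  <= Rpower (a + x) (- Re s - 1).
Proof.
intros Ha Hx.
rewrite !Cmod_mult, !Cmod_R, Cmod_cpow.
rewrite (Rabs_pos_eq x) by lra.
assert (Hi : 0 < / (a + x)) by (apply Rinv_0_lt_compat; lra).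
rewrite (Rabs_pos_eq (/ (a + x))) by lra.
change (Re (- s)%C) with (- Re s).
replace (Rpower (a + x) (- Re s - 1))
  with (1 * / (a + x) * Rpower (a + x) (- Re s)).
- apply Rmult_le_compat_r; [left; apply exp_pos|].
  apply Rmult_le_compat_r; lra.
- unfold Rminus; rewrite Rpower_plus, (Rpower_Ropp _ 1), Rpower_1 by lra; ring.
Qed.

Lemma zeta_trunc_step (s : C) n : 0 < Re s -> s <> 1%C -> (1 <= n)%nat ->
  Cmod (zeta_trunc s (S n) - zeta_trunc s n)%C
  <= 2 * Cmod s / (Re s / 2)
     * (Rpower (INR n) (- (Re s / 2)) - Rpower (INR n + 1) (- (Re s / 2))).
Proof.
intros Hs H1 Hn.
assert (Ha : 1 <= INR n) by (apply (le_INR 1); lia).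
rewrite zeta_trunc_S by exact Hn.
eapply step_bound; [exact Ha|lra| |].
- intros x Hx; apply Cder_zstep; [lra|exact H1].
- intros x Hx; cbv beta.
  replace (- s * RtoC x * RtoC (/ (INR n + x)) * cpow (INR n + x) (- s))%C
    with (- s * (RtoC x * RtoC (/ (INR n + x)) * cpow (INR n + x) (- s)))%C
    by ring.
  rewrite Cmod_mult, Cmod_opp.
  apply Rmult_le_compat_l; [apply Cmod_ge_0|].
  eapply Rle_trans; [now apply Cmod_term|].
  apply Rpower_le_exp; lra.
Qed.

Lemma dzeta_trunc_step (s : C) n : 0 < Re s -> s <> 1%C -> (1 <= n)%nat ->
  Cmod (dzeta_trunc s (S n) - dzeta_trunc s n)%C
  <= 2 * (Cmod s / (Re s / 2) + 1) / (Re s / 2)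
     * (Rpower (INR n) (- (Re s / 2)) - Rpower (INR n + 1) (- (Re s / 2))).
Proof.
intros Hs H1 Hn.
assert (Ha : 1 <= INR n) by (apply (le_INR 1); lia).
rewrite dzeta_trunc_S by exact Hn.
eapply step_bound; [exact Ha|lra| |].
- intros x Hx; apply Cder_dzstep; [lra|exact H1].
- intros x Hx; cbv beta.
  rewrite Cmod_mult.
  set (y := INR n + x) in *.
  assert (Hy : 1 <= y) by (unfold y; lra).
  replace (- (Re s / 2) - 1) with ((- Re s - 1) + Re s / 2) by field.
  rewrite Rpower_plus, <- Rmult_assoc, (Rmult_comm _ (Rpower y (- Re s - 1))),
    Rmult_assoc.
  apply Rmult_le_compat; try apply Cmod_ge_0; [now apply Cmod_term|].
  unfold Cminus; eapply Rle_trans; [apply Cmod_triangle|].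
  rewrite Cmod_opp, Cmod_mult, !Cmod_R, Rabs_R1.
  rewrite Rabs_pos_eq by now apply ln_ge_0.
  assert (L := ln_le_Rpower y (Re s / 2) Hy ltac:(lra)).
  assert (P : 1 <= Rpower y (Re s / 2)).
  { rewrite <- (Rpower_O y) by lra; apply Rpower_le_exp; lra. }
  apply (Rmult_le_compat_l (Cmod s)) in L; [|apply Cmod_ge_0].
  unfold Rdiv at 1; rewrite Rmult_plus_distr_r; lra.
Qed.

Lemma zeta_trunc_lim (s : C) : 0 < Re s -> s <> 1%C ->
  is_lim_seq (fun n => Re (zeta_trunc s n)) (Re (zeta s)) /\
  is_lim_seq (fun n => Im (zeta_trunc s n)) (Im (zeta s)).
Proof.
intros Hs H1; unfold zeta.
apply (C_lim_seq_tele (zeta_trunc s) (2 * Cmod s / (Re s / 2)) (Re s / 2)).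
- apply Rdiv_le_0_compat; [|lra].
  generalize (Cmod_ge_0 s); lra.
- lra.
- intros n Hn; now apply zeta_trunc_step.
Qed.

Definition dzeta (s : C) : C := C_lim_seq (dzeta_trunc s).

Lemma dzeta_trunc_lim (s : C) : 0 < Re s -> s <> 1%C ->
  is_lim_seq (fun n => Re (dzeta_trunc s n)) (Re (dzeta s)) /\
  is_lim_seq (fun n => Im (dzeta_trunc s n)) (Im (dzeta s)).
Proof.
intros Hs H1; unfold dzeta.
apply (C_lim_seq_tele (dzeta_trunc s)
         (2 * (Cmod s / (Re s / 2) + 1) / (Re s / 2)) (Re s / 2)).
- apply Rdiv_le_0_compat; [|lra].
  assert (0 <= Cmod s / (Re s / 2)); [|lra].
  apply Rdiv_le_0_compat; [apply Cmod_ge_0|lra].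
- lra.
- intros n Hn; now apply dzeta_trunc_step.
Qed.

Definition zrem (s h : C) (n : nat) : C :=
  (zeta_trunc (s + h) n - zeta_trunc s n - h * dzeta_trunc s n)%C.

Lemma zrem_step_bound (s h : C) (y : R) :
  1 <= y -> 0 < Re s -> Cmod h <= Re s / 4 ->
  Cmod (- s * (Cexp (- h * RtoC (ln y)) - 1 - - h * RtoC (ln y))
        - h * (Cexp (- h * RtoC (ln y)) - 1))%C
  <= Cmod h ^ 2 * (4 * Cmod s * (8 / Re s) ^ 2 + 2 * (4 / Re s))
     * Rpower y (Re s / 2).
Proof.
intros Hy Hs Hh.
set (z := (- h * RtoC (ln y))%C).
assert (L0 := ln_ge_0 y Hy).
assert (Hz : Cmod z = Cmod h * ln y).
{ unfold z; rewrite Cmod_mult, Cmod_opp, Cmod_R, Rabs_pos_eq; trivial. }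
assert (Hez : exp (Cmod z) <= Rpower y (Re s / 4)).
{ rewrite Hz; apply (Rpower_le_exp y (Cmod h) (Re s / 4) Hy Hh). }
set (P := Rpower y (Re s / 4)) in *.
assert (HP0 : 0 < P) by apply exp_pos.
assert (L1 : ln y <= 4 / Re s * P).
{ replace (4 / Re s) with (/ (Re s / 4)) by (field; lra).
  apply ln_le_Rpower; lra. }
assert (L2 : ln y ^ 2 <= (8 / Re s) ^ 2 * P).
{ replace P with (Rpower y (Re s / 8) ^ 2).
  2: { unfold P; replace (Re s / 4) with (Re s / 8 + Re s / 8) by field.
       rewrite Rpower_plus; ring. }
  rewrite <- Rpow_mult_distr; apply pow_incr; split; [exact L0|].
  replace (8 / Re s) with (/ (Re s / 8)) by (field; lra).
  apply ln_le_Rpower; lra. }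
assert (PP : Rpower y (Re s / 2) = P * P).
{ unfold P; rewrite <- Rpower_plus; f_equal; field. }
rewrite PP.
unfold Cminus at 1; eapply Rle_trans; [apply Cmod_triangle|].
rewrite Cmod_opp, !Cmod_mult, Cmod_opp.
assert (B1 := Cexp_bound1 z); assert (B2 := Cexp_bound2 z).
assert (Ch := Cmod_ge_0 h); assert (Cs := Cmod_ge_0 s).
assert (A1 : Cmod (Cexp z - 1)%C <= 2 * (Cmod h * (4 / Re s * P)) * P).
{ eapply Rle_trans; [exact B1|]; rewrite Hz in *.
  apply Rmult_le_compat; [nra|left; apply exp_pos| |exact Hez].
  apply Rmult_le_compat_l; [lra|]; now apply Rmult_le_compat_l. }
assert (A2 : Cmod (Cexp z - 1 - z)%C
             <= 4 * (Cmod h ^ 2 * ((8 / Re s) ^ 2 * P)) * P).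
{ eapply Rle_trans; [exact B2|]; rewrite Hz in *.
  rewrite Rpow_mult_distr.
  assert (0 <= Cmod h ^ 2) by apply pow2_ge_0.
  assert (0 <= ln y ^ 2) by apply pow2_ge_0.
  apply Rmult_le_compat; [nra|left; apply exp_pos| |exact Hez].
  apply Rmult_le_compat_l; [lra|]; now apply Rmult_le_compat_l. }
apply (Rmult_le_compat_l _ _ _ Ch) in A1.
apply (Rmult_le_compat_l _ _ _ Cs) in A2.
lra.
Qed.

Lemma zrem_step (s h : C) n : 0 < Re s -> s <> 1%C -> (s + h)%C <> 1%C ->
  Cmod h <= Re s / 4 -> (1 <= n)%nat ->
  Cmod (zrem s h (S n) - zrem s h n)%C
  <= 2 * (Cmod h ^ 2 * (4 * Cmod s * (8 / Re s) ^ 2 + 2 * (4 / Re s)))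
       / (Re s / 2)
     * (Rpower (INR n) (- (Re s / 2)) - Rpower (INR n + 1) (- (Re s / 2))).
Proof.
intros Hs H1 H2 Hh Hn.
assert (Ha : 1 <= INR n) by (apply (le_INR 1); lia).
set (f := fun x => (zstep (s + h) (INR n) x
                    + - (zstep s (INR n) x + h * dzstep s (INR n) x))%C).
replace (zrem s h (S n) - zrem s h n)%C with (f 1 - f 0)%C.
2: { unfold zrem, f.
     replace (zeta_trunc (s + h) (S n)) with
       (zeta_trunc (s + h) n
        + (zstep (s + h) (INR n) 1 - zstep (s + h) (INR n) 0))%C
       by (rewrite <- zeta_trunc_S by exact Hn; ring).
     replace (zeta_trunc s (S n)) with
       (zeta_trunc s n + (zstep s (INR n) 1 - zstep s (INR n) 0))%C
       by (rewrite <- zeta_trunc_S by exact Hn; ring).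
     replace (dzeta_trunc s (S n)) with
       (dzeta_trunc s n + (dzstep s (INR n) 1 - dzstep s (INR n) 0))%C
       by (rewrite <- dzeta_trunc_S by exact Hn; ring).
     ring. }
eapply step_bound; [exact Ha|lra| |].
- intros x Hx; unfold f.
  apply Cder_plus; [apply Cder_zstep; [lra|exact H2]|].
  apply Cder_opp, Cder_plus; [apply Cder_zstep; [lra|exact H1]|].
  apply Cder_mult; [apply Cder_const|apply Cder_dzstep; [lra|exact H1]].
- intros x Hx; cbv beta.
  set (y := INR n + x) in *.
  assert (Hy : 1 <= y) by (unfold y; lra).
  replace (- (s + h))%C with (- s + - h)%C by ring.
  rewrite cpow_plus.
  change (cpow y (- h)) with (Cexp (- h * RtoC (ln y))).
  match goal with |- Cmod ?e <= _ => replace e with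
    ((RtoC x * RtoC (/ y) * cpow y (- s))
     * (- s * (Cexp (- h * RtoC (ln y)) - 1 - - h * RtoC (ln y))
        - h * (Cexp (- h * RtoC (ln y)) - 1)))%C by ring end.
  rewrite Cmod_mult.
  replace (- (Re s / 2) - 1) with ((- Re s - 1) + Re s / 2) by field.
  rewrite Rpower_plus, <- Rmult_assoc, (Rmult_comm _ (Rpower y (- Re s - 1))),
    Rmult_assoc.
  apply Rmult_le_compat; try apply Cmod_ge_0; [now apply Cmod_term|].
  now apply zrem_step_bound.
Qed.

Lemma cpow_1 (w : C) : cpow 1 w = 1%C.
Proof.
unfold cpow; rewrite ln_1.
replace (w * RtoC 0)%C with (RtoC 0) by ring; apply Cexp_0.
Qed.

Lemma zrem_1 (s h : C) : s <> 1%C -> Cmod h <= Cmod (1 - s)%C / 2 ->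
  Cmod (zrem s h 1) <= Cmod h ^ 2 * (2 / Cmod (1 - s)%C ^ 3).
Proof.
intros H1 Hh.
assert (H0 := one_minus_neq_0 s H1).
assert (P : 0 < Cmod (1 - s)%C) by now apply Cmod_gt_0.
assert (Q : Cmod (1 - s)%C / 2 <= Cmod (1 - (s + h))%C).
{ assert (T := Cmod_triangle (1 - (s + h))%C h).
  replace (1 - (s + h) + h)%C with (1 - s)%C in T by ring; lra. }
assert (H2 : (1 - (s + h))%C <> 0%C) by (apply Cmod_gt_0; lra).
assert (E : zrem s h 1 = (- (h * h) / ((1 - s) * (1 - s) * (1 - (s + h))))%C).
{ unfold zrem, zeta_trunc, dzeta_trunc; rewrite !sum_n_n.
  simpl INR; rewrite !cpow_1, ln_1; field; split; assumption. }
rewrite E, Cmod_div by (repeat apply Cmult_neq_0; assumption).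
rewrite Cmod_opp, !Cmod_mult.
replace (Cmod h ^ 2) with (Cmod h * Cmod h) by ring.
assert (0 <= Cmod h * Cmod h) by (generalize (Cmod_ge_0 h); nra).
unfold Rdiv at 1; apply Rmult_le_compat_l; [assumption|].
replace (2 / Cmod (1 - s) ^ 3)
  with (/ (Cmod (1 - s) * Cmod (1 - s) * (Cmod (1 - s) / 2)))
  by (field; lra).
apply Rinv_le_contravar; [|apply Rmult_le_compat_l; nra].
repeat apply Rmult_lt_0_compat; lra.
Qed.

Lemma zeta_remainder (s : C) : 0 < Re s -> s <> 1%C ->
  exists K r : R, 0 < K /\ 0 < r /\ forall h : C, Cmod h <= r ->
  Cmod (zeta (s + h) - zeta s - h * dzeta s)%C <= K * Cmod h ^ 2.
Proof.
intros Hs H1.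
assert (H0 := one_minus_neq_0 s H1).
assert (P : 0 < Cmod (1 - s)%C) by now apply Cmod_gt_0.
set (K1 := 2 * (4 * Cmod s * (8 / Re s) ^ 2 + 2 * (4 / Re s)) / (Re s / 2)).
set (K2 := 2 / Cmod (1 - s)%C ^ 3).
assert (HK2 : 0 < K2) by (apply Rdiv_lt_0_compat; [lra|now apply pow_lt]).
assert (HK1 : 0 < K1).
{ apply Rdiv_lt_0_compat; [|lra].
  assert (0 < 4 / Re s) by (apply Rdiv_lt_0_compat; lra).
  generalize (pow2_ge_0 (8 / Re s)) (Cmod_ge_0 s); nra. }
exists (2 * (K1 + K2)), (Rmin (Re s / 4) (Cmod (1 - s)%C / 2)).
split; [lra|]; split; [apply Rmin_glb_lt; lra|].
intros h Hh.
assert (Hh1 : Cmod h <= Re s / 4) by (eapply Rle_trans; [exact Hh|apply Rmin_l]).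
assert (Hh2 : Cmod h <= Cmod (1 - s)%C / 2)
  by (eapply Rle_trans; [exact Hh|apply Rmin_r]).
assert (H2 : (s + h)%C <> 1%C).
{ intros E.
  replace (1 - s)%C with h in * by (rewrite <- E; ring).
  lra. }
assert (Hs' : 0 < Re (s + h)%C).
{ change (Re (s + h)%C) with (Re s + Re h).
  assert (A := re_le_Cmod h); unfold Rabs in A; destruct Rcase_abs in A; lra. }
rewrite Rmult_assoc.
destruct (zeta_trunc_lim s Hs H1) as [A1 A2].
destruct (zeta_trunc_lim (s + h) Hs' H2) as [B1 B2].
destruct (dzeta_trunc_lim s Hs H1) as [D1 D2].
apply (C_lim_bound (zrem s h)).
- apply (is_lim_seq_minus' (fun n => Re (zeta_trunc (s + h) n)
                                     - Re (zeta_trunc s n))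
    (fun n => Re h * Re (dzeta_trunc s n) - Im h * Im (dzeta_trunc s n))
    (Re (zeta (s + h)) - Re (zeta s))
    (Re h * Re (dzeta s) - Im h * Im (dzeta s)));
    apply is_lim_seq_minus'; trivial.
  + apply (is_lim_seq_scal_l _ (Re h) (Re (dzeta s)) D1).
  + apply (is_lim_seq_scal_l _ (Im h) (Im (dzeta s)) D2).
- apply (is_lim_seq_minus' (fun n => Im (zeta_trunc (s + h) n)
                                     - Im (zeta_trunc s n))
    (fun n => Re h * Im (dzeta_trunc s n) + Im h * Re (dzeta_trunc s n))
    (Im (zeta (s + h)) - Im (zeta s))
    (Re h * Im (dzeta s) + Im h * Re (dzeta s)));
    [apply is_lim_seq_minus'|apply is_lim_seq_plus']; trivial.
  + apply (is_lim_seq_scal_l _ (Re h) (Im (dzeta s)) D2).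
  + apply (is_lim_seq_scal_l _ (Im h) (Re (dzeta s)) D1).
- exists 1%nat; intros n Hn.
  assert (T := telescope (zrem s h) (K1 * Cmod h ^ 2) (Re s / 2)).
  replace n with (1 + (n - 1))%nat by lia.
  replace (zrem s h (1 + (n - 1))%nat)
    with ((zrem s h (1 + (n - 1))%nat - zrem s h 1%nat) + zrem s h 1%nat)%C
    by ring.
  eapply Rle_trans; [apply Cmod_triangle|].
  rewrite Rmult_plus_distr_r; apply Rplus_le_compat.
  + eapply Rle_trans; [apply T; [|lia]|].
    * intros m Hm.
      replace (K1 * Cmod h ^ 2) with
        (2 * (Cmod h ^ 2 * (4 * Cmod s * (8 / Re s) ^ 2 + 2 * (4 / Re s)))
         / (Re s / 2)) by (unfold K1; field; lra).
      now apply zrem_step.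
    * rewrite <- (Rmult_1_r (K1 * Cmod h ^ 2)) at 2.
      apply Rmult_le_compat_l; [generalize (pow2_ge_0 (Cmod h)); nra|].
      simpl (INR 1); unfold Rpower at 1; rewrite ln_1, Rmult_0_r, exp_0.
      unfold Rpower; generalize (exp_pos (- (Re s / 2) * ln (INR (1 + (n - 1))))).
      lra.
  + rewrite Rmult_comm; now apply zrem_1.
Qed.

Lemma zeta_is_derive (s : C) : 0 < Re s -> s <> 1%C ->
  is_derive (zeta : C -> C_NormedModule) s (dzeta s).
Proof.
intros Hs H1.
destruct (zeta_remainder s Hs H1) as [K [r [HK [Hr H]]]].
split; [apply (is_linear_scal_l (K := C_AbsRing) (V := C_NormedModule))|].
intros x Hx.
apply (is_filter_lim_locally_unique (V := AbsRing_NormedModule C_AbsRing)) in Hx.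
rewrite <- Hx; clear x Hx.
intros eps.
assert (Hd : 0 < Rmin r (eps / K)).
{ apply Rmin_glb_lt; [exact Hr|apply Rdiv_lt_0_compat; [apply cond_pos|exact HK]]. }
exists (mkposreal _ Hd); intros z Hz.
change (Cmod (z - s)%C < Rmin r (eps / K)) in Hz.
change (Cmod (zeta z - zeta s - (z - s) * dzeta s)%C <= eps * Cmod (z - s)%C).
assert (Z1 : Cmod (z - s)%C <= r)
  by (generalize (Rmin_l r (eps / K)); lra).
assert (Z2 : Cmod (z - s)%C <= eps / K)
  by (generalize (Rmin_r r (eps / K)); lra).
specialize (H (z - s)%C Z1).
assert (E : forall w : C, (s + (w - s))%C = w) by (intros; ring).
rewrite E in H.
eapply Rle_trans; [exact H|].
replace (K * Cmod (z - s) ^ 2) with ((K * Cmod (z - s)) * Cmod (z - s)) by ring.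
apply Rmult_le_compat_r; [apply Cmod_ge_0|].
apply (Rmult_le_compat_l K) in Z2; [|lra].
replace (K * (eps / K)) with (pos eps) in Z2 by (field; lra).
exact Z2.
Qed.

Lemma zeta_Dirichlet_series (s : C) : 1 < Re s ->
  is_series (fun n => cpow (INR (S n)) (- s) : C_NormedModule) (zeta s).
Proof.
intros Hs.
assert (H1 : s <> 1%C) by (intros E; rewrite E in Hs; simpl in Hs; lra).
assert (H0 := one_minus_neq_0 s H1).
assert (P : 0 < Cmod (1 - s)%C) by now apply Cmod_gt_0.
set (c := 2 * Cmod s / (Re s / 2)).
assert (Hc : 0 <= c).
{ apply Rdiv_le_0_compat; [generalize (Cmod_ge_0 s); lra|lra]. }
destruct (zeta_trunc_lim s ltac:(lra) H1) as [A1 A2].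
assert (A : forall n, (1 <= n)%nat ->
  Cmod (zeta s - zeta_trunc s n)%C <= 2 * (c * Rpower (INR n) (- (Re s / 2)))).
{ intros n Hn.
  apply (C_lim_bound (fun m => zeta_trunc s m - zeta_trunc s n)%C).
  - apply (is_lim_seq_minus' _ _ _ _ A1 (is_lim_seq_const (Re (zeta_trunc s n)))).
  - apply (is_lim_seq_minus' _ _ _ _ A2 (is_lim_seq_const (Im (zeta_trunc s n)))).
  - exists n; intros m Hm; replace m with (n + (m - n))%nat by lia.
    eapply Rle_trans; [apply (telescope (zeta_trunc s) c (Re s / 2));
      [intros; apply zeta_trunc_step; trivial; lra|exact Hn]|].
    apply Rmult_le_compat_l; [exact Hc|].
    unfold Rpower; generalize (exp_pos (- (Re s / 2) * ln (INR (n + (m - n))))).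
    lra. }
intros Q [eps HQ].
destruct (Rpower_INR_small c (Re s / 2) (eps / 4) Hc) as [N1 [HN1 HN1']];
  [lra|generalize (cond_pos eps); lra|].
destruct (Rpower_INR_small (/ Cmod (1 - s)%C) (Re s - 1) (eps / 4))
  as [N2 [HN2 HN2']];
  [left; now apply Rinv_0_lt_compat|lra|generalize (cond_pos eps); lra|].
exists (N1 + N2)%nat; intros n Hn; apply HQ.
apply C_NormedModule_mixin_compat1.
specialize (HN1' (S n) ltac:(lia)); specialize (HN2' (S n) ltac:(lia)).
specialize (A (S n) ltac:(lia)).
match goal with |- Cmod ?e < _ => replace e with
  (- (zeta s - zeta_trunc s (S n))
   + cpow (INR (S n)) (1 - s) / (1 - s))%C end.
2: { unfold zeta_trunc, sum_n.
     rewrite <- (sum_n_m_S (fun k => cpow (INR k) (- s)) 0 n).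
     match goal with |- _ = minus ?a _ => set (S1 := a : C) end.
     match goal with |- _ = ?e => change e with (S1 - zeta s)%C end.
     change (sum_n_m (fun k => cpow (INR (S k)) (- s)) 0 n) with S1; ring. }
eapply Rle_lt_trans; [apply Cmod_triangle|].
rewrite Cmod_opp, Cmod_div, Cmod_cpow by exact H0.
change (Re (1 - s)%C) with (1 - Re s).
replace (1 - Re s) with (- (Re s - 1)) by ring.
unfold Rdiv at 1; generalize (cond_pos eps); lra.
Qed.

Lemma zeta_line_continuous (sigma t : R) : 0 < sigma -> sigma <> 1 ->
  continuity_pt (fun u => Cmod (zeta (sigma, u))) t.
Proof.
intros H0 H1.
set (s := (sigma, t) : C).
assert (Hs : s <> 1%C) by (intros E; apply H1; exact (f_equal fst E)).
destruct (zeta_remainder s H0 Hs) as [K [r [HK [Hr H]]]].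
intros eps He.
set (B := K * r + Cmod (dzeta s) + 1).
assert (HB : 0 < B).
{ unfold B; generalize (Cmod_ge_0 (dzeta s)); nra. }
exists (Rmin r (eps / B)); split.
- apply Rmin_glb_lt; [exact Hr|apply Rdiv_lt_0_compat; lra].
- intros u [_ Hu]; change R in u; simpl in Hu |- *; unfold Rdist in *.
  set (h := (0, u - t) : C).
  assert (E : (sigma, u) = (s + h)%C).
  { unfold s, h, Cplus; simpl; f_equal; ring. }
  assert (Eh : Cmod h = Rabs (u - t)).
  { unfold h, Cmod; simpl.
    replace (0 * (0 * 1) + (u - t) * ((u - t) * 1)) with (Rsqr (u - t))
      by (unfold Rsqr; ring).
    apply sqrt_Rsqr_abs. }
  assert (U1 := Rmin_l r (eps / B)); assert (U2 := Rmin_r r (eps / B)).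
  assert (Hh : Cmod h <= r) by lra.
  specialize (H h Hh).
  assert (L : Cmod (zeta (s + h) - zeta s)%C <= B * Cmod h).
  { replace (zeta (s + h) - zeta s)%C
      with ((zeta (s + h) - zeta s - h * dzeta s) + h * dzeta s)%C by ring.
    eapply Rle_trans; [apply Cmod_triangle|]; rewrite Cmod_mult.
    assert (Ch := Cmod_ge_0 h).
    assert (0 <= K * (Cmod h * (r - Cmod h)))
      by (apply Rmult_le_pos; [lra|apply Rmult_le_pos; lra]).
    unfold B; lra. }
  rewrite E; change (sigma, t) with s.
  assert (L2 : Cmod (zeta (s + h)) - Cmod (zeta s)
               <= Cmod (zeta (s + h) - zeta s)%C).
  { assert (X := Cmod_triangle (zeta (s + h) - zeta s)%C (zeta s)).
    replace (zeta (s + h) - zeta s + zeta s)%C with (zeta (s + h)) in X by ring.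
    lra. }
  assert (L3 : Cmod (zeta s) - Cmod (zeta (s + h))
               <= Cmod (zeta (s + h) - zeta s)%C).
  { assert (X := Cmod_triangle (zeta (s + h)) (- (zeta (s + h) - zeta s))%C).
    replace (zeta (s + h) + - (zeta (s + h) - zeta s))%C with (zeta s) in X
      by ring.
    rewrite Cmod_opp in X; lra. }
  apply Rle_lt_trans with (B * Cmod h).
  + unfold Rabs; destruct Rcase_abs; lra.
  + apply Rlt_le_trans with (B * (eps / B)).
    * apply Rmult_lt_compat_l; lra.
    * right; field; lra.
Qed.

Lemma Zbeta_is_max (beta sigma T : R) :
  0 < sigma -> sigma <> 1 -> Rpower T beta <= T ->
  (exists t, Rpower T beta <= Rabs t <= T
             /\ Zbeta beta sigma T = Cmod (zeta (sigma, t))) /\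
  (forall t, Rpower T beta <= Rabs t <= T ->
     Cmod (zeta (sigma, t)) <= Zbeta beta sigma T).
Proof.
intros H0 H1 HT.
assert (HP : 0 < Rpower T beta) by apply exp_pos.
set (f := fun u => Cmod (zeta (sigma, u))).
destruct (continuity_ab_maj f (Rpower T beta) T HT) as [a [Ha Ha']].
{ intros; now apply zeta_line_continuous. }
destruct (continuity_ab_maj f (- T) (- Rpower T beta) ltac:(lra))
  as [b [Hb Hb']].
{ intros; now apply zeta_line_continuous. }
assert (X : exists t, Rpower T beta <= Rabs t <= T /\
  forall u, Rpower T beta <= Rabs u <= T -> f u <= f t).
{ assert (Y : forall u, Rpower T beta <= Rabs u <= T -> f u <= f a \/ f u <= f b).
  { intros u Hu; unfold Rabs in Hu; destruct Rcase_abs in Hu;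
      [right; apply Hb|left; apply Ha]; lra. }
  destruct (Rle_lt_dec (f a) (f b)).
  - exists b; split; [rewrite Rabs_left by lra; lra|].
    intros u Hu; destruct (Y u Hu); lra.
  - exists a; split; [rewrite Rabs_pos_eq by lra; lra|].
    intros u Hu; destruct (Y u Hu); lra. }
destruct X as [t [Ht M]].
assert (E : Zbeta beta sigma T = f t).
{ unfold Zbeta; rewrite (is_lub_Rbar_unique _ (Finite (f t))); [reflexivity|].
  split.
  - intros x [u [Hu ->]]; exact (M u Hu).
  - intros l Hl; apply Hl; now exists t. }
split; [now exists t|].
intros u Hu; rewrite E; exact (M u Hu).
Qed.

Lemma Rsum_le (M : list nat) (f : nat -> R) (c : R) :
  (forall m, In m M -> f m <= c) -> Rsum M f <= INR (length M) * c.
Proof.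
unfold Rsum; induction M as [|m M IH]; intros H.
- simpl; lra.
- change (length (m :: M)) with (S (length M)); rewrite S_INR; simpl.
  generalize (H m (or_introl eq_refl)) (IH (fun k Hk => H k (or_intror Hk))).
  lra.
Qed.

Lemma Gamma_is_lub (sigma : R) (N : nat) :
  0 <= sigma -> is_lub (Gamma_set sigma N) (Gamma sigma N).
Proof.
intros Hs.
assert (B : forall x, Gamma_set sigma N x -> x <= INR N).
{ intros x [M [_ [HN [HM ->]]]].
  destruct N as [|N].
  - simpl; unfold Rdiv; rewrite Rinv_0; lra.
  - assert (HN0 : 0 < INR (S N)) by (apply lt_0_INR; lia).
    apply Rmult_le_reg_r with (INR (S N)); [exact HN0|].
    unfold Rdiv; rewrite Rmult_assoc, Rinv_l, Rmult_1_r by lra.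
    unfold gcd_sum; rewrite <- HN.
    apply Rsum_le; intros m Hm.
    rewrite <- (Rmult_1_r (INR (length M))).
    apply Rsum_le; intros n Hn.
    assert (G : (1 <= Nat.gcd m n <= Nat.lcm m n)%nat).
    { generalize (HM m Hm) (HM n Hn); intros Hm0 Hn0.
      assert (Nat.gcd m n <> 0%nat)
        by (intros E; apply Nat.gcd_eq_0_l in E; lia).
      assert (Nat.lcm m n <> 0%nat)
        by (intros E; apply Nat.lcm_eq_0 in E; lia).
      assert (Nat.divide (Nat.gcd m n) (Nat.lcm m n)).
      { eapply Nat.divide_trans; [apply Nat.gcd_divide_l|].
        apply Nat.divide_lcm_l. }
      split; [lia|apply Nat.divide_pos_le; [lia|assumption]]. }
    destruct G as [G1 G2]; apply (le_INR 1) in G1; apply le_INR in G2.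
    simpl (INR 1) in G1.
    assert (D : 0 < Rpower (INR (Nat.lcm m n)) sigma) by apply exp_pos.
    apply Rmult_le_reg_r with (Rpower (INR (Nat.lcm m n)) sigma); [exact D|].
    unfold Rdiv; rewrite Rmult_assoc, Rinv_l, Rmult_1_r, Rmult_1_l by lra.
    apply Rle_Rpower_l; [exact Hs|lra]. }
assert (E : exists x, Gamma_set sigma N x).
{ exists (gcd_sum sigma (List.seq 1 N) / INR N), (List.seq 1 N).
  split; [apply seq_NoDup|]; split; [apply length_seq|]; split; [|reflexivity].
  intros m Hm; apply in_seq in Hm; lia. }
destruct (completeness (Gamma_set sigma N)) as [l Hl];
  [exists (INR N); exact B|exact E|].
unfold Gamma; rewrite (is_lub_Rbar_unique _ (Finite l)); [exact Hl|].
destruct Hl as [Hl1 Hl2]; split; [exact Hl1|].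
intros [b| |] Hb; simpl; trivial.
- apply Hl2; exact Hb.
- destruct E as [x Hx]; exact (Hb x Hx).
Qed.

(* Main.v *)
Require Import Defs.
From Stdlib Require Import Reals Zfloor Lra Lia ZArith List FinFun Classical.
From Coquelicot Require Import Coquelicot.
Import ListNotations.
Open Scope R_scope.

(** Resonance method with finite sums only.  Let [l = ln T].

    Averaging [zeta (sigma + i (t + u))] over [u] against a nonnegative discrete
    kernel of bounded mass (a Fejer kernel times a binomial window of width
    [O(1)]) turns zeta into a short Dirichlet polynomial [B] with nonnegative
    coefficients, of length [T^(16 beta / 100)], and annihilates the contribution
    of the pole.  Hence [|B|] is bounded by [66 Zbeta + 1 / T] for
    [2 T^beta <= t <= T / 2].

    For a set [M] of [N <= T^(1 - beta)] integers, the exponents [ln m] are rounded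
    to multiples of [2 pi / J] and the resonator is weighted so that its mean
    square over a period is exactly [N].  The weighted mean of [|B R|^2] over the
    points [t = h (j1 - j2)] is a sum of nonnegative terms, and the terms with
    [k n = l m] alone give [zeta(2 sigma) S_sigma(M)], provided that
    [m / gcd] and [n / gcd] can be restricted to be at most a small power of [T].
    The part [|t| <= 2 T^beta] costs only [O (zeta(2 sigma))], which is harmless if
    [Gamma] is large; if [Gamma] is bounded, [M = {1}] is used instead.

    The restriction is Rankin's trick together with a Gal-type upper bound:
    for [j = 2^i], [(S_s(M) / N)^j <= N * Z^(j^2)] whenever
    [sum n^(-2 s) <= Z].  It follows by bounding powers of the gcd matrix by
    correlations of iterated Dirichlet convolutions of [n^(-s)].  This is where
    [sigma >= 1/2 + 1 / ln (ln T)] enters. *)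

(** * Finite sums *)

(** The members of [M] can be arbitrarily large and their logarithms arbitrarily close, so no mean
    value theorem for well-spaced frequencies controls the resonator. Rounding turns it into a
    trigonometric polynomial of period [J] in the sampling index, whose mean square comes from exact
    orthogonality. The price is that distinct members may share a residue, and the weights
    compensate for this.

    Two costs fix the shape of the result. Close to the real axis only the trivial bound [N] for the
    resonator is available; on a proportion T^(beta - 1) of the points it contributes N^2 T^(beta -
    1) against a main term of size at least N, whence N <= T^(1 - beta). The factor zeta(2 sigma),
    unbounded as sigma approaches 1/2, is never evaluated: it enters the main term and the cost as
    truncated sums up to [G] and [G ^ 16], which differ by a factor at most 17 uniformly in sigma,
    so that the final constant is absolute.

    All averages are binomial or Fejer sums over equally spaced points, so their Fourier transforms
    are exact finite identities and no integral or contour shift occurs. *)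

Definition lsum {A : Type} (l : list A) (f : A -> R) : R :=
  fold_right Rplus 0 (map f l).

(* Iverson bracket. *)
Definition iv (b : bool) : R := if b then 1 else 0.

Lemma iv_ge_0 b : 0 <= iv b.
Proof. destruct b; simpl; lra. Qed.

Lemma iv_le_1 b : iv b <= 1.
Proof. destruct b; simpl; lra. Qed.

Lemma lsum_cons {A} (x : A) l f : lsum (x :: l) f = f x + lsum l f.
Proof. reflexivity. Qed.

Lemma lsum_app {A} (l1 l2 : list A) f :
  lsum (l1 ++ l2) f = lsum l1 f + lsum l2 f.
Proof.
induction l1 as [|x l1 IH]; simpl app; [unfold lsum at 2; simpl; ring|].
rewrite !lsum_cons, IH; ring.
Qed.

Lemma lsum_ext {A} (l : list A) f g :
  (forall x, In x l -> f x = g x) -> lsum l f = lsum l g.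
Proof.
induction l as [|x l IH]; intros H; [reflexivity|].
rewrite !lsum_cons, IH, (H x); auto with datatypes.
Qed.

Lemma lsum_le {A} (l : list A) f g :
  (forall x, In x l -> f x <= g x) -> lsum l f <= lsum l g.
Proof.
induction l as [|x l IH]; intros H; [apply Rle_refl|].
rewrite !lsum_cons; apply Rplus_le_compat; auto with datatypes.
Qed.

Lemma lsum_0 {A} (l : list A) f : (forall x, In x l -> f x = 0) -> lsum l f = 0.
Proof.
induction l as [|x l IH]; intros H; [reflexivity|].
rewrite lsum_cons, IH, (H x); auto with datatypes; ring.
Qed.

Lemma lsum_ge_0 {A} (l : list A) f :
  (forall x, In x l -> 0 <= f x) -> 0 <= lsum l f.
Proof.
intros H; rewrite <- (lsum_0 l (fun _ => 0)) by reflexivity; now apply lsum_le.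
Qed.

Lemma lsum_plus {A} (l : list A) f g :
  lsum l (fun x => f x + g x) = lsum l f + lsum l g.
Proof.
induction l as [|x l IH]; [unfold lsum; simpl; ring|].
rewrite !lsum_cons, IH; ring.
Qed.

Lemma lsum_scal {A} (l : list A) c f :
  lsum l (fun x => c * f x) = c * lsum l f.
Proof.
induction l as [|x l IH]; [unfold lsum; simpl; ring|].
rewrite !lsum_cons, IH; ring.
Qed.

Lemma lsum_scal_r {A} (l : list A) c f :
  lsum l (fun x => f x * c) = lsum l f * c.
Proof.
rewrite Rmult_comm, <- lsum_scal; apply lsum_ext; intros; ring.
Qed.

Lemma lsum_const {A} (l : list A) c : lsum l (fun _ => c) = INR (length l) * c.
Proof.
induction l as [|x l IH]; [unfold lsum; simpl; ring|].
rewrite lsum_cons, IH; change (length (x :: l)) with (S (length l)).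
rewrite S_INR; ring.
Qed.

Lemma lsum_exch {A B} (l1 : list A) (l2 : list B) f :
  lsum l1 (fun x => lsum l2 (fun y => f x y))
  = lsum l2 (fun y => lsum l1 (fun x => f x y)).
Proof.
induction l1 as [|x l1 IH].
- symmetry; apply lsum_0; reflexivity.
- rewrite lsum_cons, IH, <- lsum_plus; apply lsum_ext; intros y _.
  now rewrite lsum_cons.
Qed.

Lemma lsum_mult {A B} (l1 : list A) (l2 : list B) f g :
  lsum l1 f * lsum l2 g = lsum l1 (fun x => lsum l2 (fun y => f x * g y)).
Proof.
rewrite <- lsum_scal_r; apply lsum_ext; intros x _; now rewrite lsum_scal.
Qed.

Lemma lsum_prod {A B} (l1 : list A) (l2 : list B) f :
  lsum (list_prod l1 l2) f = lsum l1 (fun x => lsum l2 (fun y => f (x, y))).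
Proof.
induction l1 as [|x l1 IH]; [reflexivity|].
simpl list_prod; rewrite lsum_app, IH, lsum_cons; f_equal.
unfold lsum; now rewrite map_map.
Qed.

Lemma lsum_term {A} (l : list A) f a :
  (forall x, In x l -> 0 <= f x) -> In a l -> f a <= lsum l f.
Proof.
induction l as [|x l IH]; intros H Ha; [easy|].
rewrite lsum_cons; destruct Ha as [->|Ha].
- assert (0 <= lsum l f) by (apply lsum_ge_0; auto with datatypes); lra.
- assert (0 <= f x) by auto with datatypes.
  assert (f a <= lsum l f) by (apply IH; auto with datatypes); lra.
Qed.

Lemma lsum_incl {A} (l1 l2 : list A) f :
  (forall x, In x l2 -> 0 <= f x) -> NoDup l1 -> incl l1 l2 ->
  lsum l1 f <= lsum l2 f.
Proof.
revert l2; induction l1 as [|x l1 IH]; intros l2 H ND I.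
- apply lsum_ge_0, H.
- inversion ND as [|? ? Hx ND']; subst.
  destruct (in_split x l2) as [a [b E]]; [apply I; now left|].
  rewrite lsum_cons, E, lsum_app, lsum_cons.
  assert (lsum l1 f <= lsum (a ++ b) f).
  { apply IH; trivial.
    - intros y Hy; apply H; rewrite E; apply in_app_iff in Hy.
      apply in_app_iff; simpl; tauto.
    - intros y Hy; assert (Hy' : In y l2) by (apply I; now right).
      rewrite E in Hy'; apply in_app_iff in Hy'; apply in_app_iff.
      destruct Hy' as [?|[<-|?]]; auto; contradiction. }
  rewrite lsum_app in H0; lra.
Qed.

Lemma lsum_unique {A} (l : list A) (P : A -> bool) :
  NoDup l -> (forall x y, P x = true -> P y = true -> x = y) ->
  lsum l (fun x => iv (P x)) <= 1.
Proof.
intros ND U; induction l as [|x l IH]; [unfold lsum; simpl; lra|].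
inversion ND as [|? ? Hx ND']; subst.
rewrite lsum_cons; destruct (P x) eqn:E.
- rewrite lsum_0; [simpl; lra|].
  intros y Hy; destruct (P y) eqn:E'; [|reflexivity].
  now rewrite (U x y E E') in Hx.
- simpl; specialize (IH ND'); lra.
Qed.

Lemma lsum_exists {A} (l : list A) (P : A -> bool) a :
  In a l -> P a = true -> 1 <= lsum l (fun x => iv (P x)).
Proof.
intros Ha HP; replace 1 with (iv (P a)) by now rewrite HP.
apply (lsum_term l (fun x => iv (P x))); [intros; apply iv_ge_0|trivial].
Qed.

Lemma lsum_CS {A} (l : list A) f :
  (lsum l f) ^ 2 <= INR (length l) * lsum l (fun x => f x ^ 2).
Proof.
assert (H : 0 <= lsum l (fun x => lsum l (fun y => (f x - f y) ^ 2))).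
{ apply lsum_ge_0; intros; apply lsum_ge_0; intros; apply pow2_ge_0. }
rewrite (lsum_ext l _ (fun x =>
  (INR (length l) * f x ^ 2 + lsum l (fun y => f y ^ 2))
   + - 2 * (f x * lsum l f))) in H.
- rewrite !lsum_plus, lsum_scal, lsum_const, lsum_scal, lsum_scal_r in H.
  simpl in *; lra.
- intros x _.
  rewrite <- lsum_scal, <- lsum_scal, <- (lsum_const l (f x ^ 2)), <- !lsum_plus.
  apply lsum_ext; intros; ring.
Qed.

Notation rg B := (List.seq 1 B).

Lemma in_rg n B : In n (rg B) <-> (1 <= n <= B)%nat.
Proof. rewrite in_seq; lia. Qed.

Lemma rg_NoDup B : NoDup (rg B).
Proof. apply seq_NoDup. Qed.

Lemma rg_incl B B' : (B <= B')%nat -> incl (rg B) (rg B').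
Proof. intros H x; rewrite !in_rg; lia. Qed.

Lemma lsum_exch4 {A B C D} (l1 : list A) (l2 : list B) (l3 : list C) (l4 : list D) f :
  lsum l1 (fun a => lsum l2 (fun b => lsum l3 (fun c => lsum l4 (fun d => f a b c d))))
  = lsum l3 (fun c => lsum l4 (fun d => lsum l1 (fun a => lsum l2 (fun b => f a b c d)))).
Proof.
transitivity (lsum l1 (fun a => lsum l3 (fun c => lsum l4 (fun d =>
  lsum l2 (fun b => f a b c d))))).
- apply lsum_ext; intros a _; rewrite lsum_exch; apply lsum_ext; intros c _.
  apply lsum_exch.
- rewrite lsum_exch; apply lsum_ext; intros c _; apply lsum_exch.
Qed.

(** * Dirichlet convolution and refinement of factorizations *)

Definition conv (f : nat -> R) (n : nat) : R :=
  lsum (rg n) (fun a => lsum (rg n) (fun b => iv (Nat.eqb (a * b) n) * (f a * f b))).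

Lemma conv_ge_0 f : (forall n, 0 <= f n) -> forall n, 0 <= conv f n.
Proof.
intros H n; apply lsum_ge_0; intros; apply lsum_ge_0; intros.
repeat apply Rmult_le_pos; trivial; apply iv_ge_0.
Qed.

(** Factors of [n] do not exceed [n], so a longer range adds only zero terms. This lets convolutions
    at different points share one range before sums are exchanged. *)
Lemma conv_range f n B : (1 <= n <= B)%nat -> (forall n, 0 <= f n) ->
  conv f n =
  lsum (rg B) (fun a => lsum (rg B) (fun b => iv (Nat.eqb (a * b) n) * (f a * f b))).
Proof.
intros Hn H; apply Rle_antisym.
- unfold conv; eapply Rle_trans.
  + apply lsum_le; intros a _; apply (lsum_incl (rg n) (rg B)).
    * intros; repeat apply Rmult_le_pos; trivial; apply iv_ge_0.
    * apply rg_NoDup.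
    * now apply rg_incl.
  + apply (lsum_incl (rg n) (rg B)).
    * intros; apply lsum_ge_0; intros; repeat apply Rmult_le_pos; trivial; apply iv_ge_0.
    * apply rg_NoDup.
    * now apply rg_incl.
- unfold conv.
  replace B with (n + (B - n))%nat at 1 by lia.
  rewrite seq_app, lsum_app, (lsum_0 (List.seq (1 + n) (B - n))).
  + rewrite Rplus_0_r; apply lsum_le; intros a Ha; apply in_rg in Ha.
    replace B with (n + (B - n))%nat by lia.
    rewrite seq_app, lsum_app, (lsum_0 (List.seq (1 + n) (B - n))); [lra|].
    intros b Hb; apply in_seq in Hb.
    destruct (Nat.eqb_spec (a * b) n); [nia|simpl; ring].
  + intros a Ha; apply in_seq in Ha; apply lsum_0; intros b Hb; apply in_rg in Hb.
    destruct (Nat.eqb_spec (a * b) n); [nia|simpl; ring].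
Qed.

Lemma iv_sum_le (l : list nat) c : NoDup l -> lsum l (fun n => iv (Nat.eqb c n)) <= 1.
Proof.
intros ND; apply (lsum_unique l (Nat.eqb c)); trivial.
intros x y; rewrite !Nat.eqb_eq; congruence.
Qed.

(** With [p = gcd a m], [a = p q] and [m = p r], the cofactors [q] and [r] are coprime and
    [q b = r n], so [q] divides [n]; the quotient is [s]. *)
Lemma refinement a b m n : (0 < a)%nat -> (0 < b)%nat -> (a * b = m * n)%nat ->
  exists p q r s, (p * r = m /\ q * s = n /\ p * q = a /\ r * s = b)%nat.
Proof.
intros Ha Hb E.
set (p := Nat.gcd a m).
destruct (Nat.gcd_divide_l a m) as [q Hq]; destruct (Nat.gcd_divide_r a m) as [r Hr].
fold p in Hq, Hr.
assert (Hp : p <> 0%nat) by (intros K; apply Nat.gcd_eq_0_l in K; lia).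
assert (C : Nat.gcd q r = 1%nat).
{ assert (K := Nat.gcd_mul_mono_r q r p); rewrite <- Hq, <- Hr in K.
  fold p in K. nia. }
assert (E' : (q * b = r * n)%nat).
{ apply (Nat.mul_cancel_l _ _ p Hp); nia. }
assert (D : Nat.divide q n).
{ apply (Nat.gauss _ r); trivial. exists b; lia. }
destruct D as [s Hs].
exists p, q, r, s; repeat split; try nia.
Qed.

(* Every factorization [a * b = m * n] is the pair of column products of a
   2 x 2 array whose row products are [m] and [n]. *)
Lemma refinement_sum (F : nat -> nat -> R) m n B :
  (forall a b, 0 <= F a b) -> (m * n <= B)%nat -> (0 < m)%nat -> (0 < n)%nat ->
  lsum (rg B) (fun a => lsum (rg B) (fun b =>
    iv (Nat.eqb (a * b) (m * n)) * F a b))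
  <= lsum (rg B) (fun p => lsum (rg B) (fun r => iv (Nat.eqb (p * r) m) *
       lsum (rg B) (fun q => lsum (rg B) (fun s => iv (Nat.eqb (q * s) n) *
         F (p * q)%nat (r * s)%nat)))).
Proof.
intros HF HB Hm Hn.
set (L := list_prod (rg B) (rg B)).
set (P := fun (x : nat * nat) (y : (nat * nat) * (nat * nat)) =>
  (Nat.eqb (fst (fst y) * snd (fst y)) m && Nat.eqb (fst (snd y) * snd (snd y)) n
  && Nat.eqb (fst (fst y) * fst (snd y)) (fst x)
  && Nat.eqb (snd (fst y) * snd (snd y)) (snd x))%bool).
apply Rle_trans with (lsum L (fun x => lsum (list_prod L L) (fun y =>
   iv (P x y) * F (fst x) (snd x)))).
- unfold L at 1; rewrite lsum_prod.
  apply lsum_le; intros a Ha; apply lsum_le; intros b Hb.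
  apply in_rg in Ha; apply in_rg in Hb.
  rewrite lsum_scal_r; apply Rmult_le_compat_r; [apply HF|].
  destruct (Nat.eqb_spec (a * b) (m * n)) as [E|_];
    [|apply lsum_ge_0; intros; apply iv_ge_0].
  destruct (refinement a b m n) as [p [q [r [s [E1 [E2 [E3 E4]]]]]]]; try lia.
  apply (lsum_exists (list_prod L L) _ ((p, r), (q, s))).
  + assert (0 < p /\ 0 < q /\ 0 < r /\ 0 < s)%nat as [? [? [? ?]]]
      by (repeat split; nia).
    assert (p <= a /\ q <= a /\ r <= b /\ s <= b)%nat by (repeat split; nia).
    repeat apply in_prod; apply in_rg; lia.
  + unfold P; simpl; rewrite E1, E2, E3, E4, !Nat.eqb_refl; reflexivity.
- rewrite lsum_exch, lsum_prod; unfold L at 1; rewrite lsum_prod.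
  apply lsum_le; intros p Hp; apply lsum_le; intros r Hr.
  rewrite <- lsum_scal; unfold L at 1; rewrite lsum_prod.
  apply lsum_le; intros q Hq; rewrite <- lsum_scal; apply lsum_le; intros s Hs.
  unfold P; simpl.
  destruct (Nat.eqb (p * r) m); [|simpl; rewrite lsum_0; [lra|intros; simpl; ring]].
  destruct (Nat.eqb (q * s) n); [|simpl; rewrite lsum_0; [lra|intros; simpl; ring]].
  simpl (iv true); rewrite !Rmult_1_l; simpl andb.
  apply Rle_trans with (lsum L (fun x =>
    iv (Nat.eqb (p * q) (fst x) && Nat.eqb (r * s) (snd x)) * F (p * q)%nat (r * s)%nat)).
  + right; apply lsum_ext; intros x _.
    destruct (Nat.eqb_spec (p * q) (fst x)) as [E1|]; [|simpl; ring].
    destruct (Nat.eqb_spec (r * s) (snd x)) as [E2|]; [|simpl; ring].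
    now rewrite <- E1, <- E2.
  + rewrite lsum_scal_r.
    rewrite <- (Rmult_1_l (F (p * q)%nat (r * s)%nat)) at 2.
    apply Rmult_le_compat_r; [apply HF|].
    unfold L; rewrite lsum_prod; simpl fst; simpl snd.
    rewrite (lsum_ext _ _ (fun x => iv (Nat.eqb (p * q) x) *
      lsum (rg B) (fun y => iv (Nat.eqb (r * s) y)))).
    * rewrite lsum_scal_r, <- (Rmult_1_l 1).
      apply Rmult_le_compat; try (apply lsum_ge_0; intros; apply iv_ge_0);
        apply iv_sum_le, rg_NoDup.
    * intros x _; rewrite <- lsum_scal; apply lsum_ext; intros y _.
      destruct (Nat.eqb (p * q) x), (Nat.eqb (r * s) y); simpl; ring.
Qed.

Definition submult (f : nat -> R) : Prop :=
  forall m n, (0 < m)%nat -> (0 < n)%nat -> f (m * n)%nat <= f m * f n.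

(** After refining the factorizations of [m * n], submultiplicativity splits [f (p * q)] and
    [f (r * s)], and the fourfold sum separates into the two convolutions. *)
Lemma conv_submult f : (forall n, 0 <= f n) -> submult f -> submult (conv f).
Proof.
intros H S m n Hm Hn.
rewrite (conv_range f (m * n) (m * n)) by (trivial; nia).
eapply Rle_trans;
  [apply (refinement_sum (fun a b => f a * f b) m n (m * n)); trivial|].
{ intros; now apply Rmult_le_pos. }
rewrite (conv_range f m (m * n)), (conv_range f n (m * n)) by (trivial; nia).
rewrite <- lsum_scal_r; apply lsum_le; intros p Hp; apply in_rg in Hp.
rewrite <- lsum_scal_r; apply lsum_le; intros r Hr; apply in_rg in Hr.
rewrite Rmult_assoc; apply Rmult_le_compat_l; [apply iv_ge_0|].
rewrite <- lsum_scal; apply lsum_le; intros q Hq; apply in_rg in Hq.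
rewrite <- lsum_scal; apply lsum_le; intros s Hs; apply in_rg in Hs.
replace (f p * f r * (iv (Nat.eqb (q * s) n) * (f q * f s)))
  with (iv (Nat.eqb (q * s) n) * ((f p * f q) * (f r * f s))) by ring.
apply Rmult_le_compat_l; [apply iv_ge_0|].
apply Rmult_le_compat; auto; apply S; lia.
Qed.

Definition sqsum (f : nat -> R) (B : nat) : R := lsum (rg B) (fun n => f n ^ 2).

Lemma sqsum_ge_0 f B : 0 <= sqsum f B.
Proof. apply lsum_ge_0; intros; apply pow2_ge_0. Qed.

(** One factor of [conv f N ^ 2] is opened as a sum over [N = m n], and the other is refined into
    arrays [p q r s] with [m = p r], [n = q s]. Submultiplicativity then makes every entry occur
    squared, and the sum over four free entries is the fourth power. *)
Lemma sqsum_conv f B : (forall n, 0 <= f n) -> submult f ->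
  sqsum (conv f) B <= sqsum f B ^ 4.
Proof.
intros H S.
set (W := fun m n => f m * f n * conv f (m * n)%nat).
assert (Hc := conv_ge_0 f H).
assert (HW : forall m n, 0 <= W m n).
{ intros; unfold W; repeat apply Rmult_le_pos; auto. }
apply Rle_trans with (lsum (rg B) (fun m => lsum (rg B) (fun n =>
   iv (Nat.leb (m * n) B) * W m n))).
{ unfold sqsum.
  rewrite (lsum_ext (rg B) _ (fun N => lsum (rg B) (fun m => lsum (rg B) (fun n =>
     iv (Nat.eqb (m * n) N) * W m n)))).
  - rewrite lsum_exch; apply lsum_le; intros m Hm.
    rewrite lsum_exch; apply lsum_le; intros n Hn; apply in_rg in Hm, Hn.
    rewrite lsum_scal_r; apply Rmult_le_compat_r; [apply HW|].
    destruct (Nat.leb_spec (m * n) B).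
    + simpl; apply iv_sum_le, rg_NoDup.
    + rewrite lsum_0; [simpl; lra|]; intros N HN; apply in_rg in HN.
      destruct (Nat.eqb_spec (m * n) N); [lia|reflexivity].
  - intros N HN; apply in_rg in HN.
    replace (conv f N ^ 2) with (conv f N * conv f N) by ring.
    rewrite (conv_range f N B) at 1 by trivial.
    rewrite <- lsum_scal_r; apply lsum_ext; intros m _.
    rewrite <- lsum_scal_r; apply lsum_ext; intros n _.
    destruct (Nat.eqb_spec (m * n) N) as [<-|]; unfold W; simpl; ring. }
apply Rle_trans with (lsum (rg B) (fun m => lsum (rg B) (fun n => f m * f n *
  lsum (rg B) (fun p => lsum (rg B) (fun r => iv (Nat.eqb (p * r) m) *
       lsum (rg B) (fun q => lsum (rg B) (fun s => iv (Nat.eqb (q * s) n) *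
         (f (p * q)%nat * f (r * s)%nat)))))))).
{ apply lsum_le; intros m Hm; apply lsum_le; intros n Hn; apply in_rg in Hm, Hn.
  destruct (Nat.leb_spec (m * n) B).
  - simpl iv; rewrite Rmult_1_l; unfold W.
    apply Rmult_le_compat_l; [now apply Rmult_le_pos|].
    rewrite (conv_range f (m * n) B) by (trivial; nia).
    apply (refinement_sum (fun a b => f a * f b)); try lia.
    intros; now apply Rmult_le_pos.
  - simpl iv; rewrite Rmult_0_l; apply Rmult_le_pos; [now apply Rmult_le_pos|].
    repeat (apply lsum_ge_0; intros; try (apply Rmult_le_pos; [apply iv_ge_0|])).
    now apply Rmult_le_pos. }
set (L := list_prod (rg B) (rg B)).
set (c := fun x : nat * nat => f (fst x) ^ 2 * f (snd x) ^ 2).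
assert (Hcc : forall x, 0 <= c x).
{ intros x; apply Rmult_le_pos; apply pow2_ge_0. }
apply Rle_trans with (lsum (rg B) (fun m => lsum (rg B) (fun n =>
  lsum L (fun x => lsum L (fun y => iv (Nat.eqb (fst x * snd x) m) *
    (iv (Nat.eqb (fst y * snd y) n) * (c x * c y))))))).
{ apply lsum_le; intros m Hm; apply lsum_le; intros n Hn; apply in_rg in Hm, Hn.
  unfold L at 1; rewrite lsum_prod, <- lsum_scal.
  apply lsum_le; intros p Hp; rewrite <- lsum_scal; apply lsum_le; intros r Hr.
  unfold L; rewrite lsum_prod, <- !lsum_scal.
  apply lsum_le; intros q Hq; rewrite <- !lsum_scal; apply lsum_le; intros s Hs.
  apply in_rg in Hp, Hr, Hq, Hs; simpl fst; simpl snd.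
  destruct (Nat.eqb_spec (p * r) m) as [<-|]; [|simpl; lra].
  destruct (Nat.eqb_spec (q * s) n) as [<-|]; [|simpl; lra].
  simpl iv; rewrite !Rmult_1_l; unfold c; simpl fst; simpl snd.
  apply Rle_trans with ((f p * f r * (f q * f s)) * (f p * f q * (f r * f s))).
  - assert (0 < p /\ 0 < q /\ 0 < r /\ 0 < s)%nat as [? [? [? ?]]] by lia.
    apply Rmult_le_compat; try (apply Rmult_le_pos; auto);
      apply Rmult_le_compat; auto.
  - right; ring. }
rewrite lsum_exch4.
apply Rle_trans with (lsum L (fun x => lsum L (fun y => c x * c y))).
- apply lsum_le; intros x _; apply lsum_le; intros y _.
  rewrite (lsum_ext _ _ (fun m => iv (Nat.eqb (fst x * snd x) m) *
    (lsum (rg B) (fun n => iv (Nat.eqb (fst y * snd y) n)) * (c x * c y)))).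
  + rewrite lsum_scal_r, <- Rmult_assoc.
    assert (0 <= c x * c y) by now apply Rmult_le_pos.
    rewrite <- (Rmult_1_l (c x * c y)) at 2.
    apply Rmult_le_compat_r; trivial.
    rewrite <- (Rmult_1_l 1).
    apply Rmult_le_compat; try (apply lsum_ge_0; intros; apply iv_ge_0);
      apply iv_sum_le, rg_NoDup.
  + intros m _; now rewrite lsum_scal, lsum_scal_r.
- rewrite <- lsum_mult; unfold L; rewrite lsum_prod; unfold c; simpl fst; simpl snd.
  rewrite <- lsum_mult; fold (sqsum f B); right; ring.
Qed.

(** * Gal sums *)

Definition w (s : R) (n : nat) : R := Rpower (INR n) (- s).

Lemma w_gt_0 s n : 0 < w s n.
Proof. apply exp_pos. Qed.

Lemma w_ge_0 s n : 0 <= w s n.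
Proof. left; apply w_gt_0. Qed.

Lemma INR_ge_1 n : (0 < n)%nat -> 1 <= INR n.
Proof. intros H; apply (le_INR 1); lia. Qed.

Lemma w_mult s m n : (0 < m)%nat -> (0 < n)%nat -> w s (m * n) = w s m * w s n.
Proof.
intros Hm Hn; apply INR_ge_1 in Hm, Hn; unfold w; rewrite mult_INR.
symmetry; apply Rpower_mult_distr; lra.
Qed.

Lemma w_plus a b n : w (a + b) n = w a n * w b n.
Proof. unfold w; rewrite Ropp_plus_distr; apply Rpower_plus. Qed.

Lemma w_le_exp a b n : (0 < n)%nat -> a <= b -> w b n <= w a n.
Proof. intros Hn H; apply Rle_Rpower; [now apply INR_ge_1|lra]. Qed.

Lemma w_1 s : w s 1 = 1.
Proof. unfold w, Rpower; simpl INR; rewrite ln_1, Rmult_0_r; apply exp_0. Qed.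

Lemma w_decr s m n : 0 <= s -> (0 < m <= n)%nat -> w s n <= w s m.
Proof.
intros Hs [Hm H]; apply le_INR in H; apply INR_ge_1 in Hm.
unfold w; rewrite !Rpower_Ropp; apply Rinv_le_contravar; [apply exp_pos|].
apply Rle_Rpower_l; lra.
Qed.

Lemma w_sq s n : w s n ^ 2 = w (2 * s) n.
Proof. replace (2 * s) with (s + s) by ring; rewrite w_plus; ring. Qed.

Definition zs (s : R) (B : nat) : R := lsum (rg B) (w s).

Lemma zs_S s B : zs s (S B) = zs s B + w s (S B).
Proof.
unfold zs; rewrite seq_S, lsum_app; f_equal; unfold lsum; simpl; ring.
Qed.

Lemma zs_ge_1 s B : (0 < B)%nat -> 1 <= zs s B.
Proof.
intros HB; rewrite <- (w_1 s) at 1; apply (lsum_term (rg B) (w s)).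
- intros; apply w_ge_0.
- apply in_rg; lia.
Qed.

Lemma zs_mono s B B' : (B <= B')%nat -> zs s B <= zs s B'.
Proof.
intros H; apply lsum_incl; [intros; apply w_ge_0|apply rg_NoDup|now apply rg_incl].
Qed.

(** Discrete integral test: [(s - 1) n^(-s) <= (n - 1)^(1 - s) - n^(1 - s)] telescopes. The
    induction needs the sharper form that keeps the term [w (s - 1) (S B)]. *)
Lemma zs_bound s B : 1 < s -> zs s B <= 1 + / (s - 1).
Proof.
intros Hs.
assert (Hi : 0 < / (s - 1)) by (apply Rinv_0_lt_compat; lra).
destruct B as [|B]; [unfold zs, lsum; simpl; lra|].
cut (zs s (S B) <= 1 + / (s - 1) * (1 - w (s - 1) (S B))).
{ generalize (w_gt_0 (s - 1) (S B)); nra. }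
induction B as [|B IH].
- unfold zs, lsum; simpl; rewrite !w_1; lra.
- rewrite zs_S.
  cut ((s - 1) * w s (S (S B)) <= w (s - 1) (S B) - w (s - 1) (S (S B))).
  { intros K; apply (Rmult_le_compat_l (/ (s - 1))) in K; [|lra].
    rewrite <- Rmult_assoc, Rinv_l in K by lra; lra. }
  set (n := INR (S (S B))).
  assert (Hn : 2 <= n) by (apply (le_INR 2); lia).
  assert (Hn' : INR (S B) = n - 1) by (unfold n; rewrite (S_INR (S B)); ring).
  assert (E : w s (S (S B)) = w (s - 1) (S (S B)) / n).
  { replace s with ((s - 1) + 1) at 1 by ring; rewrite w_plus; unfold Rdiv; f_equal.
    unfold w; fold n; rewrite Rpower_Ropp, Rpower_1; lra. }
  rewrite E.
  assert (K : w (s - 1) (S (S B)) * (1 + (s - 1) / n) <= w (s - 1) (S B)).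
  { unfold w; fold n; rewrite Hn'; unfold Rpower.
    replace (- (s - 1) * ln (n - 1)) with
      (- (s - 1) * ln n + (s - 1) * (ln n - ln (n - 1))) by ring.
    rewrite exp_plus; apply Rmult_le_compat_l; [left; apply exp_pos|].
    eapply Rle_trans; [|apply exp_ineq1_le].
    apply Rplus_le_compat_l; unfold Rdiv; apply Rmult_le_compat_l; [lra|].
    assert (0 < / n) by (apply Rinv_0_lt_compat; lra).
    assert (X : ln (n - 1) = ln n + ln (1 - / n)).
    { rewrite <- ln_mult; [f_equal; field; lra|lra|].
      assert (/ n <= / 2) by (apply Rinv_le_contravar; lra); lra. }
    assert (Y : ln (1 - / n) <= - / n).
    { assert (/ n <= / 2) by (apply Rinv_le_contravar; lra).
      rewrite <- (ln_exp (- / n)); apply ln_le; [lra|].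
      generalize (exp_ineq1_le (- / n)); lra. }
    lra. }
  unfold Rdiv in *; lra.
Qed.

(* The block [A < n <= A B] is compared with [n <= B] through [n = q A + r]. *)
Lemma zs_mul s A B : 1 <= s -> (0 < A)%nat -> (0 < B)%nat ->
  zs s (A * B) <= zs s A + zs s B.
Proof.
intros Hs HA HB.
cut (forall b, zs s (A * (S b)) <= zs s A + zs s b).
{ intros K; destruct B as [|b]; [lia|].
  eapply Rle_trans; [apply K|]; apply Rplus_le_compat_l, zs_mono; lia. }
induction b as [|b IH].
- rewrite Nat.mul_1_r; unfold zs, lsum at 3; simpl; lra.
- rewrite zs_S.
  replace (A * S (S b))%nat with (A * S b + A)%nat by lia.
  unfold zs at 1; rewrite seq_app, lsum_app; fold (zs s (A * S b)).
  cut (lsum (List.seq (1 + A * S b) A) (w s) <= w s (S b)); [lra|].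
  eapply Rle_trans; [apply (lsum_le _ _ (fun _ => w s (A * S b)))|].
  + intros n Hn; apply in_seq in Hn; apply w_decr; [lra|lia].
  + rewrite lsum_const, length_seq, w_mult by lia.
    rewrite <- Rmult_assoc; rewrite <- (Rmult_1_l (w s (S b))) at 2.
    apply Rmult_le_compat_r; [apply w_ge_0|].
    eapply Rle_trans; [apply Rmult_le_compat_l, (w_le_exp 1 s A HA Hs)|].
    * left; apply lt_0_INR; lia.
    * apply INR_ge_1 in HA; unfold w; rewrite Rpower_Ropp, Rpower_1 by lra.
      right; field; lra.
Qed.

(** Uniform in [s >= 1]: lengthening the range to a fixed power costs a constant factor, however
    close [s] is to 1. This is what allows zeta(2 sigma) to cancel. *)
Lemma zs_pow s A i : 1 <= s -> (0 < A)%nat -> zs s (A ^ i) <= INR (S i) * zs s A.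
Proof.
intros Hs HA; induction i as [|i IH].
- simpl Nat.pow; simpl INR; rewrite Rmult_1_l; apply zs_mono; lia.
- rewrite Nat.pow_succ_r'; eapply Rle_trans; [apply zs_mul; trivial|].
  + apply Nat.neq_0_lt_0, Nat.pow_nonzero; lia.
  + rewrite (S_INR (S i)); lra.
Qed.

(** * The gcd matrix, its powers, and correlations of dilated sequences *)

Definition gk (s : R) (x y : nat) : R :=
  w s (x / Nat.gcd x y) * w s (y / Nat.gcd x y).

Lemma gk_ge_0 s x y : 0 <= gk s x y.
Proof. apply Rmult_le_pos; apply w_ge_0. Qed.

Lemma gk_sym s x y : gk s x y = gk s y x.
Proof. unfold gk; rewrite (Nat.gcd_comm y x); ring. Qed.

Lemma gk_same s x : (0 < x)%nat -> gk s x x = 1.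
Proof.
intros H; unfold gk; rewrite Nat.gcd_diag, Nat.div_same, w_1 by lia; ring.
Qed.

Lemma gcd_div x y : (0 < x)%nat -> (0 < y)%nat ->
  let d := Nat.gcd x y in
  (0 < d /\ x = d * (x / d) /\ y = d * (y / d) /\ 0 < x / d /\ 0 < y / d)%nat.
Proof.
intros Hx Hy d.
assert (Hd : d <> 0%nat) by (intros K; apply Nat.gcd_eq_0_l in K; lia).
assert (Ex : (x = d * (x / d))%nat).
{ apply Nat.Div0.div_exact, Nat.Lcm0.mod_divide, Nat.gcd_divide_l. }
assert (Ey : (y = d * (y / d))%nat).
{ apply Nat.Div0.div_exact, Nat.Lcm0.mod_divide, Nat.gcd_divide_r. }
repeat split; trivial; nia.
Qed.

Lemma gk_gcd_lcm s x y : (0 < x)%nat -> (0 < y)%nat ->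
  Rpower (INR (Nat.gcd x y)) s / Rpower (INR (Nat.lcm x y)) s = gk s x y.
Proof.
intros Hx Hy; destruct (gcd_div x y Hx Hy) as [Hd [Ex [Ey [H1 H2]]]].
unfold gk; set (d := Nat.gcd x y) in *.
replace (Nat.lcm x y) with (d * ((x / d) * (y / d)))%nat.
- replace s with (- - s) at 1 2 by ring; fold (w (- s) d).
  fold (w (- s) (d * (x / d * (y / d)))).
  rewrite !w_mult by nia.
  assert (K : forall n, w (- s) n = / w s n).
  { intros n; unfold w; now rewrite <- Rpower_Ropp. }
  rewrite !K.
  generalize (w_gt_0 s d) (w_gt_0 s (x / d)) (w_gt_0 s (y / d)); intros.
  field; lra.
- unfold Nat.lcm; fold d; rewrite Ex at 2; lia.
Qed.

Definition gsum (s : R) (M : list nat) : R := lsum M (fun x => lsum M (gk s x)).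

Lemma gcd_sum_gsum s M : (forall m, In m M -> (0 < m)%nat) -> gcd_sum s M = gsum s M.
Proof.
intros H; apply (lsum_ext M); intros x Hx; apply (lsum_ext M); intros y Hy.
apply gk_gcd_lcm; auto.
Qed.

(* [gkpow s M i] is the [2^i]-th power of the matrix [gk s] indexed by [M]. *)
Fixpoint gkpow (s : R) (M : list nat) (i : nat) (x y : nat) : R :=
  match i with
  | O => gk s x y
  | S i => lsum M (fun z => gkpow s M i x z * gkpow s M i z y)
  end.

Lemma gkpow_ge_0 s M i x y : 0 <= gkpow s M i x y.
Proof.
revert x y; induction i; intros; simpl; [apply gk_ge_0|].
apply lsum_ge_0; intros; now apply Rmult_le_pos.
Qed.

Lemma gkpow_sym s M i x y : gkpow s M i x y = gkpow s M i y x.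
Proof.
revert x y; induction i as [|i IH]; intros x y; simpl; [apply gk_sym|].
apply lsum_ext; intros z _; rewrite (IH x z), (IH z y); ring.
Qed.

(** Repeated Cauchy-Schwarz: for a symmetric matrix [K] and the all-ones vector [e], the square of
    [e K^j e] is at most [N |K^j e|^2 = N (e K^(2 j) e)]. *)
Lemma gsum_pow s M i : M <> [] ->
  gsum s M ^ (2 ^ i)
  <= INR (length M) ^ (2 ^ i - 1) * lsum M (fun x => lsum M (gkpow s M i x)).
Proof.
intros HM.
assert (HN : 1 <= INR (length M)).
{ apply INR_ge_1; destruct M; [easy|simpl; lia]. }
induction i as [|i IH].
- simpl Nat.pow; simpl Nat.sub; rewrite pow_1, pow_O, Rmult_1_l; apply Rle_refl.
- rewrite Nat.pow_succ_r', Nat.mul_comm, pow_mult.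
  assert (P := Nat.pow_nonzero 2 i ltac:(lia)).
  assert (H0 : 0 <= gsum s M).
  { apply lsum_ge_0; intros; apply lsum_ge_0; intros; apply gk_ge_0. }
  eapply Rle_trans; [apply pow_incr; split; [now apply pow_le|exact IH]|].
  rewrite Rpow_mult_distr, <- pow_mult.
  replace (2 ^ i * 2 - 1)%nat with ((2 ^ i - 1) * 2 + 1)%nat by lia.
  rewrite pow_add, pow_1, Rmult_assoc; apply Rmult_le_compat_l;
    [apply pow_le; lra|].
  eapply Rle_trans; [apply lsum_CS|].
  apply Rmult_le_compat_l; [lra|].
  rewrite (lsum_ext M (fun x => lsum M (gkpow s M i x) ^ 2) (fun x =>
    lsum M (fun y => lsum M (fun z => gkpow s M i x y * gkpow s M i x z)))).
  + rewrite lsum_exch; right; apply lsum_ext; intros y _.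
    rewrite lsum_exch; apply lsum_ext; intros z _; simpl.
    apply lsum_ext; intros x _; now rewrite (gkpow_sym s M i x y).
  + intros x _; simpl; now rewrite Rmult_1_r, lsum_mult.
Qed.

(* [phi s i n = d_j(n) n^(-s)], with [d_j] the [j]-fold divisor function, [j = 2^i]. *)
Fixpoint phi (s : R) (i : nat) : nat -> R :=
  match i with O => w s | S i => conv (phi s i) end.

Lemma phi_ge_0 s i n : 0 <= phi s i n.
Proof.
revert n; induction i; intros; simpl; [apply w_ge_0|now apply conv_ge_0].
Qed.

Lemma phi_submult s i : submult (phi s i).
Proof.
induction i; simpl.
- intros m n Hm Hn; rewrite w_mult by trivial; apply Rle_refl.
- apply conv_submult; trivial; apply phi_ge_0.
Qed.

(** Each convolution doubles [j] and raises the bound to the fourth power, so the exponent is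
    [4^i = j^2]. *)
Lemma sqsum_phi s i B Z : zs (2 * s) B <= Z -> sqsum (phi s i) B <= Z ^ (4 ^ i).
Proof.
intros HZ; induction i as [|i IH].
- simpl Nat.pow; rewrite pow_1; eapply Rle_trans; [|exact HZ].
  right; apply lsum_ext; intros n _; apply w_sq.
- simpl phi; eapply Rle_trans; [apply sqsum_conv; [apply phi_ge_0|apply phi_submult]|].
  rewrite Nat.pow_succ_r', Nat.mul_comm, pow_mult.
  apply pow_incr; split; [apply sqsum_ge_0|exact IH].
Qed.

(** Inner product of two dilates of [f], one carried by the multiples of [x] and the other by the
    multiples of [y]. *)
Definition corr (f : nat -> R) (B x y : nat) : R :=
  lsum (rg B) (fun a => lsum (rg B) (fun b =>
    iv (Nat.eqb (x * a) (y * b)) * (f a * f b))).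

(** By [2 f a f b <= f a ^ 2 + f b ^ 2], since [x a = y b] determines each of [a] and [b] from the
    other. *)
Lemma corr_le f B x y : (0 < x)%nat -> (0 < y)%nat -> corr f B x y <= sqsum f B.
Proof.
intros Hx Hy.
apply Rle_trans with (lsum (rg B) (fun a => lsum (rg B) (fun b =>
  / 2 * f a ^ 2 * iv (Nat.eqb (x * a) (y * b))
  + / 2 * f b ^ 2 * iv (Nat.eqb (x * a) (y * b))))).
- apply lsum_le; intros a _; apply lsum_le; intros b _.
  assert (K := pow2_ge_0 (f a - f b)).
  destruct (Nat.eqb (x * a) (y * b)); simpl iv; lra.
- rewrite (lsum_ext _ _ (fun a => / 2 * f a ^ 2 *
     lsum (rg B) (fun b => iv (Nat.eqb (x * a) (y * b)))
     + lsum (rg B) (fun b => / 2 * f b ^ 2 * iv (Nat.eqb (x * a) (y * b))))).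
  2: { intros a _; now rewrite lsum_plus, lsum_scal. }
  rewrite lsum_plus, (lsum_exch (rg B) (rg B)).
  apply Rle_trans with (/ 2 * sqsum f B + / 2 * sqsum f B); [|right; field].
  unfold sqsum; apply Rplus_le_compat; rewrite <- lsum_scal; apply lsum_le;
    intros a _; [|rewrite lsum_scal]; rewrite <- (Rmult_1_r (/ 2 * f a ^ 2)) at 2;
    (apply Rmult_le_compat_l; [generalize (pow2_ge_0 (f a)); lra|]).
  + apply (lsum_unique (rg B) (fun b => Nat.eqb (x * a) (y * b))); [apply rg_NoDup|].
    intros u v; rewrite !Nat.eqb_eq; nia.
  + apply (lsum_unique (rg B) (fun b => Nat.eqb (x * b) (y * a))); [apply rg_NoDup|].
    intros u v; rewrite !Nat.eqb_eq; nia.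
Qed.

(** The relations [x a = z b] and [z a' = y b'] multiply to [x (a a') = y (b b')], and the first one
    determines [z]. Hence the sum over [z] costs nothing, and grouping by [a a'] and [b b'] produces
    convolutions. *)
Lemma corr_step f B M x y : NoDup M -> (forall z, In z M -> 0 < z)%nat ->
  (0 < x)%nat -> (0 < y)%nat -> (forall n, 0 <= f n) ->
  lsum M (fun z => corr f B x z * corr f B z y) <= corr (conv f) (B * B) x y.
Proof.
intros ND HM Hx Hy Hf.
set (L := list_prod (rg B) (rg B)).
set (c := fun p : nat * nat => f (fst p) * f (snd p)).
assert (Hc : forall p, 0 <= c p) by (intros; unfold c; now apply Rmult_le_pos).
apply Rle_trans with (lsum L (fun p => lsum L (fun q =>
  iv (Nat.eqb (x * (fst p * snd p)) (y * (fst q * snd q))) * (c p * c q)))).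
- apply Rle_trans with (lsum M (fun z => lsum L (fun p => lsum L (fun q =>
    iv (Nat.eqb (x * fst p) (z * fst q)) * iv (Nat.eqb (z * snd p) (y * snd q))
    * (c p * c q))))).
  + right; apply lsum_ext; intros z _.
    unfold corr; rewrite lsum_mult.
    unfold L at 1; rewrite lsum_prod; apply lsum_ext; intros a _.
    apply lsum_ext; intros a' _; rewrite lsum_mult.
    unfold L; rewrite lsum_prod; apply lsum_ext; intros b _.
    apply lsum_ext; intros b' _; unfold c; simpl; ring.
  + rewrite lsum_exch; apply lsum_le; intros p Hp; rewrite lsum_exch.
    apply lsum_le; intros q Hq.
    destruct p as [a a'], q as [b b']; apply in_prod_iff in Hp, Hq.
    rewrite !in_rg in Hp, Hq; simpl fst; simpl snd.
    rewrite lsum_scal_r; apply Rmult_le_compat_r; [now apply Rmult_le_pos|].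
    rewrite (lsum_ext _ _ (fun z => iv (Nat.eqb (x * a) (z * b)
                                        && Nat.eqb (z * a') (y * b')))).
    2: { intros; destruct (Nat.eqb (x * a) (x0 * b)); simpl; ring. }
    destruct (Nat.eqb_spec (x * (a * a')) (y * (b * b'))).
    * simpl iv at 2; apply (lsum_unique M (fun z => Nat.eqb (x * a) (z * b)
                                        && Nat.eqb (z * a') (y * b')))%bool; trivial.
      intros u v; rewrite !Bool.andb_true_iff, !Nat.eqb_eq; nia.
    * rewrite lsum_0; [simpl; lra|]; intros z Hz.
      destruct (Nat.eqb_spec (x * a) (z * b)); [|reflexivity].
      destruct (Nat.eqb_spec (z * a') (y * b')); [|reflexivity].
      exfalso; apply n.
      rewrite Nat.mul_assoc, e, <- Nat.mul_assoc, (Nat.mul_comm b), Nat.mul_assoc, e0.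
      ring.
- set (G := fun A B' => iv (Nat.eqb (x * A) (y * B'))).
  assert (HG : forall u v, 0 <= G u v) by (intros; apply iv_ge_0).
  unfold corr.
  apply Rle_trans with (lsum (rg (B * B)) (fun A => lsum (rg (B * B)) (fun A' =>
     lsum L (fun p => lsum L (fun q => iv (Nat.eqb (fst p * snd p) A) *
        iv (Nat.eqb (fst q * snd q) A') * (G A A' * (c p * c q))))))).
  + rewrite lsum_exch4; apply lsum_le; intros p Hp; apply lsum_le; intros q Hq.
    destruct p as [a a'], q as [b b']; apply in_prod_iff in Hp, Hq.
    rewrite !in_rg in Hp, Hq; simpl fst; simpl snd.
    eapply Rle_trans; [|apply (lsum_term (rg (B * B)) _ (a * a')%nat)].
    * eapply Rle_trans; [|apply (lsum_term (rg (B * B)) _ (b * b')%nat)].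
      -- rewrite !Nat.eqb_refl; unfold G; simpl; lra.
      -- intros; repeat apply Rmult_le_pos; try apply iv_ge_0; auto.
      -- apply in_rg; nia.
    * intros; apply lsum_ge_0; intros; repeat apply Rmult_le_pos; try apply iv_ge_0; auto.
    * apply in_rg; nia.
  + apply lsum_le; intros A HA; apply lsum_le; intros A' HA'; apply in_rg in HA, HA'.
    fold (G A A').
    rewrite (conv_range f A (B * B)), (conv_range f A' (B * B)) by trivial.
    set (u := fun A p => iv (Nat.eqb (fst p * snd p) A) * c p).
    assert (Hu : forall A p, 0 <= u A p).
    { intros; unfold u; apply Rmult_le_pos; [apply iv_ge_0|trivial]. }
    apply Rle_trans with (G A A' * (lsum L (u A) * lsum L (u A'))).
    * rewrite lsum_mult, <- lsum_scal; right; apply lsum_ext; intros p _.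
      rewrite <- lsum_scal; apply lsum_ext; intros q _; unfold u; ring.
    * apply Rmult_le_compat_l; trivial.
      assert (X : forall A, lsum L (u A) <= lsum (rg (B * B)) (fun a =>
        lsum (rg (B * B)) (fun b => iv (Nat.eqb (a * b) A) * (f a * f b)))).
      { intros A0; unfold L; rewrite lsum_prod.
        assert (B <= B * B)%nat by nia.
        eapply Rle_trans; [|apply (lsum_incl (rg B) (rg (B * B)))].
        - apply lsum_le; intros a _; apply (lsum_incl (rg B) (rg (B * B)));
            [|apply rg_NoDup|now apply rg_incl].
          intros b _; apply (Hu A0 (a, b)).
        - intros a _; apply lsum_ge_0; intros b _; apply (Hu A0 (a, b)).
        - apply rg_NoDup.
        - now apply rg_incl. }
      apply Rmult_le_compat; try (apply lsum_ge_0; auto); apply X.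
Qed.

(** In the base case the single pair [a = y / gcd], [b = x / gcd] already contributes [gk s x y].
    Every squaring of the matrix is then one application of [corr_step], which squares the range. *)
Lemma gkpow_corr s M B i x y : NoDup M -> (forall z, In z M -> 0 < z <= B)%nat ->
  In x M -> In y M -> gkpow s M i x y <= corr (phi s i) (B ^ (2 ^ i)) x y.
Proof.
intros ND HM; revert x y; induction i as [|i IH]; intros x y Hx Hy.
- simpl Nat.pow; rewrite Nat.mul_1_r.
  destruct (HM x Hx) as [Hx0 HxB], (HM y Hy) as [Hy0 HyB].
  destruct (gcd_div x y Hx0 Hy0) as [Hd [Ex [Ey [H1 H2]]]].
  simpl; unfold corr, gk; set (d := Nat.gcd x y) in *.
  assert (X : forall a b, 0 <= iv (x * a =? y * b)%nat * (w s a * w s b)).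
  { intros; repeat apply Rmult_le_pos; try apply iv_ge_0; apply w_ge_0. }
  eapply Rle_trans; [|apply (lsum_term (rg B) _ (y / d)%nat)].
  + eapply Rle_trans; [|apply (lsum_term (rg B) _ (x / d)%nat)]; auto.
    * cbv beta; destruct (Nat.eqb_spec (x * (y / d)) (y * (x / d))); [simpl iv; right; ring|].
      exfalso; nia.
    * apply in_rg; nia.
  + intros; now apply lsum_ge_0.
  + apply in_rg; nia.
- simpl gkpow; eapply Rle_trans.
  + apply lsum_le; intros z Hz; apply Rmult_le_compat; try apply gkpow_ge_0;
      apply IH; trivial.
  + eapply Rle_trans; [apply corr_step; trivial|].
    * intros; now apply HM.
    * now apply HM.
    * now apply HM.
    * apply phi_ge_0.
    * simpl phi; rewrite Nat.pow_succ_r'.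
      replace (2 * 2 ^ i)%nat with (2 ^ i + 2 ^ i)%nat by lia.
      rewrite Nat.pow_add_r; apply Rle_refl.
Qed.

(** All [N^2] entries of the matrix power are bounded by the same [Z ^ (4 ^ i)]. The lost powers of
    [N] are harmless once a root of high order is taken. *)
Lemma gal_bound s M i Z : M <> [] -> NoDup M -> (forall z, In z M -> 0 < z)%nat ->
  (forall B, zs (2 * s) B <= Z) ->
  gsum s M ^ (2 ^ i) <= INR (length M) ^ (2 ^ i + 1) * Z ^ (4 ^ i).
Proof.
intros HM ND H0 HZ; eapply Rle_trans; [now apply gsum_pow|].
assert (P := Nat.pow_nonzero 2 i ltac:(lia)).
replace (2 ^ i + 1)%nat with ((2 ^ i - 1) + 2)%nat by lia.
rewrite pow_add, Rmult_assoc; apply Rmult_le_compat_l; [apply pow_le, pos_INR|].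
set (B := list_max M).
assert (HB : forall z, In z M -> (0 < z <= B)%nat).
{ intros z Hz; split; [auto|].
  assert (K := proj1 (list_max_le M B) (le_n _)).
  rewrite Forall_forall in K; auto. }
replace (INR (length M) ^ 2 * Z ^ 4 ^ i) with
  (INR (length M) * (INR (length M) * Z ^ 4 ^ i)) by ring.
rewrite <- (lsum_const M (INR (length M) * _)); apply lsum_le; intros x Hx.
rewrite <- lsum_const; apply lsum_le; intros y Hy.
eapply Rle_trans; [now apply (gkpow_corr s M B)|].
eapply Rle_trans; [apply corr_le; auto|].
apply sqsum_phi, HZ.
Qed.

(** * Truncated Gal sums and trigonometric sums *)

Lemma gal_bound_root s M i Z X : M <> [] -> NoDup M ->
  (forall z, In z M -> 0 < z)%nat -> (forall B, zs (2 * s) B <= Z) -> 0 < X ->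
  INR (length M) * Z ^ (4 ^ i) <= X ^ (2 ^ i) -> gsum s M <= INR (length M) * X.
Proof.
intros HM ND H0 HZ HX H.
assert (HN : 1 <= INR (length M)).
{ apply INR_ge_1; destruct M; [easy|simpl; lia]. }
assert (P := Nat.pow_nonzero 2 i ltac:(lia)).
destruct (Rle_lt_dec (gsum s M) (INR (length M) * X)) as [|K]; [trivial|].
assert (G := gal_bound s M i Z HM ND H0 HZ).
exfalso; revert G; apply Rlt_not_le.
eapply Rle_lt_trans.
- rewrite pow_add, pow_1, Rmult_assoc; apply Rmult_le_compat_l;
    [apply pow_le; lra|exact H].
- rewrite <- Rpow_mult_distr.
  assert (Hp : (0 < 2 ^ i)%nat) by lia.
  assert (H1 : 0 < INR (length M) * X) by nra.
  revert Hp; generalize (2 ^ i)%nat; intros j Hj; destruct j as [|j]; [lia|].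
  clear - K H1; induction j as [|j IH]; [simpl; lra|].
  change ((INR (length M) * X) * (INR (length M) * X) ^ S j < gsum s M * gsum s M ^ S j).
  apply Rmult_gt_0_lt_compat; trivial; try lra; apply pow_lt; lra.
Qed.

Definition gtrunc (s : R) (G : nat) (M : list nat) : R :=
  lsum M (fun x => lsum M (fun y =>
    iv (Nat.leb (x / Nat.gcd x y) G && Nat.leb (y / Nat.gcd x y) G) * gk s x y)).

Lemma gsum_ge_length s M : (forall z, In z M -> 0 < z)%nat ->
  INR (length M) <= gsum s M.
Proof.
intros H; rewrite <- (Rmult_1_r (INR _)), <- lsum_const; apply lsum_le; intros x Hx.
rewrite <- (gk_same s x) by auto.
apply (lsum_term M (gk s x)); trivial; intros; apply gk_ge_0.
Qed.

(** Rankin's trick: a cofactor above [G] allows a factor [w d G] to be extracted at the price of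
    lowering the exponent by [d]. The discarded part is at most half of [gsum s M], because the
    diagonal alone gives [INR (length M)]. *)
Lemma gtrunc_ge s d G M : 0 < d < s -> (0 < G)%nat ->
  (forall z, In z M -> 0 < z)%nat ->
  w d G * gsum (s - d) M <= INR (length M) / 2 -> gsum s M / 2 <= gtrunc s G M.
Proof.
intros [Hd Hds] HG H0 H.
assert (X : gsum s M <= gtrunc s G M + w d G * gsum (s - d) M).
{ unfold gsum, gtrunc; rewrite <- lsum_scal, <- lsum_plus.
  apply lsum_le; intros x Hx; rewrite <- lsum_scal, <- lsum_plus.
  apply lsum_le; intros y Hy.
  destruct (gcd_div x y (H0 x Hx) (H0 y Hy)) as [_ [_ [_ [H1 H2]]]].
  assert (T : forall a b, (0 < a)%nat -> (0 < b)%nat -> (G < a)%nat ->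
     w s a * w s b <= w d G * (w (s - d) a * w (s - d) b)).
  { intros a b Ha Hb HGa.
    replace (w s a) with (w d a * w (s - d) a) by (rewrite <- w_plus; f_equal; ring).
    rewrite <- Rmult_assoc; apply Rmult_le_compat; try apply w_ge_0.
    - apply Rmult_le_pos; apply w_ge_0.
    - apply Rmult_le_compat_r; [apply w_ge_0|apply w_decr; [lra|lia]].
    - apply w_le_exp; [trivial|lra]. }
  assert (P := gk_ge_0 (s - d) x y).
  assert (Q := w_ge_0 d G).
  destruct (Nat.leb_spec (x / Nat.gcd x y) G).
  - destruct (Nat.leb_spec (y / Nat.gcd x y) G); simpl iv; [nra|].
    unfold gk; rewrite Rmult_0_l, Rplus_0_l, Rmult_comm.
    rewrite (Rmult_comm (w (s - d) _)); apply T; trivial.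
  - simpl iv; unfold gk; rewrite Rmult_0_l, Rplus_0_l; apply T; trivial. }
assert (Y := gsum_ge_length s M H0); lra.
Qed.

(** * Complex exponentials and finite trigonometric sums *)

Definition cis (x : R) : C := (cos x, sin x).

Lemma cis_plus x y : cis (x + y) = (cis x * cis y)%C.
Proof. unfold cis, Cmult; simpl; rewrite cos_plus, sin_plus; f_equal; ring. Qed.

Lemma cis_0 : cis 0 = 1%C.
Proof. unfold cis; now rewrite cos_0, sin_0. Qed.

Lemma Cmod_sqr (z : C) : Cmod z ^ 2 = Re z ^ 2 + Im z ^ 2.
Proof. unfold Cmod, Re, Im; apply pow2_sqrt; nra. Qed.

Lemma Cmod_cis x : Cmod (cis x) = 1.
Proof.
unfold Cmod, cis; simpl; rewrite !Rmult_1_r.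
replace (_ + _) with 1; [apply sqrt_1|].
generalize (sin2_cos2 x); unfold Rsqr; lra.
Qed.

Lemma cpow_cis (x a t : R) : 0 < x ->
  cpow x (a, t) = (RtoC (Rpower x a) * cis (t * ln x))%C.
Proof.
intros _; unfold cpow, Cexp, cis, RtoC, Cmult, Re, Im, Rpower; simpl.
replace (a * ln x - t * 0) with (a * ln x) by ring.
replace (a * 0 + t * ln x) with (t * ln x) by ring.
f_equal; ring.
Qed.

Definition csum {A : Type} (l : list A) (f : A -> C) : C :=
  fold_right Cplus (RtoC 0) (map f l).

Lemma csum_cons {A} (x : A) l f : csum (x :: l) f = (f x + csum l f)%C.
Proof. reflexivity. Qed.

Lemma csum_app {A} (l1 l2 : list A) f :
  csum (l1 ++ l2) f = (csum l1 f + csum l2 f)%C.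
Proof.
induction l1 as [|x l1 IH]; simpl app; [unfold csum at 2; simpl; ring|].
rewrite !csum_cons, IH; ring.
Qed.

Lemma csum_ext {A} (l : list A) f g :
  (forall x, In x l -> f x = g x) -> csum l f = csum l g.
Proof.
induction l as [|x l IH]; intros H; [reflexivity|].
rewrite !csum_cons, IH, (H x); auto with datatypes.
Qed.

Lemma csum_plus {A} (l : list A) f g :
  csum l (fun x => f x + g x)%C = (csum l f + csum l g)%C.
Proof.
induction l as [|x l IH]; [unfold csum; simpl; ring|].
rewrite !csum_cons, IH; ring.
Qed.

Lemma csum_scal {A} (l : list A) c f :
  csum l (fun x => c * f x)%C = (c * csum l f)%C.
Proof.
induction l as [|x l IH]; [unfold csum; simpl; ring|].
rewrite !csum_cons, IH; ring.
Qed.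

Lemma csum_scal_r {A} (l : list A) c f :
  csum l (fun x => f x * c)%C = (csum l f * c)%C.
Proof.
rewrite Cmult_comm, <- csum_scal; apply csum_ext; intros; ring.
Qed.

Lemma csum_RtoC {A} (l : list A) f : csum l (fun x => RtoC (f x)) = RtoC (lsum l f).
Proof.
induction l as [|x l IH]; [reflexivity|].
now rewrite csum_cons, lsum_cons, IH, RtoC_plus.
Qed.

Lemma csum_mult {A B} (l1 : list A) (l2 : list B) f g :
  (csum l1 f * csum l2 g)%C = csum (list_prod l1 l2) (fun p => f (fst p) * g (snd p))%C.
Proof.
induction l1 as [|x l1 IH]; [unfold csum; simpl; ring|].
simpl list_prod; rewrite csum_app, <- IH, csum_cons, Cmult_plus_distr_r; f_equal.
rewrite <- csum_scal; unfold csum; now rewrite map_map.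
Qed.

Lemma Cmod_csum {A} (l : list A) f : Cmod (csum l f) <= lsum l (fun x => Cmod (f x)).
Proof.
induction l as [|x l IH].
- unfold csum, lsum; simpl; rewrite Cmod_0; lra.
- rewrite csum_cons, lsum_cons; eapply Rle_trans; [apply Cmod_triangle|]; lra.
Qed.

Lemma Re_csum {A} (l : list A) f : Re (csum l f) = lsum l (fun x => Re (f x)).
Proof.
induction l as [|x l IH]; [reflexivity|].
rewrite csum_cons, lsum_cons, <- IH; reflexivity.
Qed.

Lemma Im_csum {A} (l : list A) f : Im (csum l f) = lsum l (fun x => Im (f x)).
Proof.
induction l as [|x l IH]; [reflexivity|].
rewrite csum_cons, lsum_cons, <- IH; reflexivity.
Qed.

Lemma Cmod_trig_sqr {A} (l : list A) (c al : A -> R) :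
  Cmod (csum l (fun p => RtoC (c p) * cis (al p))%C) ^ 2
  = lsum l (fun p => lsum l (fun q => c p * c q * cos (al p - al q))).
Proof.
rewrite Cmod_sqr, Re_csum, Im_csum.
rewrite (lsum_ext l _ (fun p => c p * cos (al p)))
  by (intros; unfold Re; simpl; ring).
rewrite (lsum_ext l (fun p => Im _) (fun p => c p * sin (al p)))
  by (intros; unfold Im; simpl; ring).
simpl; rewrite !Rmult_1_r, !lsum_mult, <- lsum_plus.
apply lsum_ext; intros p _; rewrite <- lsum_plus; apply lsum_ext; intros q _.
rewrite cos_minus; ring.
Qed.

(** * The resonator *)

Lemma cos_period_Z (x : R) (k : Z) : cos (x + 2 * PI * IZR k) = cos x.
Proof.
destruct (Z_le_gt_dec 0 k) as [H|H].
- rewrite <- (Z2Nat.id k), <- INR_IZR_INZ by trivial.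
  rewrite <- (cos_period x (Z.to_nat k)); f_equal; ring.
- rewrite <- (cos_period (x + 2 * PI * IZR k) (Z.to_nat (- k))); f_equal.
  rewrite INR_IZR_INZ, Z2Nat.id, opp_IZR by lia; ring.
Qed.

Lemma geom_cis (b : R) (n : nat) :
  ((cis b - 1) * csum (List.seq 0 n) (fun j => cis (INR j * b)))%C
  = (cis (INR n * b) - 1)%C.
Proof.
induction n as [|n IH].
- unfold csum; simpl; rewrite Rmult_0_l, cis_0; ring.
- rewrite seq_S, csum_app, Cmult_plus_distr_l, IH, S_INR.
  replace ((INR n + 1) * b) with (b + INR n * b) by ring.
  rewrite cis_plus; unfold csum; simpl; ring.
Qed.

Lemma Cmod_cis_minus_1 (b : R) : Cmod (cis b - 1)%C = 2 * Rabs (sin (b / 2)).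
Proof.
apply Rsqr_inj.
- apply Cmod_ge_0.
- generalize (Rabs_pos (sin (b / 2))); lra.
- rewrite !Rsqr_pow2, Cmod_sqr, Rpow_mult_distr, pow2_abs.
  unfold cis, Re, Im, Cminus, Cplus, Copp, RtoC; simpl.
  replace b with (b / 2 + b / 2) at 1 2 3 4 by field.
  rewrite cos_plus, sin_plus.
  generalize (sin2_cos2 (b / 2)); unfold Rsqr.
  set (c := cos (b / 2)); set (s := sin (b / 2)); intros K.
  replace (c * c) with (1 - s * s) by lra.
  replace ((s * c + c * s + - 0) * ((s * c + c * s + - 0) * 1))
    with (4 * (s * s) * (c * c)) by ring.
  replace (c * c) with (1 - s * s) by lra; ring.
Qed.

Lemma csum_cis_eq_0 (b c : R) (n : nat) :
  cis b <> 1%C -> cis (INR n * b) = 1%C ->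
  csum (List.seq 0 n) (fun j => cis (c + INR j * b)) = 0%C.
Proof.
intros H1 H2.
rewrite (csum_ext _ _ (fun j => cis c * cis (INR j * b))%C)
  by (intros; apply cis_plus).
rewrite csum_scal.
assert (G := geom_cis b n); rewrite H2 in G.
replace (RtoC 1 - RtoC 1)%C with (RtoC 0) in G by ring.
destruct (Ceq_dec (csum (List.seq 0 n) (fun j => cis (INR j * b))) 0) as [->|K];
  [ring|].
exfalso; revert G; apply Cmult_neq_0; trivial.
intros E; apply H1; rewrite <- (Cplus_0_r 1), <- E; ring.
Qed.

Lemma csum_cis_bound (b : R) (n : nat) : sin (b / 2) <> 0 ->
  Cmod (csum (List.seq 0 n) (fun j => cis (INR j * b))) <= / Rabs (sin (b / 2)).
Proof.
intros H.
assert (P : 0 < Rabs (sin (b / 2))) by now apply Rabs_pos_lt.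
assert (G := f_equal Cmod (geom_cis b n)).
rewrite Cmod_mult, Cmod_cis_minus_1 in G.
assert (K : Cmod (cis (INR n * b) - 1)%C <= 2).
{ unfold Cminus; eapply Rle_trans; [apply Cmod_triangle|].
  rewrite Cmod_opp, Cmod_cis, Cmod_1; lra. }
apply Rmult_le_reg_l with (2 * Rabs (sin (b / 2))); [lra|].
rewrite G; replace (2 * Rabs (sin (b / 2)) * / Rabs (sin (b / 2))) with 2
  by (field; lra); exact K.
Qed.

Lemma fejer_sum (J : nat) (a : R) :
  lsum (List.seq 0 J) (fun j1 => lsum (List.seq 0 J) (fun j2 =>
    cos ((INR j1 - INR j2) * a)))
  = (lsum (List.seq 0 J) (fun j => cos (INR j * a))) ^ 2
    + (lsum (List.seq 0 J) (fun j => sin (INR j * a))) ^ 2.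
Proof.
simpl; rewrite !Rmult_1_r, !lsum_mult, <- lsum_plus.
apply lsum_ext; intros p _; rewrite <- lsum_plus; apply lsum_ext; intros q _.
rewrite Rmult_minus_distr_r, cos_minus; ring.
Qed.

Lemma fejer_ge_0 (J : nat) (a : R) :
  0 <= lsum (List.seq 0 J) (fun j1 => lsum (List.seq 0 J) (fun j2 =>
    cos ((INR j1 - INR j2) * a))).
Proof. rewrite fejer_sum; apply Rplus_le_le_0_compat; apply pow2_ge_0. Qed.

Lemma cos_ge_half x : Rabs x <= PI / 4 -> 1 / 2 <= cos x.
Proof.
intros H; rewrite <- cos_PI3.
assert (K := PI_RGT_0).
rewrite <- (Rabs_pos_eq (PI / 3)) by lra.
replace (cos x) with (cos (Rabs x))
  by (unfold Rabs; destruct Rcase_abs; [apply cos_neg|reflexivity]).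
rewrite (Rabs_pos_eq (PI / 3)) by lra.
apply cos_decr_1; try lra; generalize (Rabs_pos x); lra.
Qed.

(** All angles [j d] with [j < J] stay within [PI / 4] of 0 modulo the period, so the cosine sum
    alone is at least [J / 2]. *)
Lemma fejer_large (J : nat) (d : R) (k : Z) : INR J * Rabs d <= PI / 4 ->
  INR J ^ 2 / 4 <= lsum (List.seq 0 J) (fun j1 => lsum (List.seq 0 J) (fun j2 =>
    cos ((INR j1 - INR j2) * (d + 2 * PI * IZR k)))).
Proof.
intros H; rewrite fejer_sum.
assert (K : INR J * (1 / 2) <= lsum (List.seq 0 J)
  (fun j => cos (INR j * (d + 2 * PI * IZR k)))).
{ rewrite <- (length_seq J 0) at 1; rewrite <- lsum_const; apply lsum_le.
  intros j Hj; apply in_seq in Hj.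
  replace (INR j * (d + 2 * PI * IZR k)) with
    (INR j * d + 2 * PI * IZR (Z.of_nat j * k))
    by (rewrite mult_IZR, <- INR_IZR_INZ; ring).
  rewrite cos_period_Z; apply cos_ge_half.
  rewrite Rabs_mult, Rabs_pos_eq by apply pos_INR.
  eapply Rle_trans; [|exact H]; apply Rmult_le_compat_r; [apply Rabs_pos|].
  apply le_INR; lia. }
generalize (pow2_ge_0 (lsum (List.seq 0 J)
  (fun j => sin (INR j * (d + 2 * PI * IZR k))))) (pos_INR J); nra.
Qed.

Section Resonator.

Variables (M : list nat) (z : nat -> nat) (J1 : nat).
Hypothesis M_NoDup : NoDup M.
Hypothesis J1_pos : (0 < J1)%nat.

(** A rounding error below one unit moves a frequency by less than [2 PI / J]; the factor 8 bounds
    the resulting drift over [J1] samples by [PI / 4], as [fejer_large] requires. *)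
Let J := (8 * J1)%nat.
Let same m n := Nat.eqb (z m mod J) (z n mod J).
Let cls m := lsum M (fun n => iv (same m n)).
(** The [c] members of a residue class share one frequency, whose total coefficient is [c / sqrt c];
    its square is [c], and the class sizes add up to [N]. *)
Let r m := / sqrt (cls m).

Definition resonator (j : R) : C :=
  csum M (fun m => RtoC (r m) * cis (2 * PI * INR (z m) / INR J * j))%C.

Lemma J_pos : 0 < INR J.
Proof. apply lt_0_INR; unfold J; lia. Qed.

Lemma same_refl m : same m m = true.
Proof. apply Nat.eqb_refl. Qed.

Lemma same_cls m n : same m n = true -> cls m = cls n.
Proof.
unfold cls, same; rewrite Nat.eqb_eq; intros E; apply lsum_ext; intros; now rewrite E.
Qed.

Lemma cls_ge_1 m : In m M -> 1 <= cls m.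
Proof. intros H; apply (lsum_exists M (same m) m H (same_refl m)). Qed.

Lemma r_sqr m : In m M -> r m * r m = / cls m.
Proof.
intros H; apply cls_ge_1 in H; unfold r; rewrite <- Rinv_mult, sqrt_sqrt; lra.
Qed.

Lemma r_ge_0 m : In m M -> 0 <= r m.
Proof.
intros H; apply cls_ge_1 in H; left; apply Rinv_0_lt_compat, sqrt_lt_R0; lra.
Qed.

Lemma r_le_1 m : In m M -> r m <= 1.
Proof.
intros H; apply cls_ge_1 in H; rewrite <- Rinv_1; apply Rinv_le_contravar; [lra|].
rewrite <- sqrt_1; now apply sqrt_le_1_alt.
Qed.

Lemma resonator_le j : Cmod (resonator j) <= INR (length M).
Proof.
eapply Rle_trans; [apply Cmod_csum|].
rewrite <- (Rmult_1_r (INR (length M))), <- (lsum_const M); apply lsum_le; intros m Hm.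
rewrite Cmod_mult, Cmod_R, Cmod_cis, Rmult_1_r, Rabs_pos_eq.
- now apply r_le_1.
- now apply r_ge_0.
Qed.

Lemma cls_inv_sum m : In m M -> lsum M (fun n => iv (same m n) * / cls n) = 1.
Proof.
intros H; rewrite (lsum_ext _ _ (fun n => iv (same m n) * / cls m)).
- rewrite lsum_scal_r; fold (cls m); apply cls_ge_1 in H; field; lra.
- intros n _; destruct (same m n) eqn:E; [now rewrite (same_cls m n E)|simpl; ring].
Qed.

(** Orthogonality of the characters of Z/J at the frequency [z n - z m]. *)
Lemma period_sum m n (j1 : nat) :
  lsum (List.seq 0 J) (fun j =>
    cos (2 * PI * INR (z m) / INR J * (INR j1 - INR j)
         - 2 * PI * INR (z n) / INR J * (INR j1 - INR j)))
  = iv (same m n) * INR J.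
Proof.
assert (HJ := J_pos); assert (HP := PI_RGT_0).
set (b := 2 * PI * (INR (z n) - INR (z m)) / INR J).
rewrite (lsum_ext _ _ (fun j => cos (- (INR j1 * b) + INR j * b)))
  by (intros; f_equal; unfold b; field; lra).
unfold same; destruct (Nat.eqb_spec (z m mod J) (z n mod J)) as [E|E].
- assert (X : exists k : Z, b = 2 * PI * IZR k).
  { exists (Z.of_nat (z n / J) - Z.of_nat (z m / J))%Z.
    unfold b; rewrite minus_IZR, <- !INR_IZR_INZ.
    rewrite (Nat.div_mod_eq (z n) J) at 1; rewrite (Nat.div_mod_eq (z m) J) at 1.
    rewrite E, !plus_INR, !mult_INR; field; lra. }
  destruct X as [k ->].
  rewrite (lsum_ext _ _ (fun j => 1)).
  + rewrite lsum_const, length_seq; simpl; ring.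
  + intros j _; rewrite <- cos_0, <- (cos_period_Z 0 ((Z.of_nat j - Z.of_nat j1) * k)).
    f_equal; rewrite mult_IZR, minus_IZR, <- !INR_IZR_INZ; ring.
- simpl; rewrite Rmult_0_l.
  rewrite (lsum_ext _ _ (fun j => Re (cis (- (INR j1 * b) + INR j * b)))) by reflexivity.
  rewrite <- Re_csum, csum_cis_eq_0; [reflexivity| |].
  + intros K.
    assert (C0 := Cmod_cis_minus_1 b); rewrite K in C0.
    replace (1 - 1)%C with (RtoC 0) in C0 by ring; rewrite Cmod_0 in C0.
    assert (S0 : sin (b / 2) = 0).
    { destruct (Req_dec (sin (b / 2)) 0) as [|N]; trivial.
      apply Rabs_pos_lt in N; lra. }
    destruct (sin_eq_0_0 _ S0) as [k Hk].
    assert (E1 : INR (z n) - INR (z m) = IZR (k * Z.of_nat J)).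
    { rewrite mult_IZR, <- INR_IZR_INZ.
      apply (Rmult_eq_reg_l (PI / INR J)).
      - replace (PI / INR J * (INR (z n) - INR (z m))) with (b / 2)
          by (unfold b; field; lra).
        rewrite Hk; field; lra.
      - apply Rgt_not_eq, Rdiv_lt_0_compat; lra. }
    rewrite !INR_IZR_INZ, <- minus_IZR in E1; apply eq_IZR in E1.
    apply E; apply Nat2Z.inj; rewrite !Nat2Z.inj_mod.
    replace (Z.of_nat (z n)) with (Z.of_nat (z m) + k * Z.of_nat J)%Z by lia.
    now rewrite Z_mod_plus_full.
  + replace (INR J * b) with (0 + 2 * PI * IZR (Z.of_nat (z n) - Z.of_nat (z m))).
    * unfold cis; rewrite cos_period_Z, cos_0.
      (* The sine is turned into a cosine by [sin_shift], so that the periodicity over integers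
         proved for the cosine serves for both coordinates. *)
      replace (0 + 2 * PI * IZR (Z.of_nat (z n) - Z.of_nat (z m)))
        with (PI / 2 - (PI / 2 + 2 * PI * IZR (- (Z.of_nat (z n) - Z.of_nat (z m)))))
        by (rewrite opp_IZR; ring).
      rewrite sin_shift, cos_period_Z, cos_PI2; reflexivity.
    * rewrite minus_IZR, <- !INR_IZR_INZ; unfold b; field; lra.
Qed.

(** The inner sum is extended by positivity from [J1] points to a full period of [J = 8 J1], where
    orthogonality is exact; this is the factor 8. *)
Lemma resonator_L2 :
  lsum (List.seq 0 J1) (fun j1 => lsum (List.seq 0 J1) (fun j2 =>
    Cmod (resonator (INR j1 - INR j2)) ^ 2)) <= 8 * INR J1 ^ 2 * INR (length M).
Proof.
replace (8 * INR J1 ^ 2 * INR (length M)) with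
  (INR (length (List.seq 0 J1)) * (INR J * INR (length M)))
  by (rewrite length_seq; unfold J; rewrite mult_INR; simpl; ring).
rewrite <- (lsum_const (List.seq 0 J1)); apply lsum_le; intros j1 _.
apply Rle_trans with (lsum (List.seq 0 J) (fun j2 =>
    Cmod (resonator (INR j1 - INR j2)) ^ 2)).
- apply lsum_incl; [intros; apply pow2_ge_0|apply seq_NoDup|].
  intros j; rewrite !in_seq; unfold J; lia.
- unfold resonator.
  rewrite (lsum_ext _ _ (fun j2 => lsum M (fun p => lsum M (fun q => r p * r q *
    cos (2 * PI * INR (z p) / INR J * (INR j1 - INR j2)
         - 2 * PI * INR (z q) / INR J * (INR j1 - INR j2))))))
    by (intros; apply Cmod_trig_sqr).
  rewrite lsum_exch, (lsum_ext M _ (fun p => INR J *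
    lsum M (fun q => iv (same p q) * / cls q))).
  + rewrite lsum_scal; apply Rmult_le_compat_l; [left; apply J_pos|].
    rewrite <- (Rmult_1_r (INR (length M))), <- (lsum_const M); apply lsum_le; intros p Hp.
    rewrite cls_inv_sum; trivial; lra.
  + intros p Hp; rewrite lsum_exch, <- lsum_scal; apply lsum_ext; intros q Hq.
    rewrite lsum_scal, period_sum.
    destruct (same p q) eqn:E; [|simpl; ring].
    rewrite <- r_sqr by trivial.
    unfold r; rewrite (same_cls p q E); simpl; ring.
Qed.

Variables (X : nat) (b : nat -> R) (h : R).
Hypothesis b_ge_0 : forall n, 0 <= b n.
Hypothesis M_pos : forall m, In m M -> (0 < m)%nat.
Hypothesis z_spec : forall m, In m M ->
  INR (z m) <= INR J * h * ln (INR m) / (2 * PI) < INR (z m) + 1.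

Definition dirpoly (t : R) : C :=
  csum (rg X) (fun n => RtoC (b n) * cis (- t * ln (INR n)))%C.

(** Frequency, per unit of [j1 - j2], of the term indexed by [(k, m)] in the product of [dirpoly]
    and [resonator]. *)
Let al (p : nat * nat) := - h * ln (INR (fst p)) + 2 * PI * INR (z (snd p)) / INR J.
Let F a := lsum (List.seq 0 J1) (fun j1 => lsum (List.seq 0 J1) (fun j2 =>
    cos ((INR j1 - INR j2) * a))).

(** Since [l m0 = k n0], the logarithms cancel and only the difference of two rounding errors in [0,
    1) remains. Passing from [m0], [n0] to other members of their classes changes the frequency by a
    multiple of [2 PI]. *)
Lemma F_near k l m0 n0 m n : (0 < k)%nat -> (0 < l)%nat -> In m0 M -> In n0 M ->
  (l * m0 = k * n0)%nat -> same m m0 = true -> same n n0 = true ->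
  INR J1 ^ 2 / 4 <= F (al (k, m) - al (l, n)).
Proof.
intros Hk Hl Hm0 Hn0 E Em En.
assert (HJ := J_pos); assert (HP := PI_RGT_0).
unfold same in Em, En; rewrite Nat.eqb_eq in Em, En.
set (em := INR J * h * ln (INR m0) / (2 * PI) - INR (z m0)).
set (en := INR J * h * ln (INR n0) / (2 * PI) - INR (z n0)).
set (d := 2 * PI / INR J * (en - em)).
set (i := (Z.of_nat (z m / J) - Z.of_nat (z m0 / J)
           - (Z.of_nat (z n / J) - Z.of_nat (z n0 / J)))%Z).
replace (al (k, m) - al (l, n)) with (d + 2 * PI * IZR i).
- apply fejer_large; unfold d.
  rewrite Rabs_mult, Rabs_pos_eq
    by (apply Rdiv_le_0_compat; lra).
  assert (Rabs (en - em) <= 1).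
  { generalize (z_spec m0 Hm0) (z_spec n0 Hn0).
    unfold em, en; intros; apply Rabs_le; lra. }
  unfold J; rewrite mult_INR; simpl (INR 8).
  assert (0 < INR J1) by now apply lt_0_INR.
  replace (INR J1 * (2 * PI / ((1 + 1 + 1 + 1 + 1 + 1 + 1 + 1) * INR J1) * Rabs (en - em)))
    with (PI / 4 * Rabs (en - em)) by (field; lra).
  rewrite <- (Rmult_1_r (PI / 4)) at 2; apply Rmult_le_compat_l; lra.
- unfold al; simpl fst; simpl snd.
  assert (L : ln (INR l) + ln (INR m0) = ln (INR k) + ln (INR n0)).
  { assert (A1 := M_pos m0 Hm0); assert (A2 := M_pos n0 Hn0).
    rewrite <- !ln_mult by (apply lt_0_INR; trivial).
    now rewrite <- !mult_INR, E. }
  assert (D : forall a c, (z a mod J = z c mod J)%nat ->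
    INR (z a) - INR (z c) = INR J * (INR (z a / J) - INR (z c / J))).
  { intros a c Eac.
    rewrite (Nat.div_mod_eq (z a) J) at 1; rewrite (Nat.div_mod_eq (z c) J) at 1.
    rewrite Eac, !plus_INR, !mult_INR; ring. }
  apply D in Em, En.
  unfold d, i, em, en; rewrite !minus_IZR, <- !INR_IZR_INZ.
  replace (ln (INR k)) with (ln (INR l) + ln (INR m0) - ln (INR n0)) by lra.
  replace (INR (z m)) with
    (INR (z m0) + INR J * (INR (z m / J) - INR (z m0 / J))) by lra.
  replace (INR (z n)) with
    (INR (z n0) + INR J * (INR (z n / J) - INR (z n0 / J))) by lra.
  field; lra.
Qed.

(* Pairs [(m0, n0)] with [l m0 = k n0] form a partial matching, so a pair of
   residue classes of sizes [c] and [c'] contains at most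
   [min c c' <= sqrt (c c')] of them. *)
Lemma matching_bound k l : (0 < k)%nat -> (0 < l)%nat ->
  INR J1 ^ 2 / 4 * lsum M (fun m => lsum M (fun n => iv (Nat.eqb (l * m) (k * n))))
  <= lsum M (fun m => lsum M (fun n => r m * r n * F (al (k, m) - al (l, n)))).
Proof.
intros Hk Hl.
set (P := fun m n => iv (Nat.eqb (l * m) (k * n))).
(* [U m n] counts the matched pairs in the classes of [m] and [n]. Each matched pair is spread over
   all pairs of class mates with weights [/ cls m * / cls n], of total 1 by [cls_inv_sum]. *)
set (U := fun m n => lsum M (fun m0 => lsum M (fun n0 =>
  P m0 n0 * (iv (same m0 m) * iv (same n0 n))))).
assert (HP : forall m n, 0 <= P m n) by (intros; apply iv_ge_0).
assert (HU : forall m n, 0 <= U m n).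
{ intros; apply lsum_ge_0; intros; apply lsum_ge_0; intros.
  repeat apply Rmult_le_pos; trivial; apply iv_ge_0. }
assert (same_sym : forall m n, same m n = same n m) by (intros; apply Nat.eqb_sym).
apply Rle_trans with (INR J1 ^ 2 / 4 * lsum M (fun m => lsum M (fun n =>
   U m n * (/ cls m * / cls n)))).
- apply Rmult_le_compat_l; [generalize (pow2_ge_0 (INR J1)); lra|].
  right; unfold U.
  rewrite (lsum_ext M (fun m => lsum M (fun n => _ * _)) (fun m => lsum M (fun n =>
    lsum M (fun m0 => lsum M (fun n0 => P m0 n0 * ((iv (same m0 m) * / cls m) *
      (iv (same n0 n) * / cls n))))))).
  + rewrite lsum_exch4; apply lsum_ext; intros m0 Hm0; apply lsum_ext; intros n0 Hn0.
    rewrite (lsum_ext _ _ (fun m => P m0 n0 * (lsum M (fun n => (iv (same m0 m) * / cls m) *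
      (iv (same n0 n) * / cls n))))) by (intros; apply lsum_scal).
    rewrite lsum_scal, <- lsum_mult, !cls_inv_sum by trivial; fold (P m0 n0); ring.
  + intros m _; apply lsum_ext; intros n _.
    rewrite <- lsum_scal_r; apply lsum_ext; intros m0 _.
    rewrite <- lsum_scal_r; apply lsum_ext; intros n0 _; ring.
- rewrite <- lsum_scal; apply lsum_le; intros m Hm.
  rewrite <- lsum_scal; apply lsum_le; intros n Hn.
  assert (Cm := cls_ge_1 m Hm); assert (Cn := cls_ge_1 n Hn).
  assert (Rm := r_ge_0 m Hm); assert (Rn := r_ge_0 n Hn).
  destruct (classic (exists m0 n0, In m0 M /\ In n0 M /\ (l * m0 = k * n0)%nat
     /\ same m m0 = true /\ same n n0 = true)) as [[m0 [n0 [H1 [H2 [H3 [H4 H5]]]]]]|N].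
  + assert (HF := F_near k l m0 n0 m n Hk Hl H1 H2 H3 H4 H5).
    apply Rle_trans with (INR J1 ^ 2 / 4 * (r m * r n)).
    2: { rewrite Rmult_comm; apply Rmult_le_compat_l; trivial; now apply Rmult_le_pos. }
    apply Rmult_le_compat_l; [generalize (pow2_ge_0 (INR J1)); lra|].
    rewrite <- !r_sqr by trivial.
    replace (U m n * (r m * r m * (r n * r n))) with
      ((U m n * (r m * r n)) * (r m * r n)) by ring.
    rewrite <- (Rmult_1_l (r m * r n)) at 3.
    apply Rmult_le_compat_r; [now apply Rmult_le_pos|].
    assert (U1 : U m n <= cls m).
    { unfold U, cls; apply lsum_le; intros p Hp.
      rewrite <- (Rmult_1_r (iv (same m p))).
      rewrite (lsum_ext _ _ (fun n0 => iv (same m p) * (P p n0 * iv (same n0 n)))).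
      2: { intros; rewrite (same_sym p m); ring. }
      rewrite lsum_scal; apply Rmult_le_compat_l; [apply iv_ge_0|].
      eapply Rle_trans; [apply (lsum_le _ _ (fun q => P p q))|].
      - intros q _; rewrite <- (Rmult_1_r (P p q)) at 2.
        apply Rmult_le_compat_l; trivial; apply iv_le_1.
      - apply (lsum_unique M (fun q => Nat.eqb (l * p) (k * q))); trivial.
        intros u v; rewrite !Nat.eqb_eq; nia. }
    assert (U2 : U m n <= cls n).
    { unfold U, cls; rewrite lsum_exch; apply lsum_le; intros q Hq.
      rewrite <- (Rmult_1_r (iv (same n q))).
      rewrite (lsum_ext _ _ (fun p => iv (same n q) * (P p q * iv (same p m)))).
      2: { intros; rewrite (same_sym q n); ring. }
      rewrite lsum_scal; apply Rmult_le_compat_l; [apply iv_ge_0|].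
      eapply Rle_trans; [apply (lsum_le _ _ (fun p => P p q))|].
      - intros p _; rewrite <- (Rmult_1_r (P p q)) at 2.
        apply Rmult_le_compat_l; trivial; apply iv_le_1.
      - apply (lsum_unique M (fun p => Nat.eqb (l * p) (k * q))); trivial.
        intros u v; rewrite !Nat.eqb_eq; nia. }
    apply Rsqr_incr_0_var; [|lra].
    unfold Rsqr; replace (U m n * (r m * r n) * (U m n * (r m * r n))) with
      ((U m n * (r m * r m)) * (U m n * (r n * r n))) by ring.
    rewrite !r_sqr by trivial.
    apply Rmult_le_compat; try (apply Rmult_le_pos; trivial; left;
      apply Rinv_0_lt_compat; lra).
    * apply Rmult_le_reg_r with (cls m); [lra|]; field_simplify; lra.
    * apply Rmult_le_reg_r with (cls n); [lra|]; field_simplify; lra.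
  + replace (U m n) with 0.
    * rewrite Rmult_0_l, Rmult_0_r; repeat apply Rmult_le_pos; trivial; apply fejer_ge_0.
    * symmetry; apply lsum_0; intros m0 Hm0; apply lsum_0; intros n0 Hn0; unfold P.
      destruct (Nat.eqb_spec (l * m0) (k * n0)); [|simpl; ring].
      destruct (same m0 m) eqn:E1; [|simpl; ring].
      destruct (same n0 n) eqn:E2; [|simpl; ring].
      exfalso; apply N; exists m0, n0; repeat split; trivial; now rewrite same_sym.
Qed.

(** Summing over [j1] and [j2] turns every cosine of the expanded square into a value of the
    nonnegative Fejer sum [F], so off-diagonal terms can only help. For fixed [k] and [l] the rest
    is [matching_bound]. *)
Lemma moment_lower :
  INR J1 ^ 2 / 4 * lsum (rg X) (fun k => lsum (rg X) (fun l => b k * b l *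
    lsum M (fun m => lsum M (fun n => iv (Nat.eqb (l * m) (k * n))))))
  <= lsum (List.seq 0 J1) (fun j1 => lsum (List.seq 0 J1) (fun j2 =>
       Cmod (dirpoly (h * (INR j1 - INR j2))) ^ 2
       * Cmod (resonator (INR j1 - INR j2)) ^ 2)).
Proof.
set (L := list_prod (rg X) M).
set (c := fun p : nat * nat => b (fst p) * r (snd p)).
rewrite (lsum_ext (List.seq 0 J1) _ (fun j1 => lsum (List.seq 0 J1) (fun j2 =>
  lsum L (fun p => lsum L (fun q => c p * c q *
    cos ((INR j1 - INR j2) * (al p - al q))))))).
2: { intros j1 _; apply lsum_ext; intros j2 _.
  rewrite <- Rpow_mult_distr, <- Cmod_mult.
  unfold dirpoly, resonator; rewrite csum_mult; fold L.
  rewrite (csum_ext L _ (fun p => RtoC (c p) * cis ((INR j1 - INR j2) * al p))%C).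
  - rewrite Cmod_trig_sqr; apply lsum_ext; intros p _; apply lsum_ext; intros q _.
    now rewrite Rmult_minus_distr_l.
  - intros [k m] _; unfold c, al; simpl fst; simpl snd.
    rewrite Rmult_plus_distr_l, cis_plus, RtoC_mult.
    replace (- (h * (INR j1 - INR j2)) * ln (INR k)) with
      ((INR j1 - INR j2) * (- h * ln (INR k))) by ring.
    rewrite (Rmult_comm (2 * PI * INR (z m) / INR J)); ring. }
rewrite lsum_exch4.
rewrite (lsum_ext L _ (fun p => lsum L (fun q => c p * c q * F (al p - al q)))).
2: { intros p _; apply lsum_ext; intros q _; unfold F.
  rewrite <- lsum_scal; apply lsum_ext; intros; apply lsum_scal. }
unfold L at 1; rewrite lsum_prod, <- lsum_scal; apply lsum_le; intros k Hk.
rewrite (lsum_ext M _ (fun m => lsum (rg X) (fun l => lsum M (fun n =>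
   c (k, m) * c (l, n) * F (al (k, m) - al (l, n)))))) by (intros; apply lsum_prod).
rewrite lsum_exch, <- lsum_scal; apply lsum_le; intros l Hl.
apply in_rg in Hk, Hl.
assert (E : lsum M (fun m => lsum M (fun n =>
     c (k, m) * c (l, n) * F (al (k, m) - al (l, n))))
  = b k * b l * lsum M (fun m => lsum M (fun n =>
     r m * r n * F (al (k, m) - al (l, n))))).
{ rewrite <- lsum_scal; apply lsum_ext; intros m _; rewrite <- lsum_scal.
  apply lsum_ext; intros n _; unfold c; simpl fst; simpl snd; ring. }
rewrite E.
assert (K := matching_bound k l ltac:(lia) ltac:(lia)).
apply (Rmult_le_compat_l (b k * b l)) in K; [|now apply Rmult_le_pos].
lra.
Qed.

End Resonator.

(** * Moments *)

Lemma sin_ge_half x : 0 <= x <= 1 -> x / 2 <= sin x.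
Proof.
intros [H0 H1].
destruct (Req_dec x 0) as [->|N]; [rewrite sin_0; lra|].
destruct (MVT_cor2 sin cos 0 x) as [c [E Hc]]; [lra| |].
{ intros; apply derivable_pt_lim_sin. }
rewrite sin_0, !Rminus_0_r in E; rewrite E.
assert (K : 1 / 2 <= cos c).
{ assert (P := PI2_3_2); rewrite <- cos_PI3; apply cos_decr_1; lra. }
nra.
Qed.

Lemma Rabs_sin_ge x : Rabs x <= 1 -> Rabs x / 2 <= Rabs (sin x).
Proof.
intros H; unfold Rabs at 1; destruct (Rcase_abs x) as [N|N].
- rewrite <- Rabs_Ropp, <- sin_neg.
  eapply Rle_trans; [apply sin_ge_half|apply Rle_abs].
  rewrite Rabs_left in H by trivial; lra.
- eapply Rle_trans; [apply sin_ge_half|apply Rle_abs].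
  rewrite Rabs_pos_eq in H by lra; lra.
Qed.

Lemma ln_diff_ge m n X : (0 < m)%nat -> (m < n <= X)%nat ->
  / INR X <= ln (INR n) - ln (INR m).
Proof.
intros Hm [Hmn HX].
assert (H1 : 1 <= INR m) by now apply INR_ge_1.
assert (H2 : INR m + 1 <= INR n) by (rewrite <- S_INR; apply le_INR; lia).
assert (H3 : INR n <= INR X) by now apply le_INR.
assert (K : ln (INR m / INR n) <= INR m / INR n - 1).
{ rewrite <- (ln_exp (INR m / INR n - 1)); apply ln_le.
  - apply Rdiv_lt_0_compat; lra.
  - generalize (exp_ineq1_le (INR m / INR n - 1)); lra. }
rewrite ln_div in K by lra.
assert (L : / INR X <= 1 - INR m / INR n).
{ apply Rle_trans with (/ INR n); [apply Rinv_le_contravar; lra|].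
  apply Rmult_le_reg_r with (INR n); [lra|].
  replace ((1 - INR m / INR n) * INR n) with (INR n - INR m) by (field; lra).
  rewrite Rinv_l; lra. }
lra.
Qed.

(** A given distance to [j1] is attained by at most two values of [j2]. *)
Lemma lsum_dist_le (J J' j1 : nat) (f : nat -> R) : (forall i, 0 <= f i) ->
  lsum (List.seq 0 J) (fun j2 =>
    iv (Nat.ltb ((j1 - j2) + (j2 - j1)) J') * f ((j1 - j2) + (j2 - j1))%nat)
  <= 2 * lsum (List.seq 0 J') f.
Proof.
intros Hf.
apply Rle_trans with (lsum (List.seq 0 J) (fun j2 => lsum (List.seq 0 J') (fun i =>
  (iv (Nat.eqb j1 (j2 + i)) + iv (Nat.eqb j2 (j1 + i))) * f i))).
- apply lsum_le; intros j2 _.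
  assert (X : forall i, 0 <= (iv (Nat.eqb j1 (j2 + i)) + iv (Nat.eqb j2 (j1 + i))) * f i).
  { intros; apply Rmult_le_pos; trivial; apply Rplus_le_le_0_compat; apply iv_ge_0. }
  destruct (Nat.ltb_spec ((j1 - j2) + (j2 - j1)) J') as [H|H];
    [|rewrite Rmult_0_l; apply lsum_ge_0; trivial].
  eapply Rle_trans; [|apply (lsum_term _ _ ((j1 - j2) + (j2 - j1))%nat)]; trivial.
  + apply Rmult_le_compat_r; trivial.
    destruct (le_lt_dec j2 j1) as [K|K].
    * replace (Nat.eqb j1 (j2 + _)) with true by (symmetry; apply Nat.eqb_eq; lia).
      generalize (iv_ge_0 (Nat.eqb j2 (j1 + (j1 - j2 + (j2 - j1))))); simpl iv; lra.
    * replace (Nat.eqb j2 (j1 + _)) with true by (symmetry; apply Nat.eqb_eq; lia).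
      generalize (iv_ge_0 (Nat.eqb j1 (j2 + (j1 - j2 + (j2 - j1))))); simpl iv; lra.
  + apply in_seq; lia.
- rewrite lsum_exch, <- lsum_scal; apply lsum_le; intros i _.
  rewrite lsum_scal_r; apply Rmult_le_compat_r; trivial.
  rewrite lsum_plus.
  assert (lsum (List.seq 0 J) (fun j2 => iv (Nat.eqb j1 (j2 + i))) <= 1).
  { apply (lsum_unique _ (fun j2 => Nat.eqb j1 (j2 + i))); [apply seq_NoDup|].
    intros u v; rewrite !Nat.eqb_eq; lia. }
  assert (lsum (List.seq 0 J) (fun j2 => iv (Nat.eqb j2 (j1 + i))) <= 1).
  { apply (lsum_unique _ (fun j2 => Nat.eqb j2 (j1 + i))); [apply seq_NoDup|].
    intros u v; rewrite !Nat.eqb_eq; lia. }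
  lra.
Qed.

(** * Mean square of a short Dirichlet polynomial over equally spaced points *)

Section MeanSquare.

Variables (X : nat) (b : nat -> R) (h : R).
Hypothesis b_ge_0 : forall n, 0 <= b n.
Hypothesis h_pos : 0 < h.
(** No aliasing: the sampled frequencies [h (ln q - ln p)] lie in [-1, 1], away from the nonzero
    multiples of [2 PI]. *)
Hypothesis h_ln : forall n, (1 <= n <= X)%nat -> h * ln (INR n) <= 1.

Lemma dirpoly_even t : Cmod (dirpoly X b (- t)) ^ 2 = Cmod (dirpoly X b t) ^ 2.
Proof.
unfold dirpoly; rewrite !Cmod_trig_sqr.
apply lsum_ext; intros p _; apply lsum_ext; intros q _; f_equal.
rewrite <- cos_neg; f_equal; ring.
Qed.

(** Off the diagonal the geometric sum is at most [1 / |sin (be / 2)|], and logarithms of integers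
    up to [X] are [1 / X] apart. The loss of [X] is affordable because [X] is a small power of T. *)
Lemma mean_square (J : nat) :
  lsum (List.seq 0 J) (fun j => Cmod (dirpoly X b (h * INR j)) ^ 2)
  <= INR J * lsum (rg X) (fun n => b n ^ 2) + 4 * INR X / h * (lsum (rg X) b) ^ 2.
Proof.
unfold dirpoly.
rewrite (lsum_ext _ _ (fun j => lsum (rg X) (fun p => lsum (rg X) (fun q =>
  b p * b q * Re (cis (INR j * (h * (ln (INR q) - ln (INR p)))))))))
  by (intros; rewrite Cmod_trig_sqr; apply lsum_ext; intros; apply lsum_ext; intros;
      unfold cis, Re; simpl; f_equal; f_equal; ring).
rewrite lsum_exch; simpl (lsum (rg X) b ^ 2); rewrite Rmult_1_r, lsum_mult.
rewrite <- !lsum_scal, <- lsum_plus.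
apply lsum_le; intros p Hp; rewrite lsum_exch, <- lsum_scal.
apply Rle_trans with (lsum (rg X) (fun q => b p * b q * (iv (Nat.eqb p q) * INR J)
  + 4 * INR X / h * (b p * b q))).
- apply lsum_le; intros q Hq; rewrite lsum_scal, <- Re_csum.
  rewrite (Rmult_comm (4 * INR X / h)), <- Rmult_plus_distr_l.
  apply Rmult_le_compat_l; [now apply Rmult_le_pos|].
  apply in_rg in Hp, Hq.
  assert (HX : 1 <= INR X) by (apply INR_ge_1; lia).
  assert (K0 : 0 <= 4 * INR X / h) by (apply Rdiv_le_0_compat; lra).
  eapply Rle_trans; [eapply Rle_trans; [apply Rle_abs|apply re_le_Cmod]|].
  destruct (Nat.eqb_spec p q) as [<-|N].
  + eapply Rle_trans; [apply Cmod_csum|].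
    rewrite (lsum_ext _ _ (fun _ => 1)) by (intros; apply Cmod_cis).
    rewrite lsum_const, length_seq; simpl iv; lra.
  + set (be := h * (ln (INR q) - ln (INR p))).
    assert (L : / INR X <= Rabs (ln (INR q) - ln (INR p))).
    { destruct (Nat.lt_total p q) as [H|[H|H]]; [|lia|].
      - eapply Rle_trans; [apply (ln_diff_ge p q X); lia|apply Rle_abs].
      - rewrite Rabs_minus_sym.
        eapply Rle_trans; [apply (ln_diff_ge q p X); lia|apply Rle_abs]. }
    assert (B1 : Rabs be <= 1).
    { unfold be; rewrite Rmult_minus_distr_l.
      assert (Z1 := h_ln p Hp); assert (Z2 := h_ln q Hq).
      assert (0 <= ln (INR p)) by (apply ln_ge_0, INR_ge_1; lia).
      assert (0 <= ln (INR q)) by (apply ln_ge_0, INR_ge_1; lia).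
      apply Rabs_le; nra. }
    assert (B2 : h / INR X <= Rabs be).
    { unfold be; rewrite Rabs_mult, (Rabs_pos_eq h) by lra.
      apply Rmult_le_compat_l; lra. }
    assert (B3 : 0 < h / INR X) by (apply Rdiv_lt_0_compat; lra).
    assert (B4 : h / INR X / 4 <= Rabs (sin (be / 2))).
    { assert (Z : Rabs (be / 2) = Rabs be / 2).
      { unfold Rdiv; rewrite Rabs_mult, (Rabs_pos_eq (/ 2)); lra. }
      generalize (Rabs_sin_ge (be / 2)); lra. }
    eapply Rle_trans; [apply csum_cis_bound|].
    * intros E; rewrite E, Rabs_R0 in B4; lra.
    * simpl iv; rewrite Rmult_0_l, Rplus_0_l.
      replace (4 * INR X / h) with (/ (h / INR X / 4)) by (field; lra).
      apply Rinv_le_contravar; lra.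
- rewrite lsum_plus; apply Rplus_le_compat_r.
  rewrite (lsum_ext _ _ (fun q => (INR J * b p ^ 2) * iv (Nat.eqb p q))).
  + rewrite lsum_scal; rewrite <- (Rmult_1_r (INR J * b p ^ 2)) at 2.
    apply Rmult_le_compat_l; [|apply iv_sum_le, rg_NoDup].
    apply Rmult_le_pos; [apply pos_INR|apply pow2_ge_0].
  + intros q _; destruct (Nat.eqb_spec p q) as [<-|]; simpl; ring.
Qed.

End MeanSquare.

(** Pairs with [|j1 - j2| >= J'] use the bound [V] and [resonator_L2]. The nearer pairs use the
    trivial bound of the resonator and the mean square of the Dirichlet polynomial. *)
Lemma moment_upper (M : list nat) z J1 J' X b h V :
  (0 < J1)%nat -> NoDup M -> (forall n, 0 <= b n) -> 0 < h -> 0 <= V ->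
  (forall n, (1 <= n <= X)%nat -> h * ln (INR n) <= 1) ->
  (forall j, (J' <= j < J1)%nat -> Cmod (dirpoly X b (h * INR j)) <= V) ->
  lsum (List.seq 0 J1) (fun j1 => lsum (List.seq 0 J1) (fun j2 =>
       Cmod (dirpoly X b (h * (INR j1 - INR j2))) ^ 2
       * Cmod (resonator M z J1 (INR j1 - INR j2)) ^ 2))
  <= V ^ 2 * (8 * INR J1 ^ 2 * INR (length M))
     + INR (length M) ^ 2 * (INR J1 * (2 *
         (INR J' * lsum (rg X) (fun n => b n ^ 2)
          + 4 * INR X / h * (lsum (rg X) b) ^ 2))).
Proof.
intros HJ ND Hb Hh HV Hln HB.
set (f := fun i => Cmod (dirpoly X b (h * INR i)) ^ 2).
assert (Hf : forall i, 0 <= f i) by (intros; apply pow2_ge_0).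
set (D := fun j1 j2 => ((j1 - j2) + (j2 - j1))%nat).
assert (E : forall j1 j2, Cmod (dirpoly X b (h * (INR j1 - INR j2))) ^ 2 = f (D j1 j2)).
{ intros j1 j2; unfold f, D; destruct (le_lt_dec j2 j1) as [K|K].
  - replace (j1 - j2 + (j2 - j1))%nat with (j1 - j2)%nat by lia.
    now rewrite minus_INR.
  - replace (j1 - j2 + (j2 - j1))%nat with (j2 - j1)%nat by lia.
    rewrite minus_INR by lia; rewrite <- dirpoly_even by trivial.
    do 3 f_equal; ring. }
apply Rle_trans with (V ^ 2 * lsum (List.seq 0 J1) (fun j1 =>
    lsum (List.seq 0 J1) (fun j2 => Cmod (resonator M z J1 (INR j1 - INR j2)) ^ 2))
  + INR (length M) ^ 2 * lsum (List.seq 0 J1) (fun j1 =>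
    lsum (List.seq 0 J1) (fun j2 => iv (Nat.ltb (D j1 j2) J') * f (D j1 j2)))).
- rewrite <- !lsum_scal, <- lsum_plus; apply lsum_le; intros j1 H1.
  rewrite <- !lsum_scal, <- lsum_plus; apply lsum_le; intros j2 H2.
  apply in_seq in H1, H2; rewrite E.
  set (r2 := Cmod (resonator M z J1 (INR j1 - INR j2)) ^ 2).
  assert (R0 : 0 <= r2) by apply pow2_ge_0.
  assert (R1 : r2 <= INR (length M) ^ 2).
  { apply pow_incr; split; [apply Cmod_ge_0|now apply resonator_le]. }
  assert (V0 := pow2_ge_0 V); assert (F0 := Hf (D j1 j2)).
  destruct (Nat.ltb_spec (D j1 j2) J') as [K|K].
  + simpl iv; rewrite Rmult_1_l.
    assert (f (D j1 j2) * r2 <= f (D j1 j2) * INR (length M) ^ 2)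
      by now apply Rmult_le_compat_l.
    assert (0 <= V ^ 2 * r2) by now apply Rmult_le_pos.
    lra.
  + simpl iv; rewrite Rmult_0_l, Rmult_0_r, Rplus_0_r.
    apply Rmult_le_compat_r; trivial.
    apply pow_incr; split; [apply Cmod_ge_0|apply HB; unfold D in *; lia].
- apply Rplus_le_compat.
  + apply Rmult_le_compat_l; [apply pow2_ge_0|now apply resonator_L2].
  + apply Rmult_le_compat_l; [apply pow2_ge_0|].
    rewrite <- (length_seq J1 0) at 2; rewrite <- lsum_const.
    apply lsum_le; intros j1 _.
    eapply Rle_trans; [now apply lsum_dist_le|].
    apply Rmult_le_compat_l; [lra|].
    now apply mean_square.
Qed.

(** The solutions of [l m = k n] are [(k, l) = (g k0, g l0)] with the coprime cofactors [k0], [l0]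
    of [m], [n]. Keeping [g, k0, l0 <= G] stays within [G * G], and the sum over [g] factors out as
    [zs (2 * sigma) G]. *)
Lemma diagonal_lower (M : list nat) G X b sigma c :
  (forall m, In m M -> (0 < m)%nat) -> (G * G <= X)%nat -> 0 <= c ->
  (forall n, 0 <= b n) ->
  (forall n, (1 <= n <= G * G)%nat -> c * w sigma n <= b n) ->
  c ^ 2 * (zs (2 * sigma) G * gtrunc sigma G M)
  <= lsum (rg X) (fun k => lsum (rg X) (fun l => b k * b l *
       lsum M (fun m => lsum M (fun n => iv (Nat.eqb (l * m) (k * n)))))).
Proof.
intros HM HX Hc Hb Hbc.
rewrite (lsum_ext (rg X) _ (fun k => lsum (rg X) (fun l =>
   lsum M (fun m => lsum M (fun n => b k * b l * iv (Nat.eqb (l * m) (k * n))))))).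
2: { intros k _; apply lsum_ext; intros l _; rewrite <- lsum_scal.
  apply lsum_ext; intros m _; now rewrite lsum_scal. }
rewrite lsum_exch4; unfold gtrunc; rewrite <- lsum_scal, <- lsum_scal.
apply lsum_le; intros m Hm; rewrite <- lsum_scal, <- lsum_scal.
apply lsum_le; intros n Hn.
destruct (gcd_div m n (HM m Hm) (HM n Hn)) as [Hd [Em [En [H1 H2]]]].
set (d := Nat.gcd m n) in *; set (k0 := (m / d)%nat) in *; set (l0 := (n / d)%nat) in *.
assert (P : forall k l, 0 <= b k * b l * iv (Nat.eqb (l * m) (k * n))).
{ intros; repeat apply Rmult_le_pos; trivial; apply iv_ge_0. }
destruct (Nat.leb_spec k0 G) as [HkG|]; [|simpl; rewrite !Rmult_0_l, !Rmult_0_r;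
  apply lsum_ge_0; intros; now apply lsum_ge_0].
destruct (Nat.leb_spec l0 G) as [HlG|]; [|simpl; rewrite !Rmult_0_l, !Rmult_0_r;
  apply lsum_ge_0; intros; now apply lsum_ge_0].
simpl iv; rewrite Rmult_1_l.
apply Rle_trans with (lsum (map (fun g => (g * k0)%nat) (rg G)) (fun k =>
  lsum (rg X) (fun l => b k * b l * iv (Nat.eqb (l * m) (k * n))))).
- unfold lsum at 1; rewrite map_map.
  change (fold_right Rplus 0 (map ?f (rg G))) with (lsum (rg G) f).
  unfold zs; rewrite <- lsum_scal_r, <- lsum_scal; apply lsum_le; intros g Hg.
  apply in_rg in Hg.
  eapply Rle_trans; [|apply (lsum_term (rg X) _ (g * l0)%nat)].
  + cbv beta; replace (Nat.eqb _ _) with true.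
    2: { symmetry; apply Nat.eqb_eq; rewrite Em, En; fold k0 l0; ring. }
    simpl iv; rewrite Rmult_1_r.
    assert (B1 := Hbc (g * k0)%nat ltac:(nia)).
    assert (B2 := Hbc (g * l0)%nat ltac:(nia)).
    rewrite !w_mult in B1, B2 by lia.
    unfold gk; fold d k0 l0; rewrite <- w_sq.
    replace (c ^ 2 * (w sigma g ^ 2 * (w sigma k0 * w sigma l0))) with
      ((c * (w sigma g * w sigma k0)) * (c * (w sigma g * w sigma l0))) by ring.
    apply Rmult_le_compat; trivial; repeat apply Rmult_le_pos; trivial; apply w_ge_0.
  + intros; apply P.
  + apply in_rg; nia.
- apply lsum_incl.
  + intros; now apply lsum_ge_0.
  + apply Injective_map_NoDup; [|apply rg_NoDup].
    intros u v; nia.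
  + intros k Hk; apply in_map_iff in Hk; destruct Hk as [g [<- Hg]].
    apply in_rg in Hg; apply in_rg; nia.
Qed.

Lemma resonance (M : list nat) J1 J' G X a h sigma V C1 c :
  (0 < J1)%nat -> NoDup M -> (forall m, In m M -> (0 < m)%nat) ->
  (G * G <= X)%nat -> 0 < h -> 0 <= V -> 0 <= c -> 1 / 2 <= sigma ->
  (forall n, (1 <= n <= X)%nat -> h * ln (INR n) <= 1) ->
  (forall n, 0 <= a n <= C1) -> (forall n, (1 <= n <= G * G)%nat -> c <= a n) ->
  (forall j, (J' <= j < J1)%nat ->
     Cmod (dirpoly X (fun n => a n * w sigma n) (h * INR j)) <= V) ->
  INR J1 ^ 2 / 4 * (c ^ 2 * (zs (2 * sigma) G * gtrunc sigma G M))
  <= V ^ 2 * (8 * INR J1 ^ 2 * INR (length M))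
     + INR (length M) ^ 2 * (INR J1 * (2 * C1 ^ 2 *
         (INR J' * zs (2 * sigma) X + 4 * INR X ^ 3 / h))).
Proof.
intros HJ ND HM HGX Hh HV Hc Hs Hln Ha Hac HB.
set (b := fun n => a n * w sigma n) in *.
assert (Hb : forall n, 0 <= b n).
{ intros; apply Rmult_le_pos; [apply Ha|apply w_ge_0]. }
set (z := fun m => Z.to_nat (Zfloor (INR (8 * J1) * h * ln (INR m) / (2 * PI)))).
assert (HP := PI_RGT_0).
assert (Hz : forall m, In m M ->
  INR (z m) <= INR (8 * J1) * h * ln (INR m) / (2 * PI) < INR (z m) + 1).
{ intros m Hm; unfold z.
  set (x := INR (8 * J1) * h * ln (INR m) / (2 * PI)).
  assert (Hx : 0 <= x).
  { apply Rdiv_le_0_compat; [|lra]; repeat apply Rmult_le_pos; try lra.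
    - apply pos_INR.
    - apply ln_ge_0, INR_ge_1; auto. }
  assert (F := Zfloor_bound x).
  assert (0 <= Zfloor x)%Z.
  { apply Z.lt_succ_r, lt_IZR; rewrite succ_IZR; lra. }
  rewrite INR_IZR_INZ, Z2Nat.id by trivial; lra. }
eapply Rle_trans; [apply Rmult_le_compat_l;
  [|apply (diagonal_lower M G X b sigma c HM HGX Hc Hb)]|].
- generalize (pow2_ge_0 (INR J1)); lra.
- intros n Hn; unfold b; apply Rmult_le_compat_r; [apply w_ge_0|now apply Hac].
- eapply Rle_trans; [now apply (moment_lower M z J1 ND HJ X b h Hb HM Hz)|].
  eapply Rle_trans; [now apply (moment_upper M z J1 J' X b h V)|].
  apply Rplus_le_compat_l, Rmult_le_compat_l; [apply pow2_ge_0|].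
  apply Rmult_le_compat_l; [apply pos_INR|].
  rewrite Rmult_assoc; apply Rmult_le_compat_l; [lra|].
  rewrite Rmult_plus_distr_l; apply Rplus_le_compat.
  + rewrite <- Rmult_assoc, (Rmult_comm (C1 ^ 2)), Rmult_assoc.
    apply Rmult_le_compat_l; [apply pos_INR|].
    unfold zs; rewrite <- lsum_scal; apply lsum_le; intros n _.
    unfold b; rewrite Rpow_mult_distr, w_sq; apply Rmult_le_compat_r; [apply w_ge_0|].
    apply pow_incr, Ha.
  + replace (C1 ^ 2 * (4 * INR X ^ 3 / h)) with (4 * INR X / h * (INR X * C1) ^ 2)
      by (field; lra).
    apply Rmult_le_compat_l.
    { apply Rdiv_le_0_compat; [generalize (pos_INR X); lra|lra]. }
    apply pow_incr; split; [apply lsum_ge_0; auto|].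
    rewrite <- (length_seq X 1) at 2; rewrite <- lsum_const; apply lsum_le; intros n Hn.
    apply in_rg in Hn; unfold b; rewrite <- (Rmult_1_r C1).
    apply Rmult_le_compat; try apply Ha; try apply w_ge_0.
    rewrite <- (w_1 sigma); apply w_decr; [lra|lia].
Qed.

(** * Smoothing zeta *)

(** Binomial average, the sum of [C(n, k) 2^(-n) f (u + k h)]. The recursive form reduces both its
    Fourier multiplier and its effect on the pole to a single step. *)
Fixpoint avg (h : R) (n : nat) (f : R -> C) (u : R) : C :=
  match n with
  | O => f u
  | S n => (RtoC (/ 2) * (avg h n f u + avg h n f (u + h)))%C
  end.

Fixpoint avgR (h : R) (n : nat) (f : R -> R) (u : R) : R :=
  match n with
  | O => f u
  | S n => / 2 * (avgR h n f u + avgR h n f (u + h))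
  end.

Lemma avg_ext h n f g u : 0 <= h ->
  (forall v, u <= v <= u + INR n * h -> f v = g v) -> avg h n f u = avg h n g u.
Proof.
intros Hh; revert u; induction n as [|n IH]; intros u H; simpl avg.
- apply H; simpl; lra.
- rewrite S_INR in H; assert (0 <= INR n * h) by (apply Rmult_le_pos; [apply pos_INR|lra]).
  rewrite !IH; trivial; intros; apply H; lra.
Qed.

Lemma avg_scal h n c f u : avg h n (fun v => c * f v)%C u = (c * avg h n f u)%C.
Proof. revert u; induction n as [|n IH]; intros u; simpl; [|rewrite !IH]; ring. Qed.

Lemma avg_plus h n f g u :
  avg h n (fun v => f v + g v)%C u = (avg h n f u + avg h n g u)%C.
Proof. revert u; induction n as [|n IH]; intros u; simpl; [|rewrite !IH]; ring. Qed.

Lemma avg_csum {A} h n (l : list A) f u :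
  avg h n (fun v => csum l (fun x => f x v)) u = csum l (fun x => avg h n (f x) u).
Proof.
revert u; induction n as [|n IH]; intros u; simpl; [reflexivity|].
now rewrite !IH, <- csum_plus, <- csum_scal.
Qed.

Lemma avg_shift h n f u : avg h n (fun v => f (v + h)) u = avg h n f (u + h).
Proof. revert u; induction n as [|n IH]; intros u; simpl; [|rewrite !IH]; reflexivity. Qed.

Lemma avg_RtoC h n f u : avg h n (fun v => RtoC (f v)) u = RtoC (avgR h n f u).
Proof.
revert u; induction n as [|n IH]; intros u; simpl; [reflexivity|].
now rewrite !IH, <- RtoC_plus, <- RtoC_mult.
Qed.

Lemma avgR_scal h n c f u : avgR h n (fun v => c * f v) u = c * avgR h n f u.
Proof. revert u; induction n as [|n IH]; intros u; simpl; [|rewrite !IH]; ring. Qed.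

Lemma avg_le h n f g u : 0 <= h ->
  (forall v, u <= v <= u + INR n * h -> Cmod (f v) <= g v) ->
  Cmod (avg h n f u) <= avgR h n g u.
Proof.
intros Hh; revert u; induction n as [|n IH]; intros u H; simpl avg; simpl avgR.
- apply H; simpl; lra.
- rewrite S_INR in H; assert (0 <= INR n * h) by (apply Rmult_le_pos; [apply pos_INR|lra]).
  rewrite Cmod_mult, Cmod_R, Rabs_pos_eq by lra.
  apply Rmult_le_compat_l; [lra|].
  eapply Rle_trans; [apply Cmod_triangle|].
  apply Rplus_le_compat; apply IH; intros; apply H; lra.
Qed.

Lemma half_cis x : (RtoC (/ 2) * (1 + cis x) = RtoC (cos (x / 2)) * cis (x / 2))%C.
Proof.
unfold cis, Cmult, Cplus, RtoC; simpl.
assert (E : x = x / 2 + x / 2) by field.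
replace (cos x) with (cos (x / 2 + x / 2)) by now rewrite <- E.
replace (sin x) with (sin (x / 2 + x / 2)) by now rewrite <- E.
rewrite cos_plus, sin_plus.
generalize (sin2_cos2 (x / 2)); unfold Rsqr; intros K.
f_equal; [|field].
replace (sin (x / 2) * sin (x / 2)) with (1 - cos (x / 2) * cos (x / 2)) by lra; field.
Qed.

Lemma avg_cis h n a u :
  avg h n (fun v => cis (a * v)) u
  = (RtoC (cos (a * h / 2) ^ n) * cis (a * (u + INR n * h / 2)))%C.
Proof.
revert u; induction n as [|n IH]; intros u; simpl avg.
- simpl; replace (a * (u + 0 * h / 2)) with (a * u) by field; ring.
- rewrite !IH.
  replace (a * (u + h + INR n * h / 2)) with (a * (u + INR n * h / 2) + a * h) by ring.
  rewrite cis_plus.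
  set (y := cis (a * (u + INR n * h / 2))).
  transitivity (RtoC (cos (a * h / 2) ^ n) * y * (RtoC (/ 2) * (1 + cis (a * h))))%C;
    [ring|].
  rewrite half_cis, S_INR.
  replace (a * (u + (INR n + 1) * h / 2)) with
    (a * (u + INR n * h / 2) + a * h / 2) by field.
  rewrite cis_plus; fold y; simpl pow; rewrite RtoC_mult; ring.
Qed.

Definition pole_den (z : C) (u : R) : C := (z - Ci * RtoC u)%C.

(** Discrete pole of order [r + 1]: a product of reciprocals at consecutive nodes, the analogue of a
    falling factorial of negative order. Unlike the power of a single reciprocal, it is reproduced
    by forward differences. *)
Fixpoint pole (h : R) (z : C) (r : nat) (u : R) : C :=
  match r with
  | O => / pole_den z u
  | S r => pole h z r u * / pole_den z (u + INR (S r) * h)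
  end%C.

Lemma pole_shift h z r u :
  (pole h z r (u + h) * / pole_den z u = pole h z (S r) u)%C.
Proof.
induction r as [|r IH].
- simpl; replace (u + 1 * h) with (u + h) by ring; ring.
- change (pole h z (S r) (u + h)) with
    (pole h z r (u + h) * / pole_den z (u + h + INR (S r) * h))%C.
  change (pole h z (S (S r)) u) with
    (pole h z (S r) u * / pole_den z (u + INR (S (S r)) * h))%C.
  rewrite <- IH, (S_INR (S r)).
  replace (u + (INR (S r) + 1) * h) with (u + h + INR (S r) * h) by ring; ring.
Qed.

(** The two products share all but their extreme factors, and the extreme denominators differ by
    [Ci h (r + 1)]. *)
Lemma pole_diff h z r u : pole_den z u <> 0%C ->
  pole_den z (u + INR (S r) * h) <> 0%C ->
  pole h z r (u + h) = (pole h z r u + Ci * RtoC (h * INR (S r)) * pole h z (S r) u)%C.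
Proof.
intros H1 H2.
assert (E1 : pole h z r (u + h) = (pole h z (S r) u * pole_den z u)%C).
{ rewrite <- pole_shift; field; trivial. }
assert (E2 : pole h z r u = (pole h z (S r) u * pole_den z (u + INR (S r) * h))%C).
{ change (pole h z (S r) u) with (pole h z r u * / pole_den z (u + INR (S r) * h))%C.
  field; trivial. }
rewrite E1, E2 at 1; unfold pole_den; rewrite RtoC_plus, (RtoC_mult (INR (S r))), (RtoC_mult h); ring.
Qed.

Lemma pole_bound h z r u tau : 0 < tau -> 0 <= h ->
  (forall v, u <= v <= u + INR r * h -> tau <= Cmod (pole_den z v)) ->
  Cmod (pole h z r u) <= / tau ^ (S r).
Proof.
intros Ht Hh; induction r as [|r IH]; intros H.
- simpl; rewrite Rmult_1_r.
  assert (K : tau <= Cmod (pole_den z u)) by (apply H; simpl; lra).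
  rewrite Cmod_inv by (apply Cmod_gt_0; lra); apply Rinv_le_contravar; lra.
- assert (P : 0 <= INR r * h) by (apply Rmult_le_pos; [apply pos_INR|lra]).
  change (pole h z (S r) u) with (pole h z r u * / pole_den z (u + INR (S r) * h))%C.
  assert (K : tau <= Cmod (pole_den z (u + INR (S r) * h))).
  { apply H; rewrite S_INR; lra. }
  rewrite Cmod_mult, Cmod_inv by (apply Cmod_gt_0; lra).
  change (tau ^ S (S r)) with (tau * tau ^ S r).
  rewrite Rinv_mult, Rmult_comm; apply Rmult_le_compat; try apply Cmod_ge_0.
  + left; apply Rinv_0_lt_compat; lra.
  + apply Rinv_le_contravar; lra.
  + apply IH; intros v Hv; apply H; rewrite S_INR; lra.
Qed.

(* Applying the averaging operator once multiplies the modulated pole of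
   order [r] by [cos (a h / 2)], up to a pole of order [r + 1] whose
   coefficient [h (r + 1)] is small compared with [tau]. *)
Lemma avg_pole h z a tau eta : 0 < tau -> 0 <= h -> 0 <= eta ->
  forall n r u, (forall v, u <= v <= u + INR (n + r) * h -> tau <= Cmod (pole_den z v)) ->
  INR (n + r) * h <= 2 * tau * eta ->
  Cmod (avg h n (fun v => cis (a * v) * pole h z r v)%C u)
  <= (Rabs (cos (a * h / 2)) + eta) ^ n * / tau ^ (S r).
Proof.
intros Ht Hh He; set (c := Rabs (cos (a * h / 2))).
assert (Hc : 0 <= c) by apply Rabs_pos.
induction n as [|n IH]; intros r u H Hr.
- simpl avg; rewrite Cmod_mult, Cmod_cis, !Rmult_1_l; apply pole_bound; trivial.
- assert (P : 0 <= INR n * h) by (apply Rmult_le_pos; [apply pos_INR|lra]).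
  assert (P' : 0 <= INR r * h) by (apply Rmult_le_pos; [apply pos_INR|lra]).
  assert (EN : INR (S n + r) = INR n + INR r + 1).
  { change (S n + r)%nat with (S (n + r)); rewrite S_INR, plus_INR; ring. }
  rewrite EN in H, Hr.
  simpl avg; rewrite <- (avg_shift h n _ u).
  rewrite (avg_ext h n (fun v => cis (a * (v + h)) * pole h z r (v + h))%C
    (fun v => cis (a * h) * (cis (a * v) * pole h z r v)
      + cis (a * h) * (Ci * RtoC (h * INR (S r))) * (cis (a * v) * pole h z (S r) v))%C);
    trivial.
  2: { intros v Hv; rewrite pole_diff.
    - replace (a * (v + h)) with (a * h + a * v) by ring; rewrite cis_plus; ring.
    - apply Cmod_gt_0; eapply Rlt_le_trans; [exact Ht|apply H; lra].
    - apply Cmod_gt_0; eapply Rlt_le_trans; [exact Ht|apply H; rewrite S_INR; lra]. }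
  rewrite avg_plus, !avg_scal.
  set (M0 := avg h n (fun v => cis (a * v) * pole h z r v)%C u).
  set (M1 := avg h n (fun v => cis (a * v) * pole h z (S r) v)%C u).
  replace (RtoC (/ 2) * (M0 + (cis (a * h) * M0
             + cis (a * h) * (Ci * RtoC (h * INR (S r))) * M1)))%C
    with (RtoC (/ 2) * (1 + cis (a * h)) * M0
          + cis (a * h) * Ci * RtoC (/ 2 * (h * INR (S r))) * M1)%C
    by (rewrite (RtoC_mult (/ 2)); ring).
  rewrite half_cis.
  eapply Rle_trans; [apply Cmod_triangle|].
  rewrite !Cmod_mult, !Cmod_cis, Cmod_Ci, !Cmod_R; fold c.
  assert (T : 0 <= / 2 * (h * INR (S r))).
  { apply Rmult_le_pos; [lra|]; apply Rmult_le_pos; [lra|apply pos_INR]. }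
  rewrite (Rabs_pos_eq (/ 2 * _)) by trivial.
  assert (I0 : Cmod M0 <= (c + eta) ^ n * / tau ^ S r).
  { apply IH; rewrite plus_INR; [intros v Hv; apply H|]; lra. }
  assert (I1 : Cmod M1 <= (c + eta) ^ n * / tau ^ S (S r)).
  { apply IH; rewrite plus_INR, S_INR; [intros v Hv; apply H|]; lra. }
  assert (Pn : 0 <= (c + eta) ^ n) by (apply pow_le; lra).
  assert (Pt : 0 < / tau ^ S r) by (apply Rinv_0_lt_compat, pow_lt; trivial).
  assert (Q : / 2 * (h * INR (S r)) * / tau <= eta).
  { apply Rmult_le_reg_r with tau; trivial; rewrite Rmult_assoc, Rinv_l by lra.
    rewrite S_INR; lra. }
  change (tau ^ S (S r)) with (tau * tau ^ S r) in I1; rewrite Rinv_mult in I1.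
  apply (Rmult_le_compat_l _ _ _ Hc) in I0.
  apply (Rmult_le_compat_l _ _ _ T) in I1.
  assert (W : 0 <= (c + eta) ^ n * / tau ^ S r) by (apply Rmult_le_pos; lra).
  apply (Rmult_le_compat_r _ _ _ W) in Q.
  change ((c + eta) ^ S n) with ((c + eta) * (c + eta) ^ n).
  rewrite !Rmult_1_l, !Rmult_1_r; lra.
Qed.

Section Smoothing.

Variables (h D : R) (Q A : nat).
Hypothesis h_pos : 0 < h.
Hypothesis Q_pos : (0 < Q)%nat.

(** A binomial window of bounded width built from steps of size about [1 / l] has a transform of
    width only about [sqrt l]. Modulating by the frequencies [(q1 - q2) D] lays translates of that
    bump side by side and reaches the order of [l], while the kernel stays nonnegative. *)
Definition fejer (u : R) : R :=
  / INR Q * lsum (List.seq 0 Q) (fun q1 => lsum (List.seq 0 Q) (fun q2 =>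
    cos ((INR q1 - INR q2) * (D * u)))).

Definition smooth (f : R -> C) : C :=
  avg h (2 * A) (fun u => RtoC (fejer u) * f u)%C (- (INR A * h)).

(* The kernel behind [smooth] is a probability measure (binomial, step [h]) times
   [fejer]; [khat] is its Fourier transform. *)
Definition khat (xi : R) : R :=
  / INR Q * lsum (List.seq 0 Q) (fun q1 => lsum (List.seq 0 Q) (fun q2 =>
    cos (((INR q1 - INR q2) * D - xi) * h / 2) ^ (2 * A))).

Lemma Q_gt_0 : 0 < / INR Q.
Proof. now apply Rinv_0_lt_compat, lt_0_INR. Qed.

Lemma fejer_kernel_ge_0 u : 0 <= fejer u.
Proof. apply Rmult_le_pos; [left; apply Q_gt_0|apply fejer_ge_0]. Qed.

Lemma fejer_cis u : RtoC (fejer u) =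
  (RtoC (/ INR Q) * csum (List.seq 0 Q) (fun q1 => csum (List.seq 0 Q) (fun q2 =>
     cis ((INR q1 - INR q2) * D * u))))%C.
Proof.
unfold fejer; rewrite RtoC_mult; f_equal.
apply injective_projections.
- change (fst ?x) with (Re x); rewrite Re_csum; apply lsum_ext; intros p _.
  rewrite Re_csum; apply lsum_ext; intros q _; unfold cis, Re; simpl.
  now rewrite Rmult_assoc.
- transitivity 0; [reflexivity|]; change (snd ?x) with (Im x); rewrite Im_csum.
  rewrite (lsum_ext _ _ (fun p => lsum (List.seq 0 Q) (fun q =>
    sin ((INR p - INR q) * D * u)))) by (intros; apply Im_csum).
  set (S0 := lsum _ _).
  (* Exchanging the two indices changes the sign of every sine, so the imaginary part vanishes. *)
  assert (E : S0 = - S0); [|simpl; lra].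
  unfold S0 at 1; rewrite lsum_exch.
  replace (- S0) with (-1 * S0) by ring; unfold S0; rewrite <- lsum_scal.
  apply lsum_ext; intros p _; rewrite <- lsum_scal; apply lsum_ext; intros q _.
  replace ((INR q - INR p) * D * u) with (- ((INR p - INR q) * D * u)) by ring.
  rewrite sin_neg; ring.
Qed.

Lemma smooth_modulated f : (smooth f =
  RtoC (/ INR Q) * csum (List.seq 0 Q) (fun q1 => csum (List.seq 0 Q) (fun q2 =>
   avg h (2 * A) (fun u => cis ((INR q1 - INR q2) * D * u) * f u)%C (- (INR A * h)))))%C.
Proof.
unfold smooth.
rewrite (avg_ext _ _ _ (fun u => RtoC (/ INR Q) *
  csum (List.seq 0 Q) (fun q1 => csum (List.seq 0 Q) (fun q2 =>
     cis ((INR q1 - INR q2) * D * u) * f u)))%C).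
- rewrite avg_scal, avg_csum; f_equal; apply csum_ext; intros; apply avg_csum.
- lra.
- intros u _; rewrite fejer_cis, <- Cmult_assoc; f_equal.
  rewrite <- csum_scal_r; apply csum_ext; intros; now rewrite csum_scal_r.
Qed.

Lemma smooth_cis xi : smooth (fun u => cis (- xi * u)) = RtoC (khat xi).
Proof.
rewrite smooth_modulated; unfold khat; rewrite RtoC_mult, <- csum_RtoC; f_equal.
apply csum_ext; intros p _; rewrite <- csum_RtoC; apply csum_ext; intros q _.
rewrite (avg_ext _ _ _ (fun u => cis (((INR p - INR q) * D - xi) * u))).
- rewrite avg_cis, mult_INR; simpl (INR 2).
  replace (((INR p - INR q) * D - xi) * (- (INR A * h) + (1 + 1) * INR A * h / 2))
    with 0 by field.
  rewrite cis_0; ring.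
- lra.
- intros u _; rewrite <- cis_plus; f_equal; ring.
Qed.

Lemma smooth_plus f g : smooth (fun u => f u + g u)%C = (smooth f + smooth g)%C.
Proof.
unfold smooth; rewrite <- avg_plus; apply avg_ext; [lra|]; intros; ring.
Qed.

Lemma smooth_scal c f : smooth (fun u => c * f u)%C = (c * smooth f)%C.
Proof.
unfold smooth; rewrite <- avg_scal; apply avg_ext; [lra|]; intros; ring.
Qed.

Lemma smooth_csum {B} (l : list B) f :
  smooth (fun u => csum l (fun x => f x u)) = csum l (fun x => smooth (f x)).
Proof.
unfold smooth; rewrite <- avg_csum; apply avg_ext; [lra|]; intros.
now rewrite csum_scal.
Qed.

(** As the kernel is nonnegative, its total mass is its transform at 0. *)
Lemma smooth_bound f V :
  (forall u, Rabs u <= INR A * h -> Cmod (f u) <= V) -> Cmod (smooth f) <= V * khat 0.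
Proof.
intros H.
assert (E : khat 0 = avgR h (2 * A) fejer (- (INR A * h))).
{ apply RtoC_inj; rewrite <- smooth_cis, <- avg_RtoC; unfold smooth.
  apply avg_ext; [lra|]; intros v _.
  replace (- 0 * v) with 0 by ring; rewrite cis_0; ring. }
rewrite E, <- avgR_scal; apply avg_le; [lra|].
rewrite mult_INR; simpl (INR 2); intros v Hv.
rewrite Cmod_mult, Cmod_R, Rabs_pos_eq, Rmult_comm by apply fejer_kernel_ge_0.
apply Rmult_le_compat_r; [apply fejer_kernel_ge_0|apply H, Rabs_le; lra].
Qed.

Lemma khat_ge_0 xi : 0 <= khat xi.
Proof.
apply Rmult_le_pos; [left; apply Q_gt_0|].
apply lsum_ge_0; intros; apply lsum_ge_0; intros; rewrite pow_mult.
apply pow_le, pow2_ge_0.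
Qed.

Lemma khat_le xi : khat xi <= khat 0.
Proof.
rewrite <- (Rabs_pos_eq (khat xi)), <- Cmod_R, <- smooth_cis, <- (Rmult_1_l (khat 0))
  by apply khat_ge_0.
apply smooth_bound; intros; rewrite Cmod_cis; lra.
Qed.

Lemma double_sum_le (g : nat -> nat -> R) E :
  (forall p q, (p < Q)%nat -> (q < Q)%nat -> g p q <= E) ->
  / INR Q * lsum (List.seq 0 Q) (fun p => lsum (List.seq 0 Q) (g p)) <= INR Q * E.
Proof.
intros H.
assert (HQ : 0 < INR Q) by now apply lt_0_INR.
apply Rmult_le_reg_l with (INR Q); trivial.
rewrite <- Rmult_assoc, Rinv_r, Rmult_1_l by lra.
rewrite <- (length_seq Q 0) at 2; rewrite <- lsum_const; apply lsum_le; intros p Hp.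
rewrite <- (length_seq Q 0) at 2; rewrite <- lsum_const; apply lsum_le; intros q Hq.
apply in_seq in Hp, Hq; apply H; lia.
Qed.

Lemma smooth_pole z xi tau eta cbar : 0 < tau -> 0 <= eta ->
  (forall u, Rabs u <= INR A * h -> tau <= Cmod (pole_den z u)) ->
  INR A * h <= tau * eta ->
  (forall p q, (p < Q)%nat -> (q < Q)%nat ->
     Rabs (cos (((INR p - INR q) * D - xi) * h / 2)) <= cbar) ->
  Cmod (smooth (fun u => cis (- xi * u) * / pole_den z u)%C)
  <= INR Q * ((cbar + eta) ^ (2 * A) / tau).
Proof.
intros Ht He H1 H2 H3.
rewrite smooth_modulated, Cmod_mult, Cmod_R, Rabs_pos_eq by (left; apply Q_gt_0).
eapply Rle_trans; [apply Rmult_le_compat_l; [left; apply Q_gt_0|apply Cmod_csum]|].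
eapply Rle_trans; [apply Rmult_le_compat_l; [left; apply Q_gt_0|]|].
{ apply lsum_le; intros; apply Cmod_csum. }
apply double_sum_le; intros p q Hp Hq.
rewrite (avg_ext _ _ _ (fun u => cis (((INR p - INR q) * D - xi) * u) * pole h z 0 u)%C).
- eapply Rle_trans; [apply (avg_pole h z _ tau eta); trivial; try lra|].
  + rewrite Nat.add_0_r, mult_INR; simpl (INR 2); intros v Hv; apply H1, Rabs_le; lra.
  + rewrite Nat.add_0_r, mult_INR; simpl (INR 2); lra.
  + rewrite pow_1; apply Rmult_le_compat_r; [left; now apply Rinv_0_lt_compat|].
    apply pow_incr; split.
    * apply Rplus_le_le_0_compat; [apply Rabs_pos|trivial].
    * apply Rplus_le_compat_r, H3; trivial.
- lra.
- intros u _; simpl pole.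
  replace (((INR p - INR q) * D - xi) * u) with
    ((INR p - INR q) * D * u + - xi * u) by ring.
  rewrite cis_plus; ring.
Qed.

(** Smoothing in [u] multiplies the term of index [n] in [zeta_trunc] by [khat (ln n)]. What remains
    is the correction [N^(1 - s) / (1 - s)], a pole modulated at frequency [ln N], to which
    [smooth_pole] applies. *)
Lemma smooth_zeta (sigma t : R) (N : nat) (V e tau eta cbar : R) :
  (1 <= N)%nat -> 0 < tau -> 0 <= eta ->
  (forall u, Rabs u <= INR A * h -> tau <= Rabs (t + u)) ->
  INR A * h <= tau * eta ->
  (forall p q, (p < Q)%nat -> (q < Q)%nat ->
     Rabs (cos (((INR p - INR q) * D - ln (INR N)) * h / 2)) <= cbar) ->
  (forall u, Rabs u <= INR A * h -> Cmod (zeta (sigma, (t + u)%R)) <= V) ->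
  (forall u, Rabs u <= INR A * h ->
     Cmod (zeta (sigma, (t + u)%R) - zeta_trunc (sigma, (t + u)%R) N)%C <= e) ->
  Cmod (dirpoly N (fun n => khat (ln (INR n)) * w sigma n) t)
  <= (V + e) * khat 0
     + Rpower (INR N) (1 - sigma) * (INR Q * ((cbar + eta) ^ (2 * A) / tau)).
Proof.
intros HN Ht He H1 H2 H3 HV Hz.
set (z := ((1 - sigma, - t) : C)).
set (P := fun u => (cis (- ln (INR N) * u) * / pole_den z u)%C).
set (K := (RtoC (Rpower (INR N) (1 - sigma)) * cis (- t * ln (INR N)))%C).
assert (Ez : forall u, pole_den z u = (1 - (sigma, (t + u)%R))%C).
{ intros u; unfold pole_den, z, Cminus, Cplus, Copp, Cmult, Ci, RtoC; simpl; f_equal; ring. }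
assert (E : dirpoly N (fun n => khat (ln (INR n)) * w sigma n) t
  = (smooth (fun u => zeta_trunc (sigma, (t + u)%R) N) + K * smooth P)%C).
{ rewrite <- smooth_scal, <- smooth_plus.
  unfold dirpoly.
  rewrite (csum_ext (rg N) _ (fun n => (RtoC (w sigma n) * cis (- t * ln (INR n)))
      * smooth (fun u => cis (- ln (INR n) * u))))%C.
  2: { intros n _; rewrite smooth_cis, RtoC_mult; ring. }
  rewrite (csum_ext (rg N) _ (fun n => smooth (fun u => (RtoC (w sigma n) *
     cis (- t * ln (INR n))) * cis (- ln (INR n) * u))%C))
    by (intros; now rewrite smooth_scal).
  rewrite <- smooth_csum; unfold smooth; apply avg_ext; [lra|].
  intros u _; f_equal.
  unfold zeta_trunc.
  assert (X : forall k, sum_n_m (fun n => cpow (INR n) (- (sigma, (t + u)%R))) 1 k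
    = csum (rg k) (fun n => RtoC (w sigma n) * cis (- t * ln (INR n)) *
        cis (- ln (INR n) * u))%C).
  { induction k as [|k IH].
    - rewrite sum_n_m_zero by lia; reflexivity.
    - rewrite sum_n_Sm, IH by lia; rewrite seq_S, csum_app; rewrite csum_cons.
      change plus with Cplus; f_equal.
      change (- (sigma, (t + u)%R))%C with ((- sigma, - (t + u)) : C).
      rewrite cpow_cis by (apply lt_0_INR; lia).
      change (1 + k)%nat with (S k).
      replace (- (t + u) * ln (INR (S k))) with
        (- t * ln (INR (S k)) + - ln (INR (S k)) * u) by ring.
      rewrite cis_plus; unfold w, csum; simpl fold_right.
      change (1 + k)%nat with (S k); ring. }
  rewrite X; unfold P, K; rewrite Ez.
  replace (cpow (INR N) (1 - (sigma, (t + u)%R))) with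
    (RtoC (Rpower (INR N) (1 - sigma)) * cis (- t * ln (INR N)) *
      cis (- ln (INR N) * u))%C.
  - unfold Cdiv; ring.
  - replace (1 - (sigma, (t + u)%R))%C with ((1 - sigma, - (t + u)) : C).
    + rewrite cpow_cis by (apply lt_0_INR; lia).
      replace (- (t + u) * ln (INR N)) with
        (- t * ln (INR N) + - ln (INR N) * u) by ring.
      rewrite cis_plus; ring.
    + unfold Cminus, Cplus, Copp, RtoC; simpl; f_equal; ring. }
rewrite E; eapply Rle_trans; [apply Cmod_triangle|]; apply Rplus_le_compat.
- apply smooth_bound; intros u Hu.
  replace (zeta_trunc (sigma, (t + u)%R) N) with (zeta (sigma, (t + u)%R) +
    - (zeta (sigma, (t + u)%R) - zeta_trunc (sigma, (t + u)%R) N))%C by ring.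
  eapply Rle_trans; [apply Cmod_triangle|]; rewrite Cmod_opp.
  apply Rplus_le_compat; auto.
- rewrite Cmod_mult; unfold K; rewrite Cmod_mult, Cmod_cis, Cmod_R, Rmult_1_r.
  rewrite Rabs_pos_eq by (left; apply exp_pos).
  apply Rmult_le_compat_l; [left; apply exp_pos|].
  apply smooth_pole; trivial.
  intros u Hu; eapply Rle_trans; [apply (H1 u Hu)|].
  rewrite Ez, <- Rabs_Ropp; eapply Rle_trans; [|apply im_le_Cmod'].
  unfold Im, Cminus, Cplus, Copp, RtoC; simpl; right; f_equal; ring.
Qed.

End Smoothing.

(** * Bounds for the smoothing kernel *)

Lemma cos_sqr_le x : Rabs x <= 1 -> cos x ^ 2 <= 1 - x ^ 2 / 4.
Proof.
intros H; assert (K := Rabs_sin_ge x H).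
assert (E := sin2_cos2 x); rewrite !Rsqr_pow2 in E.
assert (0 <= Rabs x) by apply Rabs_pos.
assert ((Rabs x / 2) ^ 2 <= Rabs (sin x) ^ 2) by (apply pow_incr; lra).
rewrite pow2_abs in H1; unfold Rdiv in H1; rewrite Rpow_mult_distr, pow2_abs in H1; lra.
Qed.

Lemma Rabs_sin_le x : Rabs (sin x) <= Rabs x.
Proof.
destruct (Req_dec x 0) as [->|N]; [rewrite sin_0; lra|].
destruct (MVT_abs sin cos 0 x) as [c [E Hc]].
{ intros; apply derivable_pt_lim_sin. }
rewrite sin_0, !Rminus_0_r in E; rewrite E.
rewrite <- (Rmult_1_l (Rabs x)) at 2; apply Rmult_le_compat_r; [apply Rabs_pos|].
apply Rabs_le, COS_bound.
Qed.

Lemma cos_sqr_ge x : 1 - x ^ 2 <= cos x ^ 2.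
Proof.
assert (E := sin2_cos2 x); rewrite !Rsqr_pow2 in E.
assert (Rabs (sin x) ^ 2 <= Rabs x ^ 2).
{ apply pow_incr; split; [apply Rabs_pos|apply Rabs_sin_le]. }
rewrite !pow2_abs in H; lra.
Qed.

Lemma bernoulli x n : -1 <= x -> 1 + INR n * x <= (1 + x) ^ n.
Proof.
intros Hx; induction n as [|n IH]; [simpl; lra|].
rewrite S_INR; simpl pow.
apply (Rmult_le_compat_l (1 + x)) in IH; [|lra].
generalize (pos_INR n) (pow2_ge_0 x); nra.
Qed.

Lemma pow_le_exp x n : 0 <= 1 - x -> (1 - x) ^ n <= exp (- (INR n * x)).
Proof.
intros H; replace (- (INR n * x)) with (INR n * - x) by ring.
replace (exp (INR n * - x)) with (exp (- x) ^ n).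
- apply pow_incr; split; trivial; generalize (exp_ineq1_le (- x)); lra.
- induction n as [|n IH]; [simpl; now rewrite Rmult_0_l, exp_0|].
  rewrite S_INR; simpl pow; rewrite IH, <- exp_plus; f_equal; ring.
Qed.

Section KernelBounds.

Variables (h : R) (Q B : nat).
Hypothesis h_pos : 0 < h.
Hypothesis Q_pos : (0 < Q)%nat.
Hypothesis B_pos : (0 < B)%nat.

(** With [A = B * B] a single binomial bump has width about [1 / (h B)]. Spacing the translates by
    exactly this [D] makes them overlap into a plateau without piling up. *)
Let D := / INR B / h.
Let A := (B * B)%nat.

Lemma kernel_arg p q xi :
  ((INR p - INR q) * D - xi) * h / 2 = ((INR p - INR q) / INR B - h * xi) / 2.
Proof. assert (0 < INR B) by now apply lt_0_INR. unfold D; field; lra. Qed.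

Lemma diff_bound p q : (p < Q)%nat -> (q < Q)%nat ->
  Rabs ((INR p - INR q) / INR B) <= INR Q / INR B.
Proof.
intros Hp Hq; assert (0 < INR B) by now apply lt_0_INR.
unfold Rdiv; rewrite Rabs_mult, (Rabs_pos_eq (/ INR B))
  by (left; now apply Rinv_0_lt_compat).
apply Rmult_le_compat_r; [left; now apply Rinv_0_lt_compat|].
apply lt_INR in Hp, Hq; generalize (pos_INR p) (pos_INR q); intros.
apply Rabs_le; lra.
Qed.

(** For fixed [p], the term at distance [i] is at most [1 / (1 + i^2 / 16)], because
    [cos x ^ 2 <= 1 / (1 + x^2 / 4)] and Bernoulli's inequality apply. The constant is
    [2 (1 + 16 * 2)], with 2 bounding the sum of [n^(-2)]. *)
Lemma khat_0_le : INR Q / INR B <= 2 -> khat h D Q A 0 <= 66.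
Proof.
intros HQ; assert (HB : 0 < INR B) by now apply lt_0_INR.
assert (HQ0 : 0 < INR Q) by now apply lt_0_INR.
set (f := fun i => / (1 + INR i ^ 2 / 16)).
assert (Hf : forall i, 0 <= f i).
{ intros; left; apply Rinv_0_lt_compat; generalize (pow2_ge_0 (INR i)); lra. }
unfold khat; apply Rmult_le_reg_l with (INR Q); trivial.
rewrite <- Rmult_assoc, Rinv_r, Rmult_1_l by lra.
rewrite <- (length_seq Q 0) at 2; rewrite <- lsum_const; apply lsum_le; intros p Hp.
apply Rle_trans with (2 * lsum (List.seq 0 Q) f).
- eapply Rle_trans; [|now apply (lsum_dist_le Q Q p f)].
  apply lsum_le; intros q Hq; apply in_seq in Hp, Hq.
  destruct (Nat.ltb_spec (p - q + (q - p)) Q); [|lia].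
  simpl iv; rewrite Rmult_1_l, kernel_arg, Rmult_0_r, Rminus_0_r, pow_mult.
  set (x := (INR p - INR q) / INR B / 2).
  assert (Hx : Rabs x <= 1).
  { unfold x, Rdiv at 1; rewrite Rabs_mult, (Rabs_pos_eq (/ 2)) by lra.
    generalize (diff_bound p q ltac:(lia) ltac:(lia)); lra. }
  assert (C1 := cos_sqr_le x Hx).
  assert (Y : 0 <= x ^ 2 / 4) by (generalize (pow2_ge_0 x); lra).
  assert (C2 : cos x ^ 2 <= / (1 + x ^ 2 / 4)).
  { apply Rmult_le_reg_r with (1 + x ^ 2 / 4); [lra|].
    rewrite Rinv_l by lra; nra. }
  eapply Rle_trans; [apply pow_incr; split; [apply pow2_ge_0|exact C2]|].
  rewrite pow_inv; unfold f; apply Rinv_le_contravar.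
  + generalize (pow2_ge_0 (INR (p - q + (q - p)))); lra.
  + eapply Rle_trans; [|apply bernoulli; lra].
    apply Rplus_le_compat_l; unfold A; rewrite mult_INR; right.
    replace (INR (p - q + (q - p)) ^ 2) with ((INR p - INR q) ^ 2).
    * unfold x; field; lra.
    * destruct (le_lt_dec q p).
      -- replace (p - q + (q - p))%nat with (p - q)%nat by lia.
         now rewrite minus_INR.
      -- replace (p - q + (q - p))%nat with (q - p)%nat by lia.
         rewrite minus_INR by lia; ring.
- destruct Q as [|Q']; [lia|].
  change (List.seq 0 (S Q')) with (0%nat :: rg Q'); rewrite lsum_cons.
  assert (F0 : f 0%nat = 1) by (unfold f; simpl; field).
  assert (F1 : lsum (rg Q') f <= 16 * zs 2 Q').
  { unfold zs; rewrite <- lsum_scal; apply lsum_le; intros i Hi; apply in_rg in Hi.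
    assert (1 <= INR i) by (apply INR_ge_1; lia).
    unfold f, w; rewrite Rpower_Ropp.
    replace (Rpower (INR i) 2) with (INR i ^ 2)
      by (rewrite <- (Rpower_pow 2) by lra; reflexivity).
    assert (0 < INR i ^ 2) by (apply pow_lt; lra).
    replace (16 * / INR i ^ 2) with (/ (INR i ^ 2 / 16)) by (field; lra).
    apply Rinv_le_contravar; lra. }
  assert (F2 := zs_bound 2 Q' ltac:(lra)).
  replace (/ (2 - 1)) with 1 in F2 by field; lra.
Qed.

(** With [d] the integer part of [h xi B], the translates with [p = q + d] are centred within [D] of
    [xi]. There are at least [Q / 2] of them, each worth at least [3 / 4]. *)
Lemma khat_large xi : 0 <= h * xi -> h * xi <= INR Q / INR B / 2 ->
  3 / 8 <= khat h D Q A xi.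
Proof.
intros H0 H1; assert (HB : 1 <= INR B) by now apply INR_ge_1.
assert (HQ0 : 0 < INR Q) by now apply lt_0_INR.
set (y := h * xi * INR B).
assert (Hy0 : 0 <= y) by (apply Rmult_le_pos; lra).
assert (Hy1 : y <= INR Q / 2).
{ unfold y; apply Rmult_le_reg_r with (/ INR B); [apply Rinv_0_lt_compat; lra|].
  rewrite Rmult_assoc, Rinv_r by lra; unfold Rdiv in *; lra. }
set (d := Z.to_nat (Zfloor y)).
assert (Hd : INR d <= y < INR d + 1).
{ unfold d; assert (F := Zfloor_bound y).
  assert (0 <= Zfloor y)%Z by (apply Z.lt_succ_r, lt_IZR; rewrite succ_IZR; lra).
  rewrite INR_IZR_INZ, Z2Nat.id by trivial; lra. }
assert (HdQ : (d < Q)%nat) by (apply INR_lt; lra).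
unfold khat; apply Rmult_le_reg_l with (INR Q); trivial.
rewrite <- Rmult_assoc, Rinv_r, Rmult_1_l by lra.
set (g := fun p q => cos (((INR p - INR q) * D - xi) * h / 2) ^ (2 * A)).
assert (Hg : forall p q, 0 <= g p q).
{ intros; unfold g; rewrite pow_mult; apply pow_le, pow2_ge_0. }
change (INR Q * (3 / 8) <= lsum (List.seq 0 Q) (fun p => lsum (List.seq 0 Q) (g p))).
rewrite lsum_exch.
apply Rle_trans with (lsum (List.seq 0 (Q - d)) (fun q =>
   lsum (List.seq 0 Q) (fun p => g p q))).
- apply Rle_trans with (INR (Q - d) * (3 / 4)).
  { rewrite minus_INR by lia; lra. }
  rewrite <- (length_seq (Q - d) 0) at 1; rewrite <- lsum_const.
  apply lsum_le; intros q Hq; apply in_seq in Hq.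
  eapply Rle_trans; [|apply (lsum_term _ (fun p => g p q) (q + d)%nat)]; trivial.
  + unfold g; rewrite kernel_arg, pow_mult.
    set (x := ((INR (q + d) - INR q) / INR B - h * xi) / 2).
    assert (Hx : x ^ 2 * INR A <= 1 / 4).
    { unfold x, A; rewrite mult_INR, plus_INR.
      replace (((INR q + INR d - INR q) / INR B - h * xi) / 2) with
        ((INR d - y) / INR B / 2) by (unfold y; field; lra).
      replace (((INR d - y) / INR B / 2) ^ 2 * (INR B * INR B)) with
        ((y - INR d) ^ 2 / 4) by (field; lra).
      assert ((y - INR d) ^ 2 <= 1 ^ 2) by (apply pow_incr; lra); lra. }
    assert (HA : 1 <= INR A) by (unfold A; rewrite mult_INR; nra).
    assert (X0 := pow2_ge_0 x).
    assert (X1 : x ^ 2 <= 1 / 4) by nra.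
    eapply Rle_trans; [|apply pow_incr; split; [|apply cos_sqr_ge]]; [|lra].
    eapply Rle_trans; [|apply (bernoulli (- x ^ 2)); lra]; lra.
  + apply in_seq; lia.
- apply lsum_incl; [|apply seq_NoDup|intros q; rewrite !in_seq; lia].
  intros; now apply lsum_ge_0.
Qed.

(** All translates are centred at most [xi / 2] from 0, hence at distance at least [xi / 2] from
    [xi]. *)
Lemma khat_tail xi : h * xi <= 1 -> INR Q / INR B <= h * xi / 2 ->
  khat h D Q A xi <= INR Q * exp (- (INR A * ((h * xi) ^ 2 / 64))).
Proof.
intros H0 H1; unfold khat; apply double_sum_le; trivial.
intros p q Hp Hq; rewrite kernel_arg, pow_mult.
assert (K := diff_bound p q Hp Hq).
set (v := (INR p - INR q) / INR B) in *; set (x := (v - h * xi) / 2).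
apply Rabs_le_between in K.
assert (K0 : 0 <= INR Q / INR B).
{ apply Rdiv_le_0_compat; [apply pos_INR|now apply lt_0_INR]. }
assert (Hx : Rabs x <= 1) by (apply Rabs_le; unfold x; lra).
assert (L : (h * xi / 4) ^ 2 <= x ^ 2).
{ replace (x ^ 2) with ((- x) ^ 2) by ring; apply pow_incr; unfold x; lra. }
eapply Rle_trans; [|apply pow_le_exp].
- apply pow_incr; split; [apply pow2_ge_0|].
  eapply Rle_trans; [apply cos_sqr_le, Hx|].
  replace ((h * xi) ^ 2 / 64) with ((h * xi / 4) ^ 2 / 4) by field; lra.
- assert ((h * xi) ^ 2 <= 1 ^ 2) by (apply pow_incr; lra); lra.
Qed.

(** The half-angle has absolute value at least [(1/2 - 1/4) / 2 = 1/8], so the squared cosine is at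
    most [1 - 1/256]. *)
Lemma cos_pole_le xi p q : 1 / 2 <= h * xi <= 1 -> INR Q / INR B <= 1 / 4 ->
  (p < Q)%nat -> (q < Q)%nat ->
  Rabs (cos (((INR p - INR q) * D - xi) * h / 2)) <= 1 - 1 / 512.
Proof.
intros H0 H1 Hp Hq; rewrite kernel_arg.
assert (K := diff_bound p q Hp Hq).
set (v := (INR p - INR q) / INR B) in *; set (x := (v - h * xi) / 2).
apply Rabs_le_between in K.
assert (Hx : Rabs x <= 1) by (apply Rabs_le; unfold x; lra).
assert (L : (1 / 8) ^ 2 <= x ^ 2).
{ replace (x ^ 2) with ((- x) ^ 2) by ring; apply pow_incr; unfold x; lra. }
assert (C := cos_sqr_le x Hx).
apply Rsqr_incr_0_var; [|lra]; rewrite <- Rsqr_abs, !Rsqr_pow2; lra.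
Qed.

End KernelBounds.

(** Telescoping the decay rate [Re s / 2 >= 1/4]. The exponent is weak, but the cutoff can be a
    large power of T. *)
Lemma zeta_trunc_approx (sigma t : R) (n : nat) :
  1 / 2 <= sigma < 1 -> (1 <= n)%nat ->
  Cmod (zeta (sigma, t) - zeta_trunc (sigma, t) n)%C
  <= 16 * (1 + Rabs t) * Rpower (INR n) (- (1 / 4)).
Proof.
intros Hs Hn; set (s := ((sigma, t) : C)).
assert (R0 : Re s = sigma) by reflexivity.
assert (H1 : s <> 1%C) by (intros E; apply (f_equal Re) in E; rewrite R0 in E; simpl in E; lra).
assert (Hc := Cmod_ge_0 s).
set (c := 2 * Cmod s / (Re s / 2)).
assert (Hc0 : 0 <= c) by (apply Rdiv_le_0_compat; lra).
assert (Hc1 : c <= 8 * Cmod s).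
{ unfold c; rewrite R0; apply Rmult_le_reg_r with (sigma / 2); [lra|].
  unfold Rdiv at 1; rewrite Rmult_assoc, Rinv_l by lra; nra. }
assert (Hcs : Cmod s <= 1 + Rabs t).
{ eapply Rle_trans; [apply Cmod_le_Re_Im|]; rewrite R0, Rabs_pos_eq by lra.
  change (Im s) with t; lra. }
destruct (zeta_trunc_lim s ltac:(lra) H1) as [A1 A2].
apply Rle_trans with (2 * (c * Rpower (INR n) (- (Re s / 2)))).
- apply (C_lim_bound (fun m => zeta_trunc s m - zeta_trunc s n)%C).
  + apply (is_lim_seq_minus' _ _ _ _ A1 (is_lim_seq_const (Re (zeta_trunc s n)))).
  + apply (is_lim_seq_minus' _ _ _ _ A2 (is_lim_seq_const (Im (zeta_trunc s n)))).
  + exists n; intros m Hm; replace m with (n + (m - n))%nat by lia.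
    eapply Rle_trans; [apply (telescope (zeta_trunc s) c (Re s / 2));
      [intros; apply zeta_trunc_step; trivial; lra|exact Hn]|].
    apply Rmult_le_compat_l; [exact Hc0|].
    unfold Rpower; generalize (exp_pos (- (Re s / 2) * ln (INR (n + (m - n))))).
    lra.
- assert (P : Rpower (INR n) (- (Re s / 2)) <= Rpower (INR n) (- (1 / 4))).
  { apply Rle_Rpower; [now apply INR_ge_1|lra]. }
  rewrite <- Rmult_assoc; apply Rmult_le_compat; trivial; try lra.
  left; apply exp_pos.
Qed.

(** * Choice of the parameters *)

Definition nfloor (x : R) : nat := Z.to_nat (Zfloor x).

Lemma nfloor_bound x : 0 <= x -> INR (nfloor x) <= x < INR (nfloor x) + 1.
Proof.
intros Hx; unfold nfloor; assert (F := Zfloor_bound x).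
assert (0 <= Zfloor x)%Z by (apply Z.lt_succ_r, lt_IZR; rewrite succ_IZR; lra).
rewrite INR_IZR_INZ, Z2Nat.id by trivial; lra.
Qed.

Lemma exp_le x y : x <= y -> exp x <= exp y.
Proof. intros [H| ->]; [left; now apply exp_increasing|lra]. Qed.

Lemma exp_pow x n : exp x ^ n = exp (INR n * x).
Proof.
induction n as [|n IH]; [simpl; now rewrite Rmult_0_l, exp_0|].
rewrite S_INR; simpl pow; rewrite IH, <- exp_plus; f_equal; ring.
Qed.

Lemma nfloor_exp_ge x y : 0 <= y -> y + 1 <= x -> exp y <= INR (nfloor (exp x)).
Proof.
intros Hy H; assert (B := nfloor_bound (exp x) ltac:(left; apply exp_pos)).
assert (E1 : exp y * exp 1 <= exp x) by (rewrite <- exp_plus; apply exp_le; lra).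
assert (E2 := exp_ineq1_le 1); assert (E3 := exp_ineq1_le y).
nra.
Qed.

Definition ev (P : R -> Prop) : Prop := exists l0, forall l, l0 <= l -> P l.

Lemma ev_and P Q : ev P -> ev Q -> ev (fun l => P l /\ Q l).
Proof.
intros [a Ha] [b Hb]; exists (Rmax a b); intros l Hl; split;
  [apply Ha; eapply Rle_trans; [apply Rmax_l|exact Hl]
  |apply Hb; eapply Rle_trans; [apply Rmax_r|exact Hl]].
Qed.

Lemma ev_ge K : ev (fun l => K <= l).
Proof. now exists K. Qed.

Lemma ev_exp a K : 0 < a -> ev (fun l => K * l <= exp (a * l)).
Proof.
intros Ha; exists (Rmax 0 (4 * K / a ^ 2)); intros l Hl.
assert (H0 : 0 <= l) by (eapply Rle_trans; [apply Rmax_l|exact Hl]).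
assert (H1 : 4 * K / a ^ 2 <= l) by (eapply Rle_trans; [apply Rmax_r|exact Hl]).
replace (a * l) with (a * l / 2 + a * l / 2) by field; rewrite exp_plus.
assert (E := exp_ineq1_le (a * l / 2)).
assert (P : 0 <= a * l) by (apply Rmult_le_pos; lra).
apply Rle_trans with ((a * l / 2) * (a * l / 2)).
- assert (Q : 0 < a ^ 2) by (apply pow_lt; lra).
  apply (Rmult_le_compat_r (a ^ 2)) in H1; [|lra].
  unfold Rdiv in H1; rewrite Rmult_assoc, Rinv_l in H1 by lra.
  replace (a * l / 2 * (a * l / 2)) with (a ^ 2 * l / 4 * l) by field.
  apply Rmult_le_compat_r; lra.
- apply Rmult_le_compat; lra.
Qed.

Lemma dirpoly_split X N b t : (X <= N)%nat -> (forall n, 0 <= b n) ->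
  Cmod (dirpoly X b t)
  <= Cmod (dirpoly N b t) + lsum (List.seq (1 + X) (N - X)) b.
Proof.
intros H Hb; unfold dirpoly at 2.
replace N with (X + (N - X))%nat at 1 by lia; rewrite seq_app, csum_app.
fold (dirpoly X b t); set (y := csum (List.seq (1 + X) (N - X)) _).
replace (dirpoly X b t) with ((dirpoly X b t + y) + - y)%C at 1 by ring.
eapply Rle_trans; [apply Cmod_triangle|]; apply Rplus_le_compat_l.
rewrite Cmod_opp; unfold y; eapply Rle_trans; [apply Cmod_csum|].
apply lsum_le; intros n _; rewrite Cmod_mult, Cmod_cis, Cmod_R, Rmult_1_r.
rewrite Rabs_pos_eq; [lra|trivial].
Qed.

(** The range of [t] leaves room for the window inside [[T^beta, T]]. The kernel has to be bounded
    below up to [ln (G * G)] and negligible beyond [ln (G ^ 16)]. *)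
Lemma smoothing_exists beta : 0 < beta < 1 -> ev (fun l =>
  let G := nfloor (exp (beta / 100 * l)) in
  exists a : nat -> R, (forall n, 0 <= a n <= 66) /\
    (forall n, (1 <= n <= G * G)%nat -> 3 / 8 <= a n) /\
    forall sigma t, 1 / 2 <= sigma < 1 ->
      2 * exp (beta * l) <= t <= exp l / 2 ->
      Cmod (dirpoly (G ^ 16) (fun n => a n * w sigma n) t)
      <= 66 * Zbeta beta sigma (exp l) + exp (- l)).
Proof.
(* Solves [K^2 (16 beta / 4000)^2 / 64 = 100], so that the tail of the kernel is at most
   [Q T^(-100)]. *)
intros Hb; set (K := 20000 / beta).
assert (HK : 20000 <= K).
{ unfold K; apply Rmult_le_reg_r with beta; [lra|].
  unfold Rdiv; rewrite Rmult_assoc, Rinv_l by lra; lra. }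
assert (HK2 : 4 * 10 ^ 8 <= K ^ 2) by (simpl; nra).
(* The constant [6336 = 3 * 32 * 66] absorbs the truncation error [32 exp (- 3 l)], times the kernel
   mass 66, into [exp (- l) / 3]. *)
destruct (ev_and _ _ (ev_and _ _ (ev_ge (200 / beta + 6336)) (ev_exp 1 (4 * K ^ 2) ltac:(lra)))
  (ev_exp beta (1024 * K ^ 2) ltac:(lra))) as [l0 Hl0].
exists l0; intros l Hl; specialize (Hl0 l Hl); destruct Hl0 as [[L1 L2] L3].
rewrite Rmult_1_l in L2; clear l0 Hl.
assert (Hib : 0 < / beta) by (apply Rinv_0_lt_compat; lra).
assert (L4 : 6336 <= l) by (unfold Rdiv in L1; lra).
assert (L5 : 200 <= beta * l).
{ apply (Rmult_le_compat_l beta) in L1; [|lra].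
  replace (beta * (200 / beta + 6336)) with (200 + beta * 6336) in L1 by (field; lra); lra. }
intros G.
assert (G1 : INR G <= exp (beta / 100 * l)) by (apply nfloor_bound; left; apply exp_pos).
assert (G2 : exp (beta / 200 * l) <= INR G) by (apply nfloor_exp_ge; lra).
assert (Gpos : 1 < INR G).
{ eapply Rlt_le_trans; [|exact G2]; rewrite <- exp_0; apply exp_increasing; lra. }
assert (G1' : ln (INR G) <= beta / 100 * l) by (rewrite <- (ln_exp (beta / 100 * l)); apply ln_le; lra).
assert (G2' : beta / 200 * l <= ln (INR G)).
{ rewrite <- (ln_exp (beta / 200 * l)); apply ln_le; [apply exp_pos|lra]. }
set (h := / (20 * l)).
assert (Hh : 0 < h) by (apply Rinv_0_lt_compat; lra).
assert (hl : h * l = / 20) by (unfold h; field; lra).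
set (th := h * ln (INR G)).
assert (T1 : th <= beta / 2000).
{ unfold th; apply (Rmult_le_compat_l h) in G1'; [|lra].
  replace (h * (beta / 100 * l)) with (beta / 100 * (h * l)) in G1' by ring.
  rewrite hl in G1'; lra. }
assert (T2 : beta / 4000 <= th).
{ unfold th; apply (Rmult_le_compat_l h) in G2'; [|lra].
  replace (h * (beta / 200 * l)) with (beta / 200 * (h * l)) in G2' by ring.
  rewrite hl in G2'; lra. }
(* A cutoff near T^20 makes the truncation error [O(T^(-3))]. It also puts [h ln N] in [1/2, 1],
   beyond all Fejer frequencies, so that the pole term is damped. *)
set (N := nfloor (exp (20 * l))).
assert (N1 : INR N <= exp (20 * l)) by (apply nfloor_bound; left; apply exp_pos).
assert (N2 : exp (19 * l) <= INR N) by (apply nfloor_exp_ge; lra).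
assert (N3 : 1 <= INR N).
{ eapply Rle_trans; [|exact N2]; rewrite <- exp_0; apply exp_le; lra. }
assert (HN : (1 <= N)%nat) by (apply INR_le; simpl; lra).
assert (N1' : h * ln (INR N) <= 1).
{ apply Rle_trans with (h * (20 * l)); [|right; unfold h; field; lra].
  apply Rmult_le_compat_l; [lra|]; rewrite <- (ln_exp (20 * l)); apply ln_le; lra. }
assert (N2' : 1 / 2 <= h * ln (INR N)).
{ apply Rle_trans with (h * (19 * l)); [lra|].
  apply Rmult_le_compat_l; [lra|]; rewrite <- (ln_exp (19 * l)); apply ln_le;
    [apply exp_pos|lra]. }
assert (Sl : 1 <= sqrt l) by (rewrite <- sqrt_1; apply sqrt_le_1_alt; lra).
assert (Sl2 : sqrt l * sqrt l = l) by (apply sqrt_sqrt; lra).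
set (B := S (nfloor (K * sqrt l))).
assert (HB := nfloor_bound (K * sqrt l) ltac:(nra)).
assert (B1 : K * sqrt l <= INR B) by (unfold B; rewrite S_INR; lra).
assert (B2 : INR B <= 2 * (K * sqrt l)) by (unfold B; rewrite S_INR; nra).
assert (B3 : 20000 <= INR B) by nra.
set (A := (B * B)%nat).
assert (A1 : K ^ 2 * l <= INR A).
{ unfold A; rewrite mult_INR.
  replace (K ^ 2 * l) with ((K * sqrt l) * (K * sqrt l)) by (rewrite <- Sl2 at 3; ring).
  apply Rmult_le_compat; nra. }
assert (A2 : INR A <= 4 * K ^ 2 * l).
{ unfold A; rewrite mult_INR.
  replace (4 * K ^ 2 * l) with ((2 * (K * sqrt l)) * (2 * (K * sqrt l)))
    by (rewrite <- Sl2 at 3; ring).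
  apply Rmult_le_compat; lra. }
(* [Q / B] must lie in [[4 th, 8 th]]: the lower end makes the plateau reach [2 th = h ln (G^2)],
   and the upper end makes the tail start by [16 th = h ln (G^16)]. *)
set (Q := nfloor (8 * th * INR B)).
assert (HQ := nfloor_bound (8 * th * INR B) ltac:(nra)); fold Q in HQ.
assert (thB : 5 <= th * INR B).
{ apply Rle_trans with (beta / 4000 * K).
  - unfold K; right; field; lra.
  - apply Rmult_le_compat; nra. }
assert (Q1 : INR Q / INR B <= 8 * th).
{ apply Rmult_le_reg_r with (INR B); [lra|].
  unfold Rdiv; rewrite Rmult_assoc, Rinv_l by lra; lra. }
assert (Q2 : 4 * th <= INR Q / INR B).
{ apply Rmult_le_reg_r with (INR B); [lra|].
  unfold Rdiv; rewrite (Rmult_assoc (INR Q)), Rinv_l by lra; lra. }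
assert (HQ0 : (0 < Q)%nat) by (apply INR_lt; simpl; lra).
assert (HB0 : (0 < B)%nat) by (unfold B; lia).
assert (Q3 : INR Q <= exp l).
{ apply Rle_trans with (INR A); [|lra].
  unfold A; rewrite mult_INR.
  apply Rle_trans with (INR B); [|nra].
  apply Rle_trans with (8 * th * INR B); [lra|].
  rewrite <- (Rmult_1_l (INR B)) at 2; apply Rmult_le_compat_r; lra. }
set (D := / INR B / h).
set (a := fun n => khat h D Q A (ln (INR n))).
assert (Kmax : khat h D Q A 0 <= 66) by (apply (khat_0_le h Q B); trivial; lra).
assert (Ka : forall n, 0 <= a n <= 66).
{ intros n; split; [exact (khat_ge_0 h D Q A HQ0 (ln (INR n)))|].
  exact (Rle_trans _ _ _ (khat_le h D Q A Hh HQ0 (ln (INR n))) Kmax). }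
exists a; split; [exact Ka|]; split.
{ intros n Hn; apply (khat_large h Q B); trivial.
  - apply Rmult_le_pos; [lra|apply ln_ge_0, INR_ge_1; lia].
  - apply Rle_trans with (2 * th); [|lra].
    unfold th; replace (2 * (h * ln (INR G))) with (h * (ln (INR G) + ln (INR G))) by ring.
    apply Rmult_le_compat_l; [lra|].
    rewrite <- ln_mult, <- mult_INR by lra; apply ln_le.
    + apply lt_0_INR; lia.
    + apply le_INR; lia. }
intros sigma t Hs Ht.
set (Z := Zbeta beta sigma (exp l)).
assert (HT : Rpower (exp l) beta = exp (beta * l)) by (unfold Rpower; now rewrite ln_exp).
assert (HTle : exp (beta * l) <= exp l) by (apply exp_le; nra).
destruct (Zbeta_is_max beta sigma (exp l)) as [_ HZ]; [lra|lra|now rewrite HT|].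
rewrite HT in HZ; fold Z in HZ.
assert (U0 : INR A * h <= K ^ 2 / 5).
{ apply (Rmult_le_compat_r h) in A2; [|lra].
  replace (4 * K ^ 2 * l * h) with (4 * K ^ 2 * (h * l)) in A2 by ring.
  rewrite hl in A2; lra. }
assert (Eb := exp_pos (beta * l)).
assert (U1 : INR A * h <= exp (beta * l) * (1 / 1024)) by nra.
assert (U2 : INR A * h <= exp l / 2) by lra.
assert (E20 := exp_pos (20 * l)).
assert (eta1 : exp (- l) = exp (- (3 * l)) * exp (2 * l)).
{ rewrite <- exp_plus; f_equal; ring. }
assert (e2l : 1 + 2 * l <= exp (2 * l)) by apply exp_ineq1_le.
assert (em3 := exp_pos (- (3 * l))).
assert (MZ := smooth_zeta h D Q A Hh HQ0 sigma t N Z (32 * exp (- (3 * l)))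
  (exp (beta * l)) (1 / 1024) (1 - 1 / 512)).
assert (MZ' : Cmod (dirpoly N (fun n => a n * w sigma n) t)
  <= (Z + 32 * exp (- (3 * l))) * khat h D Q A 0
     + Rpower (INR N) (1 - sigma) * (INR Q * ((1 - 1 / 512 + 1 / 1024) ^ (2 * A) / exp (beta * l)))).
{ apply MZ; trivial; try lra.
  - intros u Hu; apply Rabs_le_between in Hu.
    eapply Rle_trans; [|apply Rle_abs]; lra.
  - intros p q Hp Hq; apply (cos_pole_le h Q B); trivial; lra.
  - intros u Hu; apply Rabs_le_between in Hu; apply HZ.
    rewrite Rabs_pos_eq by lra; lra.
  - intros u Hu; apply Rabs_le_between in Hu.
    eapply Rle_trans; [apply zeta_trunc_approx; [exact Hs|exact HN]|].
    rewrite Rabs_pos_eq by lra.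
    assert (P1 : Rpower (INR N) (- (1 / 4)) <= exp (- (4 * l))).
    { unfold Rpower; apply exp_le.
      assert (19 * l <= ln (INR N)).
      { rewrite <- (ln_exp (19 * l)); apply ln_le; [apply exp_pos|lra]. }
      lra. }
    assert (P2 : 1 <= exp l) by (rewrite <- exp_0; apply exp_le; lra).
    apply Rle_trans with (16 * (2 * exp l) * exp (- (4 * l))).
    + apply Rmult_le_compat; [lra|left; apply exp_pos|lra|exact P1].
    + right; replace (16 * (2 * exp l) * exp (- (4 * l))) with (32 * (exp l * exp (- (4 * l)))) by ring.
      rewrite <- exp_plus; do 2 f_equal; ring. }
assert (Xle : (G ^ 16 <= N)%nat).
{ apply INR_le; rewrite pow_INR; eapply Rle_trans; [|exact N2].
  eapply Rle_trans; [apply pow_incr; split; [lra|exact G1]|].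
  rewrite exp_pow; apply exp_le; replace (INR 16) with 16 by (simpl; ring); nra. }
eapply Rle_trans; [apply (dirpoly_split (G ^ 16) N); trivial|].
{ intros; apply Rmult_le_pos; [apply Ka|apply w_ge_0]. }
assert (Z0 : 0 <= Z).
{ eapply Rle_trans; [apply Cmod_ge_0|apply (HZ t)]; rewrite Rabs_pos_eq; lra. }
assert (Er1 : (Z + 32 * exp (- (3 * l))) * khat h D Q A 0 <= 66 * Z + exp (- l) / 3).
{ apply Rle_trans with ((Z + 32 * exp (- (3 * l))) * 66).
  - apply Rmult_le_compat_l; [lra|exact Kmax].
  - rewrite eta1; nra. }
(* Both the pole and the tail are bounded by T^20 * T * T^(-100). *)
assert (e1 : exp (- (79 * l)) <= exp (- l) / 3).
{ replace (- (79 * l)) with (- l + - (78 * l)) by ring; rewrite exp_plus.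
  apply Rmult_le_compat_l; [left; apply exp_pos|].
  rewrite exp_Ropp; apply Rinv_le_contravar; [lra|].
  generalize (exp_ineq1_le (78 * l)); lra. }
assert (Er2 : Rpower (INR N) (1 - sigma) * (INR Q *
   ((1 - 1 / 512 + 1 / 1024) ^ (2 * A) / exp (beta * l))) <= exp (- l) / 3).
{ eapply Rle_trans; [|exact e1].
  apply Rle_trans with (exp (20 * l) * (exp l * (exp (- (100 * l))))).
  - assert (P1 : Rpower (INR N) (1 - sigma) <= exp (20 * l)).
    { eapply Rle_trans; [|exact N1]; rewrite <- (Rpower_1 (INR N)) at 2 by lra.
      apply Rle_Rpower; lra. }
    assert (P2 : (1 - 1 / 512 + 1 / 1024) ^ (2 * A) <= exp (- (100 * l))).
    { replace (1 - 1 / 512 + 1 / 1024) with (1 - 1 / 1024) by field.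
      eapply Rle_trans; [apply pow_le_exp; lra|]; apply exp_le.
      rewrite mult_INR; simpl (INR 2); nra. }
    assert (P3 : 0 <= (1 - 1 / 512 + 1 / 1024) ^ (2 * A)) by (apply pow_le; lra).
    assert (P4 : 1 <= exp (beta * l)) by (rewrite <- exp_0; apply exp_le; nra).
    assert (P5 : (1 - 1 / 512 + 1 / 1024) ^ (2 * A) / exp (beta * l)
       <= exp (- (100 * l))).
    { apply Rmult_le_reg_r with (exp (beta * l)); [lra|].
      unfold Rdiv; rewrite Rmult_assoc, Rinv_l by lra; rewrite Rmult_1_r.
      generalize (exp_pos (- (100 * l))); nra. }
    assert (P6 : 0 <= (1 - 1 / 512 + 1 / 1024) ^ (2 * A) / exp (beta * l))
      by (apply Rdiv_le_0_compat; lra).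
    apply Rmult_le_compat; trivial.
    + left; apply exp_pos.
    + apply Rmult_le_pos; [apply pos_INR|trivial].
    + apply Rmult_le_compat; trivial; apply pos_INR.
  - rewrite <- !exp_plus; apply exp_le; lra. }
assert (Er3 : lsum (List.seq (1 + G ^ 16) (N - G ^ 16)) (fun n => a n * w sigma n)
   <= exp (- l) / 3).
{ eapply Rle_trans; [|exact e1].
  apply Rle_trans with (lsum (List.seq (1 + G ^ 16) (N - G ^ 16))
    (fun _ => exp l * exp (- (100 * l)))).
  - apply lsum_le; intros n Hn; apply in_seq in Hn.
    assert (Hn1 : 1 <= INR n) by (apply INR_ge_1; lia).
    assert (Hn2 : h * ln (INR n) <= 1).
    { eapply Rle_trans; [|exact N1']; apply Rmult_le_compat_l; [lra|].
      apply ln_le; [lra|]; apply le_INR; lia. }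
    assert (Hn3 : 16 * th <= h * ln (INR n)).
    { unfold th; replace (16 * (h * ln (INR G))) with (h * (INR 16 * ln (INR G)))
        by (simpl; ring).
      apply Rmult_le_compat_l; [lra|].
      rewrite <- ln_pow by lra; rewrite <- pow_INR; apply ln_le.
      - apply lt_0_INR; assert (G <> 0)%nat by (intros E; rewrite E in Gpos; simpl in Gpos; lra).
        apply Nat.neq_0_lt_0, Nat.pow_nonzero; trivial.
      - apply le_INR; lia. }
    rewrite <- (Rmult_1_r (exp l * _)).
    apply Rmult_le_compat; [apply Ka|apply w_ge_0| |].
    + unfold a; eapply Rle_trans; [apply (khat_tail h Q B); trivial; lra|].
      apply Rmult_le_compat; [apply pos_INR|left; apply exp_pos|exact Q3|].
      apply exp_le; fold A.
      assert (S1 : (16 * (beta / 4000)) ^ 2 <= (h * ln (INR n)) ^ 2)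
        by (apply pow_incr; lra).
      assert (S2 : 100 * l <= K ^ 2 * l * ((16 * (beta / 4000)) ^ 2 / 64)).
      { right; unfold K; field; lra. }
      assert (S3 : K ^ 2 * l * ((16 * (beta / 4000)) ^ 2 / 64)
        <= INR A * ((h * ln (INR n)) ^ 2 / 64)).
      { apply Rmult_le_compat; try lra; nra. }
      lra.
    + rewrite <- (w_1 sigma); apply w_decr; [lra|lia].
  - rewrite lsum_const, length_seq.
    apply Rle_trans with (exp (20 * l) * (exp l * exp (- (100 * l)))).
    + apply Rmult_le_compat_r.
      * apply Rmult_le_pos; left; apply exp_pos.
      * eapply Rle_trans; [|exact N1]; apply le_INR; lia.
    + rewrite <- !exp_plus; apply exp_le; lra. }
lra.
Qed.

(** * Conclusion *)

Lemma pow2_between y : 1 <= y -> exists i, y <= 2 ^ i <= 2 * y.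
Proof.
intros Hy.
assert (X : exists n, y <= 2 ^ n).
{ destruct (Pow_x_infinity 2 ltac:(rewrite Rabs_pos_eq; lra) y) as [n Hn].
  exists n; specialize (Hn n (le_n _)); rewrite Rabs_pos_eq in Hn; [lra|].
  apply pow_le; lra. }
destruct X as [n Hn]; induction n as [|n IH].
- exists 0%nat; simpl in *; lra.
- destruct (Rle_lt_dec y (2 ^ n)) as [H|H]; [auto|].
  exists (S n); simpl in *; lra.
Qed.

Lemma ev_ln_cube K : ev (fun l => 1 <= ln l /\ K * ln l ^ 3 <= l).
Proof.
exists (exp (Rmax 1 (256 * K))); intros l Hl.
assert (P := exp_pos (Rmax 1 (256 * K))).
assert (H : Rmax 1 (256 * K) <= ln l).
{ rewrite <- (ln_exp (Rmax 1 (256 * K))); apply ln_le; trivial. }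
assert (H1 : 1 <= ln l) by (eapply Rle_trans; [apply Rmax_l|exact H]).
assert (H2 : 256 * K <= ln l) by (eapply Rle_trans; [apply Rmax_r|exact H]).
split; trivial.
rewrite <- (exp_ln l) at 2 by lra; set (L := ln l) in *.
replace (exp L) with (exp (L / 4) ^ 4) by (rewrite exp_pow; f_equal; simpl; field).
apply Rle_trans with ((L / 4) ^ 4).
- replace ((L / 4) ^ 4) with (L / 256 * L ^ 3) by field.
  apply Rmult_le_compat_r; [apply pow_le; lra|lra].
- apply pow_incr; generalize (exp_ineq1_le (L / 4)); lra.
Qed.

Definition posset (M : list nat) : Prop :=
  M <> [] /\ NoDup M /\ (forall z, In z M -> 0 < z)%nat.

(** Let [L = ln l]. Lowering the exponent by [d = 1 / (2 L)] leaves [2 (sigma - d) >= 1 + 1 / L], so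
    that [Z = 1 + L] is admissible. With [j] of order [L], the gain [j d ln G] is of order [l],
    while [j^2 ln Z] is only [O(L^3)]. *)
Lemma gtrunc_half beta : 0 < beta < 1 -> ev (fun l => forall sigma M,
  1 / 2 + 1 / ln l <= sigma < 1 -> posset M -> INR (length M) <= exp l ->
  gsum sigma M / 2 <= gtrunc sigma (nfloor (exp (beta / 100 * l))) M).
Proof.
(* Makes [(c / 2) L * d * (beta / 200) l] equal to [3 l]: one [l] pays for [ln N], one for the terms
   [j^2 L + j], and one is spare. *)
intros Hb; set (c := 2400 / beta).
assert (Hc : 2400 <= c).
{ unfold c; apply Rmult_le_reg_r with beta; [lra|].
  unfold Rdiv; rewrite Rmult_assoc, Rinv_l; lra. }
destruct (ev_and _ _ (ev_ge (200 / beta)) (ev_ln_cube (c ^ 2 + c))) as [l0 Hl0].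
exists l0; intros l Hl sigma M Hs [M0 [ND Mp]] HM.
specialize (Hl0 l Hl); destruct Hl0 as [L1 [L2 L3]].
assert (L5 : 200 <= beta * l).
{ apply (Rmult_le_compat_l beta) in L1; [|lra].
  replace (beta * (200 / beta)) with 200 in L1 by (field; lra); lra. }
assert (Lpos : 0 < l) by nra.
set (G := nfloor (exp (beta / 100 * l))).
assert (G2 : exp (beta / 200 * l) <= INR G) by (apply nfloor_exp_ge; lra).
assert (Gpos : 1 < INR G).
{ eapply Rlt_le_trans; [|exact G2]; rewrite <- exp_0; apply exp_increasing; lra. }
assert (G2' : beta / 200 * l <= ln (INR G)).
{ rewrite <- (ln_exp (beta / 200 * l)); apply ln_le; [apply exp_pos|lra]. }
assert (HG : (0 < G)%nat) by (apply INR_lt; simpl; lra).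
set (L := ln l) in *.
set (d := / (2 * L)).
assert (Hd : 0 < d) by (apply Rinv_0_lt_compat; lra).
assert (Hd2 : 1 / L = 2 * d) by (unfold d; field; lra).
apply (gtrunc_ge sigma d); trivial; try lra.
destruct (pow2_between (c / 2 * L)) as [i Hi]; [nra|].
set (j := 2 ^ i) in *.
set (X := exp (d * ln (INR G)) / 2).
assert (HX : 0 < X) by (generalize (exp_pos (d * ln (INR G))); unfold X; lra).
assert (Hw : w d G * X = / 2).
{ unfold w, X, Rpower; replace (- d * ln (INR G)) with (- (d * ln (INR G))) by ring.
  rewrite exp_Ropp; field; apply Rgt_not_eq, exp_pos. }
cut (gsum (sigma - d) M <= INR (length M) * X).
{ intros H; apply (Rmult_le_compat_l (w d G)) in H; [|apply w_ge_0].
  replace (w d G * (INR (length M) * X)) with (INR (length M) * (w d G * X)) in H by ring.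
  rewrite Hw in H; lra. }
apply (gal_bound_root (sigma - d) M i (1 + L)); trivial.
- intros B; eapply Rle_trans; [apply zs_bound; lra|]; apply Rplus_le_compat_l.
  replace L with (/ (2 * d)) by (unfold d; field; lra).
  apply Rinv_le_contravar; lra.
- assert (E1 : (1 + L) ^ (4 ^ i) <= exp (j * j * L)).
  { replace (j * j) with (INR (4 ^ i)).
    - rewrite <- exp_pow; apply pow_incr; split; [lra|apply exp_ineq1_le].
    - rewrite pow_INR; unfold j; rewrite <- Rpow_mult_distr; f_equal; simpl; ring. }
  assert (E2 : exp (j * (d * ln (INR G) - 1)) <= X ^ (2 ^ i)).
  { replace j with (INR (2 ^ i)) by (rewrite pow_INR; unfold j; f_equal).
    rewrite <- exp_pow; apply pow_incr; split; [left; apply exp_pos|].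
    unfold Rminus, X; rewrite exp_plus; unfold Rdiv.
    apply Rmult_le_compat_l; [left; apply exp_pos|].
    rewrite exp_Ropp; apply Rinv_le_contravar; [lra|].
    generalize (exp_ineq1_le 1); lra. }
  eapply Rle_trans; [|exact E2].
  eapply Rle_trans; [apply Rmult_le_compat; [apply pos_INR|apply pow_le; lra|exact HM|exact E1]|].
  rewrite <- exp_plus; apply exp_le.
  assert (j1 : 0 <= j) by nra.
  assert (F1 : 3 * l <= j * (d * ln (INR G))).
  { apply Rle_trans with (c / 2 * L * (d * (beta / 200 * l))).
    - right; unfold c, d; field; lra.
    - apply Rmult_le_compat; nra. }
  assert (F2 : j <= c * L) by lra.
  assert (F3 : j * j <= (c * L) * (c * L)) by (apply Rmult_le_compat; lra).
  assert (F4 : j * j * L <= c ^ 2 * L ^ 3) by (simpl; nra).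
  assert (F5 : L <= L ^ 3).
  { replace (L ^ 3) with (L * (L * L)) by ring; nra. }
  nra.
Qed.

(** The subtracted term is the cost of the points near the real axis. It is bounded when [N] is
    close to T^(1 - beta), and tiny for a fixed set [M]. *)
Lemma main_inequality beta : 0 < beta < 1 -> ev (fun l => forall sigma M,
  1 / 2 + 1 / ln l <= sigma < 1 -> posset M ->
  INR (length M) <= exp ((1 - beta) * l) ->
  9 / 512 * (gsum sigma M / INR (length M))
    - 1411344 * (INR (length M) * exp (- ((1 - beta) * l)))
  <= 8 * (66 * Zbeta beta sigma (exp l) + exp (- l)) ^ 2).
Proof.
intros Hb.
destruct (ev_and _ _ (ev_and _ _ (smoothing_exists beta Hb) (gtrunc_half beta Hb))
  (ev_and _ _ (ev_ge (200 / beta)) (ev_ln_cube 1))) as [l0 Hl0].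
exists l0; intros l Hl sigma M Hs HM HN.
specialize (Hl0 l Hl); destruct Hl0 as [[HS HT] [L1 [L2 L3]]].
assert (L5 : 200 <= beta * l).
{ apply (Rmult_le_compat_l beta) in L1; [|lra].
  replace (beta * (200 / beta)) with 200 in L1 by (field; lra); lra. }
assert (L6 : 200 <= l) by nra.
set (G := nfloor (exp (beta / 100 * l))) in *.
destruct HS as [a [Ha1 [Ha2 Ha3]]].
assert (G1 : INR G <= exp (beta / 100 * l)) by (apply nfloor_bound; left; apply exp_pos).
assert (G2 : exp (beta / 200 * l) <= INR G) by (apply nfloor_exp_ge; lra).
assert (Gpos : 1 < INR G).
{ eapply Rlt_le_trans; [|exact G2]; rewrite <- exp_0; apply exp_increasing; lra. }
assert (HG : (0 < G)%nat) by (apply INR_lt; simpl; lra).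
assert (Hs2 : 1 / 2 <= sigma < 1).
{ assert (0 < 1 / ln l) by (apply Rdiv_lt_0_compat; lra); lra. }
assert (Hgt : gsum sigma M / 2 <= gtrunc sigma G M).
{ apply HT; trivial; eapply Rle_trans; [exact HN|apply exp_le; nra]. }
clear HT.
set (h := / (20 * l)).
assert (Hh : 0 < h) by (apply Rinv_0_lt_compat; lra).
assert (hl : h * l = / 20) by (unfold h; field; lra).
assert (Tpos := exp_pos l); assert (tpos := exp_pos (beta * l)).
assert (T1 := exp_ineq1_le l); assert (t1 := exp_ineq1_le (beta * l)).
set (J1 := nfloor (10 * l * exp l)).
set (J' := S (nfloor (40 * l * exp (beta * l)))).
assert (BJ1 := nfloor_bound (10 * l * exp l) ltac:(nra)); fold J1 in BJ1.
assert (BJ' := nfloor_bound (40 * l * exp (beta * l)) ltac:(nra)).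
assert (J1b : 5 * l * exp l <= INR J1) by nra.
assert (J'a : 40 * l * exp (beta * l) <= INR J') by (unfold J'; rewrite S_INR; lra).
assert (J'b : INR J' <= 41 * l * exp (beta * l)) by (unfold J'; rewrite S_INR; nra).
assert (J1pos : 0 < INR J1) by nra.
set (V := 66 * Zbeta beta sigma (exp l) + exp (- l)) in *.
destruct HM as [M0 [ND Mp]].
set (n := INR (length M)) in *.
assert (Hn : 1 <= n).
{ apply INR_ge_1; destruct M; [easy|simpl; lia]. }
assert (HX : INR (G ^ 16) <= exp (16 * beta / 100 * l)).
{ rewrite pow_INR; eapply Rle_trans; [apply pow_incr; split; [lra|exact G1]|].
  rewrite exp_pow; apply exp_le; simpl; lra. }
assert (HX0 : (0 < G ^ 16)%nat) by (apply Nat.neq_0_lt_0, Nat.pow_nonzero; lia).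
assert (HB : forall j, (J' <= j < J1)%nat ->
   Cmod (dirpoly (G ^ 16) (fun n => a n * w sigma n) (h * INR j)) <= V).
{ intros j [Hj1 Hj2]; apply le_INR in Hj1; apply lt_INR in Hj2.
  apply Ha3; trivial; split.
  - apply Rle_trans with (h * (40 * l * exp (beta * l))).
    + right; unfold h; field; lra.
    + apply Rmult_le_compat_l; lra.
  - apply Rle_trans with (h * (10 * l * exp l)).
    + apply Rmult_le_compat_l; lra.
    + right; unfold h; field; lra. }
assert (HV : 0 <= V).
{ destruct (Zbeta_is_max beta sigma (exp l)) as [[t [_ E]] _]; [lra|lra| |].
  - unfold Rpower; rewrite ln_exp; apply exp_le; nra.
  - unfold V; rewrite E.
    generalize (Cmod_ge_0 (zeta (sigma, t))) (exp_pos (- l)); lra. }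
assert (R := resonance M J1 J' G (G ^ 16) a h sigma V 66 (3 / 8)).
assert (Hln : forall k, (1 <= k <= G ^ 16)%nat -> h * ln (INR k) <= 1).
{ intros k [Hk1 Hk2]; apply le_INR in Hk2.
  assert (1 <= INR k) by now apply INR_ge_1.
  assert (ln (INR k) <= l).
  { rewrite <- (ln_exp l); apply ln_le; [lra|].
    eapply Rle_trans; [exact Hk2|]; eapply Rle_trans; [exact HX|apply exp_le; nra]. }
  apply Rle_trans with (h * l); [apply Rmult_le_compat_l; lra|lra]. }
specialize (R ltac:(apply INR_lt; simpl; lra) ND Mp).
specialize (R ltac:(replace (G * G)%nat with (G ^ 2)%nat by (simpl; lia);
  apply Nat.pow_le_mono_r; lia)).
specialize (R Hh HV ltac:(lra) ltac:(lra) Hln Ha1 Ha2 HB).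
fold n in R; clear HB Ha1 Ha2 Ha3 Hln.
set (zG := zs (2 * sigma) G) in *.
assert (zG1 : 1 <= zG) by now apply zs_ge_1.
assert (zX : zs (2 * sigma) (G ^ 16) <= 17 * zG).
{ eapply Rle_trans; [apply zs_pow; [lra|exact HG]|].
  fold zG; right; f_equal; simpl; ring. }
assert (X3 : 4 * INR (G ^ 16) ^ 3 / h <= INR J' * zG).
{ apply Rle_trans with (INR J').
  2: { rewrite <- (Rmult_1_r (INR J')) at 1; apply Rmult_le_compat_l; lra. }
  eapply Rle_trans; [|exact J'a].
  assert (X4 : INR (G ^ 16) ^ 3 <= exp (beta / 2 * l)).
  { eapply Rle_trans; [apply pow_incr; split; [apply pos_INR|exact HX]|].
    rewrite exp_pow; apply exp_le; simpl; lra. }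
  assert (X5 : 2 * exp (beta / 2 * l) <= exp (beta * l)).
  { replace (beta * l) with (beta / 2 * l + beta / 2 * l) by field; rewrite exp_plus.
    generalize (exp_ineq1_le (beta / 2 * l)); intros.
    apply Rmult_le_compat_r; [left; apply exp_pos|lra]. }
  replace (4 * INR (G ^ 16) ^ 3 / h) with (40 * l * (2 * INR (G ^ 16) ^ 3))
    by (unfold h; field; lra).
  apply Rmult_le_compat_l; lra. }
set (r := exp (- ((1 - beta) * l))).
assert (rE : exp (beta * l) = r * exp l).
{ unfold r; rewrite <- exp_plus; f_equal; ring. }
assert (rpos : 0 < r) by apply exp_pos.
assert (JJ : INR J' <= 9 * r * INR J1).
{ apply Rle_trans with (9 * r * (5 * l * exp l)).
  - eapply Rle_trans; [exact J'b|]; rewrite rE.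
    replace (41 * l * (r * exp l)) with (41 * (l * (r * exp l))) by ring.
    replace (9 * r * (5 * l * exp l)) with (45 * (l * (r * exp l))) by ring.
    apply Rmult_le_compat_r; [|lra].
    repeat apply Rmult_le_pos; lra.
  - apply Rmult_le_compat_l; lra. }
set (S0 := gsum sigma M) in *.
assert (S1 : n <= S0) by now apply gsum_ge_length.
(* Here [9/512 = (3/8)^2 / 8] and [1411344 = 2 * 66^2 * 18 * 9]; the 18 is the 17 of [zs_pow] plus 1
   for the off-diagonal error [X3], and the 9 comes from [JJ]. *)
assert (R2 : INR J1 ^ 2 * n * (9 / 512 * (S0 / n) * zG)
  <= INR J1 ^ 2 * n * (8 * V ^ 2 + 1411344 * (n * r) * zG)).
{ apply Rle_trans with (INR J1 ^ 2 / 4 * ((3 / 8) ^ 2 * (zG * gtrunc sigma G M))).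
  - apply Rle_trans with (INR J1 ^ 2 / 4 * ((3 / 8) ^ 2 * (zG * (S0 / 2)))).
    + right; field; lra.
    + apply Rmult_le_compat_l; [generalize (pow2_ge_0 (INR J1)); lra|].
      apply Rmult_le_compat_l; [apply pow2_ge_0|].
      apply Rmult_le_compat_l; lra.
  - eapply Rle_trans; [exact R|].
    rewrite (Rmult_plus_distr_l (INR J1 ^ 2 * n)).
    apply Rplus_le_compat; [right; ring|].
    replace (INR J1 ^ 2 * n * (1411344 * (n * r) * zG)) with
      (n ^ 2 * (INR J1 * (2 * 66 ^ 2 * (18 * ((9 * r * INR J1) * zG))))) by ring.
    apply Rmult_le_compat_l; [apply pow2_ge_0|].
    apply Rmult_le_compat_l; [lra|].
    apply Rmult_le_compat_l; [lra|].
    apply Rle_trans with (18 * (INR J' * zG)).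
    + assert (INR J' * zs (2 * sigma) (G ^ 16) <= INR J' * (17 * zG))
        by (apply Rmult_le_compat_l; lra).
      lra.
    + apply Rmult_le_compat_l; [lra|]; apply Rmult_le_compat_r; lra. }
apply Rmult_le_reg_l in R2.
2: { apply Rmult_lt_0_compat; [apply pow_lt; lra|lra]. }
(* The common factor [zG] has been collected on the left, where [zG >= 1] lets it be dropped if [y]
   is positive. *)
set (y := 9 / 512 * (S0 / n) - 1411344 * (n * r)).
assert (Hy : y * zG <= 8 * V ^ 2) by (unfold y; lra).
assert (V2 := pow2_ge_0 V).
destruct (Rle_lt_dec y 0); [lra|nra].
Qed.

Theorem theorem1p3 :
  exists c : R, 0 < c /\
    forall beta : R, 0 < beta < 1 ->
    exists T0 : R, forall T : R, T0 <= T ->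
    forall sigma : R, 1 / 2 + 1 / ln (ln T) <= sigma < 1 ->
      Zbeta beta sigma T >= c * sqrt (GammaR sigma (Rpower T (1 - beta))).
Proof.
set (K := 1411344).
(* [76032000 = 66 * 64 * 18000], dictated by the bounded case: there [sqrt g <= 18000] and
   [Z >= 1 / (66 * 64)]. *)
exists (/ 76032000); split; [lra|]; intros beta Hb.
destruct (ev_and _ _ (main_inequality beta Hb)
  (ev_and _ _ (ev_ge (256 + 1024 * K / (1 - beta))) (ev_ln_cube 1))) as [l0 Hl0].
exists (exp l0); intros T HT sigma Hs.
assert (K0 : 0 < K) by (unfold K; lra).
assert (HT0 : 0 < T) by (generalize (exp_pos l0); lra).
set (l := ln T) in *.
assert (ET : T = exp l) by (symmetry; now apply exp_ln).
assert (Hl : l0 <= l) by (rewrite <- (ln_exp l0); apply ln_le; [apply exp_pos|trivial]).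
destruct (Hl0 l Hl) as [HI [L1 [L2 _]]]; clear Hl0.
assert (HK : 0 < 1024 * K / (1 - beta)) by (apply Rdiv_lt_0_compat; unfold K; lra).
assert (L3 : 1024 * K <= (1 - beta) * l).
{ assert (X : 1024 * K / (1 - beta) <= l) by lra.
  apply (Rmult_le_compat_l (1 - beta)) in X; [|lra].
  replace ((1 - beta) * (1024 * K / (1 - beta))) with (1024 * K) in X by (field; lra); lra. }
assert (Hs2 : 1 / 2 <= sigma < 1).
{ assert (0 < 1 / ln l) by (apply Rdiv_lt_0_compat; lra); lra. }
assert (Hexp : exp (- l) <= / 256).
{ rewrite exp_Ropp; apply Rinv_le_contravar; [lra|].
  generalize (exp_ineq1_le l); lra. }
assert (EP : Rpower T (1 - beta) = exp ((1 - beta) * l)) by reflexivity.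
rewrite EP; rewrite ET.
set (Z := Zbeta beta sigma (exp l)) in *.
assert (HZ0 : 0 <= Z).
{ destruct (Zbeta_is_max beta sigma (exp l)) as [[t [_ E]] _]; [lra|lra| |].
  - unfold Rpower; rewrite ln_exp; apply exp_le; nra.
  - unfold Z; rewrite E; apply Cmod_ge_0. }
set (N := nfloor (exp ((1 - beta) * l))).
change (GammaR sigma (exp ((1 - beta) * l))) with (Gamma sigma N).
assert (HN := nfloor_bound (exp ((1 - beta) * l)) ltac:(left; apply exp_pos)); fold N in HN.
assert (E1 := exp_ineq1_le ((1 - beta) * l)).
assert (HN1 : (1 <= N)%nat) by (apply INR_le; simpl; unfold K in *; lra).
assert (Er : exp ((1 - beta) * l) * exp (- ((1 - beta) * l)) = 1)
  by (rewrite <- exp_plus, <- exp_0; f_equal; ring).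
assert (Ep := exp_pos (- ((1 - beta) * l))).
set (g := Gamma sigma N).
assert (Lub := Gamma_is_lub sigma N ltac:(lra)); fold g in Lub.
(* Above this threshold the cost [K] is at most half of [9/512 * (g / 2)], the main term of a set
   whose ratio exceeds [g / 2]. *)
destruct (Rle_lt_dec (2048 * K / 9) g) as [Hg|Hg].
- assert (X : exists M, posset M /\ length M = N /\ g / 2 < gsum sigma M / INR N).
  { apply NNPP; intros H; destruct Lub as [_ Lub].
    assert (g <= g / 2); [|unfold K in Hg; lra].
    apply Lub; intros x [M [ND [HL [Mp ->]]]].
    rewrite gcd_sum_gsum by trivial.
    apply Rnot_lt_le; intros H'; apply H; exists M; repeat split; trivial.
    intros E; rewrite E in HL; simpl in HL; lia. }
  destruct X as [M [HM [HL HMg]]].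
  specialize (HI sigma M Hs HM); rewrite HL in HI; specialize (HI ltac:(lra)).
  assert (Y : INR N * exp (- ((1 - beta) * l)) <= 1).
  { eapply Rle_trans; [|right; exact Er]; apply Rmult_le_compat_r; lra. }
  fold Z in HI; set (V := 66 * Z + exp (- l)) in *.
  assert (HV : 9 / 16384 * g <= V ^ 2) by (unfold K in *; lra).
  assert (g1 : 1 <= g) by (unfold K in *; lra).
  assert (s1 : 1 <= sqrt g) by (rewrite <- sqrt_1; apply sqrt_le_1_alt; lra).
  assert (s2 : sqrt g * sqrt g = g) by (apply sqrt_sqrt; lra).
  assert (V1 : 3 / 128 * sqrt g <= V).
  { apply Rsqr_incr_0_var.
    - unfold Rsqr; lra.
    - unfold V; generalize (exp_pos (- l)); lra. }
  unfold V in V1; lra.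
(* For the singleton the ratio is 1 and the cost at most [1/1024], so zeta is bounded below by an
   absolute constant, which suffices because [g] is bounded here. *)
- assert (HM : posset [1%nat]).
  { repeat split; [discriminate|constructor; [easy|constructor]|].
    intros z [<-|[]]; lia. }
  specialize (HI sigma [1%nat] Hs HM).
  assert (G1 : gsum sigma [1%nat] = 1).
  { unfold gsum, lsum; simpl map; simpl fold_right.
    rewrite gk_same by lia; ring. }
  rewrite G1 in HI; simpl length in HI; simpl INR in HI.
  specialize (HI ltac:(lra)).
  assert (Y : 1024 * K * exp (- ((1 - beta) * l)) <= 1).
  { eapply Rle_trans; [|right; exact Er]; apply Rmult_le_compat_r; lra. }
  fold Z in HI; set (V := 66 * Z + exp (- l)) in *.
  assert (V1 : 1 / 32 <= V).
  { apply Rsqr_incr_0_var.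
    - unfold Rsqr; unfold K in *; lra.
    - unfold V; generalize (exp_pos (- l)); lra. }
  assert (s1 : sqrt g <= 18000).
  { rewrite <- (sqrt_square 18000) by lra; apply sqrt_le_1_alt; unfold K in *; lra. }
  unfold V in V1; lra.
Qed.
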